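(* Let $\ell\ge1$ be an integer, let $\mu,\omega$ be real with $\omega>0$, put $T=2\pi/\omega$, and let $\mathfrak{D}_\pm=\mathfrak{p}(1)\pm2\omega\,\mathfrak{r}(1)$, where $\mathfrak{p},\mathfrak{r}$ are the polynomials defined in the context; assume $\mathfrak{D}_+\neq0\neq\mathfrak{D}_-$. Let the functions $\Phi$ and $\Psi$ verify, respectively, the equations $$\text{(R)}\quad \Phi'=\frac{1}{2\mathrm{i}\omega z}(1-\Phi^2)+\Bigl(\frac{\ell}{z}+\mu(1+z^{-2})\Bigr)\Phi,\qquad \text{(L)}\quad 2\mathrm{i}\omega z\,\Psi'=(\Phi+\Phi^{-1})\Psi,$$ and obey the constraints $\Psi(1)=1$, $|\Phi(1)|=1$. Let the functions $\Phi_B,\Psi_B$ be the ones constructed from $(\Phi,\Psi)$ by the explicit formulas given in the context. Then: (i) the functions $\Phi_B$ and $\Psi_B$ verify the same equations and constraints as $\Phi$ and $\Psi$, respectively; that is, $\Phi_B$ satisfies (R), $\Psi_B$ satisfies $2\mathrm{i}\omega z\,\Psi_B'=(\Phi_B+\Phi_B^{-1})\Psi_B$, and $|\Phi_B(1)|=1$, $\Psi_B(1)=1$; (ii) the transformation $B:(\Phi,\Psi)\mapsto(\Phi_B,\Psi_B)$ repeated twice coincides with the monodromy transformation $M$.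
   Context: **Domain and monodromy.** Solutions are considered on the slit plane $\mathbb{C}\setminus\mathbb{R}_{\le0}$ (isolated singular points removed), identified with a sub-domain of the universal cover of $\mathbb{C}\setminus\{0\}$; $e^{\mathrm{i}\pi}$ and $e^{-\mathrm{i}\pi}$ denote the two distinct boundary points over $-1$ (on the upper and lower edge of the cut). A solution $\Phi$ of (R) with $|\Phi(1)|=1$ is holomorphic near and unimodular on the punctured circle $\{|z|=1,\ z\ne-1\}$; $\varphi$ denotes a continuous real function with $\Phi(e^{\mathrm{i}\omega t})=e^{\mathrm{i}\varphi(t)}$, $t\in(-T/2,T/2)$, extended to $t=\pm T/2$ by continuity (it extends to a solution on $\mathbb{R}$ of $\dot\varphi+\sin\varphi=\omega\ell+2\omega\mu\cos\omega t$). Put $P(t)=\int_0^t\cos\varphi(\tau)\,d\tau$, so $\Psi(e^{\mathrm{i}\omega t})=e^{P(t)}$. The branches $\Psi^{1/2}$, $\Phi^{\pm1/2}$ are the analytic continuations of $e^{P(t)/2}$, $e^{\pm\mathrm{i}\varphi(t)/2}$ from $z=e^{\mathrm{i}\omega t}$. The monodromy transformation $M:\Phi\mapsto\Phi_M$ acts on the space of solutions of (R): $\Phi_M$ is obtained from $\Phi$ by pointwise analytic continuation along the full counter-clockwise circles around zero (or homotopic curves avoiding singularities of $\Phi$); equivalently, $\Phi_M(e^{\mathrm{i}\omega t})=e^{\mathrm{i}\varphi(t+T)}$, or $\Phi_M$ is the solution of (R) with $\Phi_M(e^{-\mathrm{i}\pi})=\Phi(e^{\mathrm{i}\pi})$.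 **Polynomials.** Let $\lambda=(2\omega)^{-2}-\mu^2$. Define functions of $z$ by $p_0=0$, $q_0=1$, $r_0=z^{-2}$, $s_0=-\mu$ and, for $k\ge1$, $$\begin{aligned} p_k&=(1-\ell)z\,p_{k-1}+q_{k-1}+z^2p_{k-1}',\\ q_k&=z^2(-\lambda+(\ell+1)\mu z)p_{k-1}+\mu(1-z^2)q_{k-1}+z^2q_{k-1}',\\ r_k&=2(k-2)z\,r_{k-1}-s_{k-1}-z^2r_{k-1}',\\ s_k&=z^2(\lambda-(\ell+1)\mu z)r_{k-1}+\bigl((2k-\ell-3)z+\mu(z^2-1)\bigr)s_{k-1}-z^2s_{k-1}'. \end{aligned}$$ Then $\mathfrak{p}=p_\ell$, $\mathfrak{q}=q_\ell$, $\mathfrak{r}=r_\ell$, $\mathfrak{s}=s_\ell$ (polynomials in $z$). **Constants.** $$u_\pm=(-1)^\ell e^{\frac{\mathrm i}{2}\varphi(\frac T2)}\pm\mathrm{i}\,e^{-\frac{\mathrm i}{2}\varphi(\frac T2)},\quad v_\pm=e^{\frac{\mathrm i}{2}\varphi(-\frac T2)}\pm\mathrm{i}(-1)^\ell e^{-\frac{\mathrm i}{2}\varphi(-\frac T2)},\quad w_\pm=e^{\frac{\mathrm i}{2}\varphi(0)}\pm\mathrm{i}\,e^{-\frac{\mathrm i}{2}\varphi(0)},$$ $\mathfrak{D}_\pm=\mathfrak{p}(1)\pm2\omega\mathfrak{r}(1)$. Abbreviate $e_+=e^{\frac12P(\frac T2)}$, $e_-=e^{\frac12P(-\frac T2)}$,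 $S=\sin\varphi(0)$, and $$\begin{aligned} a&=2\mathrm{i}\,e_+(\mathfrak{D}_+w_-u_-+\mathfrak{D}_-w_+u_+),\\ b&=-\mathfrak{D}_+w_-(e_+u_-+e_-v_-)+\mathfrak{D}_-w_+(e_+u_++e_-v_+),\\ c&=\mathfrak{D}_-w_+\bigl((2S-1)e_+u_+-e_-v_+\bigr)+\mathfrak{D}_+w_-\bigl((2S+1)e_+u_-+e_-v_-\bigr),\\ d&=-\mathfrak{D}_-w_+\bigl((S-2)e_+u_++S\,e_-v_+\bigr)+\mathfrak{D}_+w_-\bigl((S+2)e_+u_-+S\,e_-v_-\bigr). \end{aligned}$$ **The transformation $B$.** $$\Phi_B(z)=-\frac{a\,\Psi(z)^{1/2}\Phi(z)^{1/2}+b\,\Psi(1/z)^{1/2}\Phi(1/z)^{-1/2}}{-a\,\Psi(z)^{1/2}\Phi(z)^{-1/2}+b\,\Psi(1/z)^{1/2}\Phi(1/z)^{1/2}},$$ $$\Theta_B(z)=\frac{1}{\cos\varphi(0)}\cdot\frac{-\mathrm{i}\,c\,\Psi(z)^{1/2}\Phi(z)^{-1/2}+d\,\Psi(1/z)^{1/2}\Phi(1/z)^{1/2}}{-a\,\Psi(z)^{1/2}\Phi(z)^{-1/2}+b\,\Psi(1/z)^{1/2}\Phi(1/z)^{1/2}},$$ $$\tilde\Theta_B(z)=\frac{1}{\cos\varphi(0)}\cdot\frac{\mathrm{i}\,c\,\Psi(z)^{1/2}\Phi(z)^{1/2}+d\,\Psi(1/z)^{1/2}\Phi(1/z)^{-1/2}}{a\,\Psi(z)^{1/2}\Phi(z)^{1/2}+b\,\Psi(1/z)^{1/2}\Phi(1/z)^{-1/2}},$$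 $$\Psi_B(z)=\frac{1}{2\mathrm{i}}\bigl(\Theta_B(z)-\tilde\Theta_B(z)\bigr).$$ The constants are computed from the pair $(\Phi,\Psi)$ to which $B$ is applied.
   Formalization: Ψ_B is taken as the reciprocal of (Θ_B−Θ̃_B)/(2i): the printed expression solves the equation with the opposite sign, so (i) fails for it. cos φ(0)≠0 is assumed for (Φ,Ψ), and in (ii) also for (Φ_B,Ψ_B), since otherwise the formulas for B are undefined. *)

(* Defs.v *)
(* Stdlib reals and Coquelicot. *)
From Stdlib Require Import Reals ClassicalEpsilon.
From Coquelicot Require Import Coquelicot.

Open Scope C_scope.

Definition is_Cderive (f : C -> C) (z d : C) : Prop :=
  @is_derive C_AbsRing C_NormedModule f z d.

Definition ex_Cderive (f : C -> C) (z : C) : Prop :=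
  @ex_derive C_AbsRing C_NormedModule f z.

Definition pole (f : C -> C) (z : C) : Prop :=
  filterlim (fun w : C_UniformSpace => Cmod (f w)) (locally' z)
    (Rbar_locally p_infty).

Definition slit (z : C) : Prop := ~ (Im z = 0%R /\ (Re z <= 0)%R).

(* [cis x] is e^{ix}. *)
Definition cis (x : R) : C := (cos x, sin x).

Definition Cexp (z : C) : C := RtoC (exp (Re z)) * cis (Im z).

Definition period (omega : R) : R := (2 * PI / omega)%R.

(* Equation (R) at the point z:
   Phi' = (1 - Phi^2) / (2 i omega z) + (l / z + mu (1 + z^-2)) Phi. *)
Definition satisfies_R_at (l : nat) (mu omega : R) (Phi : C -> C) (z : C)
  : Prop :=
  is_Cderive Phi z
    (/ (2 * Ci * omega * z) * (1 - Phi z ^ 2)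
     + (INR l / z + mu * (1 + / z ^ 2)) * Phi z).

(* The isolated singular points of a solution of (R) are poles.  The value
   that the total function Phi takes at a pole is irrelevant. *)
Definition solves_R (l : nat) (mu omega : R) (Phi : C -> C) : Prop :=
  forall z : C, slit z ->
    satisfies_R_at l mu omega Phi z
    \/ (@locally' C_UniformSpace z (satisfies_R_at l mu omega Phi)
        /\ pole Phi z).

(* Equation (L), 2 i omega z Psi' = (Phi + 1/Phi) Psi, is imposed where both
   Phi and 1/Phi make sense, that is away from the poles and zeros of Phi. *)
Definition solves_L (omega : R) (Phi Psi : C -> C) : Prop :=
  forall z : C, slit z -> ex_Cderive Phi z -> Phi z <> 0 ->
    is_Cderive Psi z ((Phi z + / Phi z) * Psi z / (2 * Ci * omega * z)).

(* [ex_Cderive Phi 1] says that 1 is not a pole, so that the constraint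
   |Phi(1)| = 1 is not about an irrelevant value. *)
Definition solution_pair (l : nat) (mu omega : R) (f : (C -> C) * (C -> C))
  : Prop :=
  let (Phi, Psi) := f in
  solves_R l mu omega Phi
  /\ solves_L omega Phi Psi
  /\ ex_Cderive Phi 1 /\ Cmod (Phi 1) = 1%R
  /\ Psi 1 = 1.

(* The quadruple (p_k, q_k, r_k, s_k), as functions of z.  The step from j to
   j + 1 is the recurrence with index k = j + 1. *)
Fixpoint pqrs (l : nat) (mu omega : R) (k : nat) {struct k}
  : (C -> C) * (C -> C) * (C -> C) * (C -> C) :=
  match k with
  | O => (fun _ => RtoC 0, fun _ => RtoC 1, fun z => / z ^ 2,
          fun _ => - RtoC mu)
  | S j =>
      let '(p, q, r, s) := pqrs l mu omega j in
      let lambda : C := RtoC (/ (2 * omega) ^ 2 - mu ^ 2) in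
      let el : C := RtoC (INR l) in
      let kk : C := RtoC (INR k) in
      let m : C := RtoC mu in
      (fun z => (1 - el) * z * p z + q z + z ^ 2 * C_derive p z,
       fun z => z ^ 2 * (- lambda + (el + 1) * m * z) * p z
                + m * (1 - z ^ 2) * q z + z ^ 2 * C_derive q z,
       fun z => 2 * (kk - 2) * z * r z - s z - z ^ 2 * C_derive r z,
       fun z => z ^ 2 * (lambda - (el + 1) * m * z) * r z
                + ((2 * kk - el - 3) * z + m * (z ^ 2 - 1)) * s z
                - z ^ 2 * C_derive s z)
  end.

Definition D_plus (l : nat) (mu omega : R) : C :=
  let '(p, _, r, _) := pqrs l mu omega l in p 1 + 2 * omega * r 1.

Definition D_minus (l : nat) (mu omega : R) : C :=
  let '(p, _, r, _) := pqrs l mu omega l in p 1 - 2 * omega * r 1.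

Definition is_phase (omega : R) (Phi : C -> C) (phi : R -> R) : Prop :=
  let h := (period omega / 2)%R in
  continuous_on (fun t : R => - h <= t <= h)%R phi
  /\ forall t : R, (- h < t < h)%R -> Phi (cis (omega * t)) = cis (phi t).

(* A phase is determined by Phi up to a constant multiple of 2 pi; the
   formulas for the transformation B below do not depend on the choice. *)
Definition phase (omega : R) (Phi : C -> C) : R -> R :=
  epsilon (inhabits (fun _ : R => 0%R)) (is_phase omega Phi).

Definition Pint (phi : R -> R) (t : R) : R :=
  RInt (fun tau => cos (phi tau)) 0 t.

(* X is the branch of Psi^{1/2} F^{1/2} on the slit plane that continues
   e^{P(t)/2} e^{i theta(t)/2} from the arc z = e^{i omega t}; it is used with
   (F, theta) = (Phi, phi) and (F, theta) = (1/Phi, -phi).  Separately,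
   Psi^{1/2} and Phi^{1/2} change sign around the zeros and poles of Phi (at
   which Psi has simple zeros), but the products Psi^{1/2} Phi^{1/2} and
   Psi^{1/2} Phi^{-1/2} are single-valued and holomorphic on the whole slit
   plane, and only these products occur in the formulas. *)
Definition is_root_branch (omega : R) (Phi Psi : C -> C) (phi : R -> R)
  (F : C -> C) (theta : R -> R) (X : C -> C) : Prop :=
  let h := (period omega / 2)%R in
  (forall z : C, slit z -> ex_Cderive X z)
  /\ (forall z : C, slit z -> ex_Cderive Phi z -> Phi z <> 0 ->
        X z ^ 2 = Psi z * F z)
  /\ (forall t : R, (- h < t < h)%R ->
        X (cis (omega * t)) = RtoC (exp (Pint phi t / 2)) * cis (theta t / 2)).

Definition root_plus (omega : R) (Phi Psi : C -> C) : C -> C :=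
  let phi := phase omega Phi in
  epsilon (inhabits (fun _ : C => RtoC 0))
    (is_root_branch omega Phi Psi phi Phi phi).

Definition root_minus (omega : R) (Phi Psi : C -> C) : C -> C :=
  let phi := phase omega Phi in
  epsilon (inhabits (fun _ : C => RtoC 0))
    (is_root_branch omega Phi Psi phi
       (fun z => / Phi z) (fun t => (- phi t)%R)).

(* The formulas of the transformation B divide by cos phi(0); when
   cos phi(0) = 0 both quotients, Phi_B included, degenerate to 0/0. *)
Definition B_defined (omega : R) (f : (C -> C) * (C -> C)) : Prop :=
  cos (phase omega (fst f) 0) <> 0%R.

(* [Xp z] = Psi(z)^{1/2} Phi(z)^{1/2}, [Xm z] = Psi(z)^{1/2} Phi(z)^{-1/2}.

   Psi_B is the reciprocal of (Theta_B - Theta~_B) / 2i.  With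
   N = a Xp(z) + b Xm(1/z) and D = - a Xm(z) + b Xp(1/z) one has Phi_B = - N/D,
   so a solution of (L) for Phi_B is a constant multiple of N D, whereas
   Theta_B - Theta~_B = 2 (a d - i b c) / (N D), because
   Xp(z) Xp(1/z) + Xm(z) Xm(1/z) = 2 cos phi(0) identically. *)
Definition B (l : nat) (mu omega : R) (f : (C -> C) * (C -> C))
  : (C -> C) * (C -> C) :=
  let (Phi, Psi) := f in
  let phi := phase omega Phi in
  let Xp := root_plus omega Phi Psi in
  let Xm := root_minus omega Phi Psi in
  let h := (period omega / 2)%R in
  let sgn : C := (- (1)) ^ l in
  let ep : C := RtoC (exp (Pint phi h / 2)) in
  let em : C := RtoC (exp (Pint phi (- h) / 2)) in
  let S : C := RtoC (sin (phi 0%R)) in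
  let up := sgn * cis (phi h / 2) + Ci * cis (- phi h / 2) in
  let um := sgn * cis (phi h / 2) - Ci * cis (- phi h / 2) in
  let vp := cis (phi (- h)%R / 2) + Ci * sgn * cis (- phi (- h)%R / 2) in
  let vm := cis (phi (- h)%R / 2) - Ci * sgn * cis (- phi (- h)%R / 2) in
  let wp := cis (phi 0%R / 2) + Ci * cis (- phi 0%R / 2) in
  let wm := cis (phi 0%R / 2) - Ci * cis (- phi 0%R / 2) in
  let Dp := D_plus l mu omega in
  let Dm := D_minus l mu omega in
  let a := 2 * Ci * ep * (Dp * wm * um + Dm * wp * up) in
  let b := - (Dp * wm * (ep * um + em * vm))
           + Dm * wp * (ep * up + em * vp) in
  let c := Dm * wp * ((2 * S - 1) * ep * up - em * vp)
           + Dp * wm * ((2 * S + 1) * ep * um + em * vm) in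
  let d := - (Dm * wp * ((S - 2) * ep * up + S * em * vp))
           + Dp * wm * ((S + 2) * ep * um + S * em * vm) in
  let cos0 : C := RtoC (cos (phi 0%R)) in
  let Phi_B z :=
    - ((a * Xp z + b * Xm (/ z)) / (- a * Xm z + b * Xp (/ z))) in
  let Theta_B z :=
    1 / cos0
    * ((- Ci * c * Xm z + d * Xp (/ z)) / (- a * Xm z + b * Xp (/ z))) in
  let Theta'_B z :=
    1 / cos0
    * ((Ci * c * Xp z + d * Xm (/ z)) / (a * Xp z + b * Xm (/ z))) in
  let Psi_B z := / (1 / (2 * Ci) * (Theta_B z - Theta'_B z)) in
  (Phi_B, Psi_B).

(* Phi_M is the analytic continuation of Phi along the full counter-clockwise
   circle around 0.  F is the (single-valued, meromorphic) continuation of Phi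
   to the universal cover of C \ {0}, in the coordinate zeta = log z: the slit
   plane is the strip |Im zeta| < pi and the circle is
   zeta |-> zeta + 2 pi i. *)
Definition is_monodromy (Phi Phi_M : C -> C) : Prop :=
  exists F : C -> C,
    (forall zeta : C,
        ex_Cderive F zeta
        \/ (@locally' C_UniformSpace zeta (ex_Cderive F) /\ pole F zeta))
    /\ (forall zeta : C, (- PI < Im zeta < PI)%R ->
          F zeta = Phi (Cexp zeta)
          /\ F (zeta + 2 * PI * Ci) = Phi_M (Cexp zeta)).

(* The action of M on pairs: since Psi is determined by Phi through (L) and
   Psi(1) = 1, the second component of M (Phi, Psi) is the solution of (L)
   attached to Phi_M that takes the value 1 at 1. *)
Definition is_monodromy_pair (l : nat) (mu omega : R)
  (f g : (C -> C) * (C -> C)) : Prop :=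
  is_monodromy (fst f) (fst g) /\ solution_pair l mu omega g.

(* Main.v *)
Require Import Defs.
From Stdlib Require Import Reals Lra Lia Psatz ClassicalEpsilon FunctionalExtensionality.
From Coquelicot Require Import Coquelicot.

(** Put z = e^zeta.  A solution Phi of the Riccati equation (R) is a quotient x / y,
    where (x, y) solves the linear system
<<
      x' = (q/2) x + c y,    y' = c x - (q/2) y,
      q = l + mu (e^zeta + e^-zeta),    c = 1 / (2 i omega),
>>
    whose coefficients, and hence solutions, are entire in zeta; the solution of (L)
    is then Psi = x y, so that Psi^{1/2} Phi^{1/2} = x and Psi^{1/2} Phi^{-1/2} = y.
    Poles and zeros of Phi are zeros of y and x, and the monodromy is the translation
    of zeta by 2 i pi.

    Because l is an integer, the system has a hidden symmetry.  With
    m = (mu/2) (1/z - z) and the commuting operators D_j = d/dzeta + m + j, the functions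
<<
      Y = D_{l/2-1} ... D_{1-l/2} D_{-l/2} x,    X = D_{l/2} D_{l/2-1} ... D_{1-l/2} y
>>
    solve the system with -mu in place of mu ([climb_y_eq], [climb_x_eq]).  Since
    z -> -z also changes the sign of mu, H (x, y) = (X, Y)(zeta + i pi) is again a
    solution of the original system ([linsol_turned]).  The theorem holds because B is
    the projective action of H, and H^2 is the full turn up to a constant factor.

    For H^2, let the constant matrix K express (X, Y)(0) through (x, y)(0).  The
    polynomials p_k, q_k and r_k, s_k are the coefficients of the two partial products
    above, in the variables E, E' of the double confluent Heun equation
    ([poly_pq_ladder], [poly_rs_ladder]), and the symmetry z -> 1/z makes one product
    the mirror image of the other.  Hence K is made of the two numbers p_l(1) and
    r_l(1) only ([climb_at_1]), with determinant a multiple of D_+ D_-.  The key fact is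
    [climb_adjoint]: for the Wronskian, H is up to sign the adjoint of the operation
    (x, y) -> (X, Y) after a rotation.  It is proved by moving the factors D_j one by
    one from one argument of the Wronskian to the other; the errors telescope, because
    the second-order equation of each partial product involves the previous one
    ([ladder_second]).  So H^2 is det K times the full turn, up
    to sign ([half_turn_twice]), and the value of H (x, y) at z = 1 is, up to sign, the
    adjugate of K applied to (x, y)(e^{i pi}).

    For B, let s = (x, y) be normalised by |x(1)| = 1 and y(1) the conjugate of x(1), and
    let J s = (y(1/z), - x(1/z)), a second solution.  Reading off coordinates with
    Wronskians, the constants a and b satisfy a s + b J s = 16 omega cos(phi(0)) H s
    ([B_is_half_turn]); here b is an average of two expressions of the same Wronskian, at
    z = 1 and at z = e^{-i pi}.  Finally c = - i S a - b and d = - S b - i a, and then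
    Psi_B is the product of the two components of H s, divided by its value at 1.

    What remains is analysis.  Entire solutions exist by power series
    ([linsol_exists]).  A meromorphic solution of (R), and a solution of (L), given on
    the slit plane, are the ones above, because suitable ratios have zero derivative off
    a discrete set and the strip |Im zeta| < pi is connected ([solves_R_quotient],
    [solves_L_product]).  The same argument identifies the branches of the square
    roots ([root_unique]).  On the unit circle y is the conjugate of x, which gives the
    phase and the amplitude of x ([phase_polar]). *)

Local Open Scope C_scope.

(** * Complex differentiation *)

Definition near (z : C) (P : C -> Prop) : Prop :=
  exists delta : R, (0 < delta)%R
    /\ forall w : C, (Cmod (w - z) < delta)%R -> P w.

Definition pnear (z : C) (P : C -> Prop) : Prop :=
  exists delta : R, (0 < delta)%R
    /\ forall w : C, w <> z -> (Cmod (w - z) < delta)%R -> P w.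

Definition Ccont (f : C -> C) (z : C) : Prop :=
  forall eps : R, (0 < eps)%R -> near z (fun w => (Cmod (f w - f z) < eps)%R).

Lemma near_locally (z : C) (P : C -> Prop) :
  near z P <-> @locally C_UniformSpace z P.
Proof.
  rewrite locally_C; split.
  - intros [d [Hd H]]; exists (mkposreal d Hd); intros w Hw; apply H; exact Hw.
  - intros [d H]; exists (pos d); split; [apply cond_pos|].
    intros w Hw; apply H; exact Hw.
Qed.

Lemma pnear_locally' (z : C) (P : C -> Prop) :
  pnear z P <-> @locally' C_UniformSpace z P.
Proof.
  unfold locally', within; rewrite <- near_locally; split;
    intros [d [Hd H]]; exists d; split; auto.
Qed.

Lemma near_point (z : C) (P : C -> Prop) : near z P -> P z.
Proof.
  intros [d [Hd H]]; apply H.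
  replace (z - z) with (RtoC 0) by ring; rewrite Cmod_0; exact Hd.
Qed.

Lemma near_and (z : C) (P Q : C -> Prop) :
  near z P -> near z Q -> near z (fun w => P w /\ Q w).
Proof.
  intros [d [Hd H]] [e [He K]]; exists (Rmin d e); split.
  - now apply Rmin_glb_lt.
  - intros w Hw; split; [apply H|apply K];
      eapply Rlt_le_trans; eauto using Rmin_l, Rmin_r.
Qed.

Lemma pnear_and (z : C) (P Q : C -> Prop) :
  pnear z P -> pnear z Q -> pnear z (fun w => P w /\ Q w).
Proof.
  intros [d [Hd H]] [e [He K]]; exists (Rmin d e); split.
  - now apply Rmin_glb_lt.
  - intros w Hn Hw; split; [apply H|apply K]; auto;
      eapply Rlt_le_trans; eauto using Rmin_l, Rmin_r.
Qed.

Lemma near_mono (z : C) (P Q : C -> Prop) :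
  near z P -> (forall w, P w -> Q w) -> near z Q.
Proof. intros [d [Hd H]] K; exists d; split; auto. Qed.

Lemma pnear_mono (z : C) (P Q : C -> Prop) :
  pnear z P -> (forall w, w <> z -> P w -> Q w) -> pnear z Q.
Proof. intros [d [Hd H]] K; exists d; split; auto. Qed.

Lemma near_pnear (z : C) (P : C -> Prop) : near z P -> pnear z P.
Proof. intros [d [Hd H]]; exists d; split; auto. Qed.

Lemma Cmod_pos (z : C) : z <> 0 -> (0 < Cmod z)%R.
Proof. apply Cmod_gt_0. Qed.

Lemma Cminus_neq (a b : C) : a <> b -> a - b <> 0.
Proof. apply Cminus_eq_contra. Qed.

Lemma near_near (z : C) (P : C -> Prop) : near z P -> near z (fun w => near w P).
Proof.
  intros [d [Hd H]]; exists d; split; auto; intros w Hw.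
  exists (d - Cmod (w - z))%R; split; [lra|]; intros v Hv; apply H.
  replace (v - z) with ((v - w) + (w - z)) by ring.
  pose proof (Cmod_triangle (v - w) (w - z)); lra.
Qed.

Lemma pnear_near (z : C) (P : C -> Prop) :
  pnear z P -> pnear z (fun w => near w P).
Proof.
  intros [d [Hd H]]; exists d; split; auto; intros w Hn Hw.
  assert (Hp := Cmod_pos _ (Cminus_neq _ _ Hn)).
  exists (Rmin (d - Cmod (w - z)) (Cmod (w - z))); split.
  { apply Rmin_glb_lt; lra. }
  intros v Hv.
  assert (H1 := Rmin_l (d - Cmod (w - z)) (Cmod (w - z))).
  assert (H2 := Rmin_r (d - Cmod (w - z)) (Cmod (w - z))).
  apply H.
  - intros ->. replace (z - w) with (- (w - z)) in Hv by ring.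
    rewrite Cmod_opp in Hv; lra.
  - replace (v - z) with ((v - w) + (w - z)) by ring.
    pose proof (Cmod_triangle (v - w) (w - z)); lra.
Qed.

Lemma pnear_exists (z : C) (P : C -> Prop) : pnear z P -> exists w, w <> z /\ P w.
Proof.
  intros [d [Hd H]]; exists (z + RtoC (d / 2)); split.
  - intros E. assert (E2 : RtoC (d / 2) = RtoC 0).
    { replace (RtoC (d / 2)) with (z + RtoC (d / 2) - z) by ring.
      rewrite E; ring. }
    apply RtoC_inj in E2; lra.
  - apply H.
    + intros E. assert (E2 : RtoC (d / 2) = RtoC 0).
      { replace (RtoC (d / 2)) with (z + RtoC (d / 2) - z) by ring.
        rewrite E; ring. }
      apply RtoC_inj in E2; lra.
    + replace (z + RtoC (d / 2) - z) with (RtoC (d / 2)) by ring.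
      rewrite Cmod_R, Rabs_pos_eq; lra.
Qed.

(** The form of differentiability used for estimates: no division, and discs of the
    modulus instead of the product uniform structure. *)
Lemma is_Cderive_eps (f : C -> C) (z d : C) :
  is_Cderive f z d <->
  forall eps : R, (0 < eps)%R ->
    near z (fun w => (Cmod (f w - f z - d * (w - z)) <= eps * Cmod (w - z))%R).
Proof.
  split.
  - intros [_ H] eps He.
    destruct (H z (fun P hP => hP) (mkposreal eps He)) as [e K].
    exists (pos e); split; [apply cond_pos|]; intros w Hw.
    specialize (K w Hw).
    replace (f w - f z - d * (w - z)) with (f w - f z - (w - z) * d) by ring.
    exact K.
  - intros H; split; [apply is_linear_scal_l|].
    intros x Hx.
    apply (is_filter_lim_locally_unique (V := AbsRing_NormedModule C_AbsRing)) in Hx.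
    subst x.
    intros [eps He]; destruct (H eps He) as [e [He' K]].
    exists (mkposreal e He'); intros w Hw; specialize (K w Hw).
    replace (f w - f z - d * (w - z)) with (f w - f z - (w - z) * d) in K by ring.
    exact K.
Qed.

(** The complex numbers carry two normed-module structures over themselves, one with the
    product uniform structure and one with that of the modulus; a ring product is
    differentiated in the second. *)
Lemma is_Cderive_K (f : C -> C) (z d : C) :
  is_Cderive f z d <-> @is_derive C_AbsRing (AbsRing_NormedModule C_AbsRing) f z d.
Proof.
  rewrite is_Cderive_eps; split.
  - intros H; split; [apply is_linear_scal_l|].
    intros x Hx.
    apply (is_filter_lim_locally_unique (V := AbsRing_NormedModule C_AbsRing)) in Hx.
    subst x.
    intros [eps He]; destruct (H eps He) as [e [He' K]].
    exists (mkposreal e He'); intros w Hw; specialize (K w Hw).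
    replace (f w - f z - d * (w - z)) with (f w - f z - (w - z) * d) in K by ring.
    exact K.
  - intros [_ H] eps He.
    destruct (H z (fun P hP => hP) (mkposreal eps He)) as [e K].
    exists (pos e); split; [apply cond_pos|]; intros w Hw.
    specialize (K w Hw).
    replace (f w - f z - d * (w - z)) with (f w - f z - (w - z) * d) by ring.
    exact K.
Qed.

Lemma is_Cderive_unique (f : C -> C) (z d : C) :
  is_Cderive f z d -> C_derive f z = d.
Proof. apply is_C_derive_unique. Qed.

Lemma is_Cderive_eq (f : C -> C) (z d d' : C) :
  is_Cderive f z d -> d = d' -> is_Cderive f z d'.
Proof. now intros H <-. Qed.

Lemma is_Cderive_near (f g : C -> C) (z d : C) :
  near z (fun w => f w = g w) -> is_Cderive f z d -> is_Cderive g z d.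
Proof.
  intros E H; rewrite is_Cderive_eps in *; intros eps He.
  assert (E0 := near_point _ _ E); cbv beta in E0.
  generalize (near_and _ _ _ E (H eps He)); intros K.
  eapply near_mono; [exact K|]; intros w [Ew Kw]; rewrite <- Ew, <- E0; exact Kw.
Qed.

Lemma is_Cderive_ext (f g : C -> C) (z d : C) :
  (forall w, f w = g w) -> is_Cderive f z d -> is_Cderive g z d.
Proof.
  intros E; apply is_Cderive_near; exists 1%R; split; [lra|auto].
Qed.

Lemma is_Cderive_const (a z : C) : is_Cderive (fun _ => a) z 0.
Proof. apply (is_derive_const (K := C_AbsRing) (V := C_NormedModule)). Qed.

Lemma is_Cderive_id (z : C) : is_Cderive (fun w => w) z 1.
Proof. apply is_Cderive_K, (is_derive_id (K := C_AbsRing)). Qed.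

Lemma is_Cderive_plus (f g : C -> C) (z a b : C) :
  is_Cderive f z a -> is_Cderive g z b -> is_Cderive (fun w => f w + g w) z (a + b).
Proof. apply (is_derive_plus (K := C_AbsRing) (V := C_NormedModule)). Qed.

Lemma is_Cderive_opp (f : C -> C) (z a : C) :
  is_Cderive f z a -> is_Cderive (fun w => - f w) z (- a).
Proof. apply (is_derive_opp (K := C_AbsRing) (V := C_NormedModule)). Qed.

Lemma is_Cderive_minus (f g : C -> C) (z a b : C) :
  is_Cderive f z a -> is_Cderive g z b -> is_Cderive (fun w => f w - g w) z (a - b).
Proof. apply (is_derive_minus (K := C_AbsRing) (V := C_NormedModule)). Qed.

Lemma is_Cderive_mult (f g : C -> C) (z a b : C) :
  is_Cderive f z a -> is_Cderive g z b ->
  is_Cderive (fun w => f w * g w) z (a * g z + f z * b).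
Proof.
  rewrite !is_Cderive_K; intros Hf Hg.
  apply (is_derive_mult (K := C_AbsRing) f g z a b Hf Hg).
  intros n m; apply Cmult_comm.
Qed.

Lemma is_Cderive_comp (f g : C -> C) (z a b : C) :
  is_Cderive f (g z) a -> is_Cderive g z b ->
  is_Cderive (fun w => f (g w)) z (b * a).
Proof.
  rewrite (is_Cderive_K g); intros Hf Hg.
  apply (is_derive_comp (K := C_AbsRing) (V := C_NormedModule) f g z a b Hf Hg).
Qed.

Lemma is_Cderive_Ccont (f : C -> C) (z d : C) : is_Cderive f z d -> Ccont f z.
Proof.
  rewrite is_Cderive_eps; intros H eps He.
  destruct (H 1%R Rlt_0_1) as [r [Hr K]].
  assert (Hm := Cmod_ge_0 d).
  exists (Rmin r (eps / (Cmod d + 2))); split.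
  { apply Rmin_glb_lt; [exact Hr|]. apply Rdiv_lt_0_compat; lra. }
  intros w Hw.
  assert (H1 := Rlt_le_trans _ _ _ Hw (Rmin_l _ _)).
  assert (H2 := Rlt_le_trans _ _ _ Hw (Rmin_r _ _)).
  specialize (K w H1).
  replace (f w - f z) with ((f w - f z - d * (w - z)) + d * (w - z)) by ring.
  eapply Rle_lt_trans; [apply Cmod_triangle|]; rewrite Cmod_mult.
  assert (Hq : (Cmod (w - z) * (Cmod d + 2) < eps)%R).
  { apply Rlt_div_r in H2; lra. }
  pose proof (Cmod_ge_0 (w - z)); nra.
Qed.

Lemma Ccont_near_neq (f : C -> C) (z a : C) :
  Ccont f z -> f z <> a -> near z (fun w => f w <> a).
Proof.
  intros H Hn. assert (Hp := Cmod_pos _ (Cminus_neq _ _ Hn)).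
  eapply near_mono; [exact (H _ Hp)|]; intros w Hw E; cbv beta in Hw.
  rewrite E in Hw. replace (a - f z) with (- (f z - a)) in Hw by ring.
  rewrite Cmod_opp in Hw; lra.
Qed.

Lemma is_Cderive_inv (f : C -> C) (z a : C) :
  is_Cderive f z a -> f z <> 0 ->
  is_Cderive (fun w => / f w) z (- a / (f z * f z)).
Proof.
  intros Hf Hz.
  assert (Hinv : is_Cderive (fun w => / w) (f z) (- / (f z * f z))).
  { set (u := f z) in *; clearbody u; clear - Hz.
    assert (Hu := Cmod_pos _ Hz).
    apply is_Cderive_eps; intros eps He.
    exists (Rmin (Cmod u / 2) (eps * (Cmod u * Cmod u * Cmod u) / 2)); split.
    { apply Rmin_glb_lt; [lra|].
      apply Rdiv_lt_0_compat; [|lra]; repeat apply Rmult_lt_0_compat; lra. }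
    intros w Hw.
    assert (H1 := Rlt_le_trans _ _ _ Hw (Rmin_l _ _)).
    assert (H2 := Rlt_le_trans _ _ _ Hw (Rmin_r _ _)).
    assert (Hw2 : (Cmod u / 2 < Cmod w)%R).
    { pose proof (Cmod_triangle w (- (w - u))).
      replace (w + - (w - u)) with u in H by ring.
      rewrite Cmod_opp in H; lra. }
    assert (Hw0 : w <> 0). { apply Cmod_gt_0; lra. }
    replace (/ w - / u - - / (u * u) * (w - u))
      with ((w - u) * ((w - u) * / (w * (u * u)))).
    2:{ field; auto. }
    rewrite Cmod_mult, (Rmult_comm eps).
    apply Rmult_le_compat_l; [apply Cmod_ge_0|].
    rewrite Cmod_mult, Cmod_inv, !Cmod_mult by (repeat apply Cmult_neq_0; auto).
    apply Rle_div_l; [apply Rmult_lt_0_compat; nra|].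
    assert (0 < Cmod u * Cmod u)%R by nra.
    assert (eps * (Cmod u / 2 * (Cmod u * Cmod u)) <= eps * (Cmod w * (Cmod u * Cmod u)))%R.
    { apply Rmult_le_compat_l; [lra|]; apply Rmult_le_compat_r; lra. }
    nra. }
  eapply is_Cderive_eq; [exact (is_Cderive_comp _ _ _ _ _ Hinv Hf)|].
  field; auto.
Qed.

Lemma is_Cderive_div (f g : C -> C) (z a b : C) :
  is_Cderive f z a -> is_Cderive g z b -> g z <> 0 ->
  is_Cderive (fun w => f w / g w) z ((a * g z - f z * b) / (g z * g z)).
Proof.
  intros Hf Hg Hz.
  eapply is_Cderive_eq;
    [exact (is_Cderive_mult _ _ _ _ _ Hf (is_Cderive_inv _ _ _ Hg Hz))|].
  cbv beta; field; auto.
Qed.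

Lemma Ccont_unique_lim (f g : C -> C) (z : C) :
  Ccont f z -> Ccont g z -> pnear z (fun w => f w = g w) -> f z = g z.
Proof.
  intros Hf Hg H; destruct (Ceq_dec (f z) (g z)) as [E|N]; [exact E|exfalso].
  assert (Hp := Cmod_pos _ (Cminus_neq _ _ N)).
  set (e := Cmod (f z - g z)) in *.
  assert (He : (0 < e / 2)%R) by lra.
  destruct (pnear_exists _ _
    (pnear_and _ _ _ H (near_pnear _ _ (near_and _ _ _ (Hf _ He) (Hg _ He)))))
    as [w [_ [Ew [H1 H2]]]].
  assert (K : (e <= Cmod (f w - f z) + Cmod (g w - g z))%R).
  { unfold e. replace (f z - g z) with ((g w - g z) - (f w - f z)) by (rewrite Ew; ring).
    unfold Cminus at 1. eapply Rle_trans; [apply Cmod_triangle|].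
    rewrite Cmod_opp; lra. }
  lra.
Qed.

(** * The complex exponential *)

Lemma C_eq (a b : C) : Re a = Re b -> Im a = Im b -> a = b.
Proof. destruct a, b; simpl; intros -> ->; reflexivity. Qed.

Lemma re_minus (a b : C) : Re (a - b) = (Re a - Re b)%R.
Proof. reflexivity. Qed.

Lemma im_minus (a b : C) : Im (a - b) = (Im a - Im b)%R.
Proof. reflexivity. Qed.

Lemma cis_plus (a b : R) : cis (a + b) = cis a * cis b.
Proof.
  apply C_eq; unfold cis; simpl; [rewrite cos_plus|rewrite sin_plus]; ring.
Qed.

Lemma cis_0 : cis 0 = 1.
Proof. unfold cis; rewrite cos_0, sin_0; reflexivity. Qed.

Lemma cis_opp (a : R) : cis (- a) = Cconj (cis a).
Proof. unfold cis, Cconj; simpl; rewrite cos_neg, sin_neg; reflexivity. Qed.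

Lemma Cmod_cis (a : R) : Cmod (cis a) = 1%R.
Proof.
  unfold Cmod, cis; simpl.
  replace (cos a * (cos a * 1) + sin a * (sin a * 1))%R with 1%R.
  - apply sqrt_1.
  - pose proof (sin2_cos2 a) as H; unfold Rsqr in H; lra.
Qed.

Lemma Cexp_plus (a b : C) : Cexp (a + b) = Cexp a * Cexp b.
Proof.
  unfold Cexp; rewrite re_plus, im_plus, exp_plus, cis_plus, RtoC_mult; ring.
Qed.

Lemma Cexp_0 : Cexp 0 = 1.
Proof. unfold Cexp; simpl; rewrite exp_0, cis_0; ring. Qed.

Lemma Cmod_Cexp (z : C) : Cmod (Cexp z) = exp (Re z).
Proof.
  unfold Cexp; rewrite Cmod_mult, Cmod_cis, Cmod_R, Rabs_pos_eq.
  - ring.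
  - left; apply exp_pos.
Qed.

Lemma Cexp_neq_0 (z : C) : Cexp z <> 0.
Proof. apply Cmod_gt_0; rewrite Cmod_Cexp; apply exp_pos. Qed.

Lemma Cexp_opp (z : C) : Cexp (- z) = / Cexp z.
Proof.
  assert (H : Cexp (- z) * Cexp z = 1).
  { rewrite <- Cexp_plus; replace (- z + z) with (RtoC 0) by ring; apply Cexp_0. }
  pose proof (Cexp_neq_0 z).
  replace (Cexp (- z)) with (Cexp (- z) * Cexp z * / Cexp z) by (field; auto).
  rewrite H; ring.
Qed.

Lemma Cexp_conj (z : C) : Cexp (Cconj z) = Cconj (Cexp z).
Proof.
  unfold Cexp; rewrite Cmult_conj, re_conj, im_conj, cis_opp.
  f_equal; apply C_eq; simpl; ring.
Qed.

Lemma Cexp_imag (t : R) : Cexp (Ci * t) = cis t.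
Proof.
  unfold Cexp; simpl.
  replace (0 * t - 1 * 0)%R with 0%R by ring.
  replace (0 * 0 + 1 * t)%R with t by ring.
  rewrite exp_0; ring.
Qed.

Lemma Cexp_iPI : Cexp (Ci * PI) = - (1).
Proof.
  rewrite Cexp_imag; unfold cis; rewrite cos_PI, sin_PI; apply C_eq; simpl; ring.
Qed.

Lemma Cexp_shift_iPI (z : C) : Cexp (z + Ci * PI) = - Cexp z.
Proof. rewrite Cexp_plus, Cexp_iPI; ring. Qed.

Lemma im_le_Cmod (z : C) : (Rabs (Im z) <= Cmod z)%R.
Proof. eapply Rle_trans; [apply Rmax_r|apply Rmax_Cmod]. Qed.

Lemma Cmod_le_ReIm (z : C) : (Cmod z <= Rabs (Re z) + Rabs (Im z))%R.
Proof.
  assert (E : z = RtoC (Re z) + Ci * RtoC (Im z)) by (apply C_eq; simpl; ring).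
  rewrite E at 1. eapply Rle_trans; [apply Cmod_triangle|].
  rewrite Cmod_mult, Cmod_Ci, !Cmod_R; lra.
Qed.

Lemma derivable_pt_lim_bound (f : R -> R) (x d : R) :
  derivable_pt_lim f x d -> forall eps : R, (0 < eps)%R ->
  exists delta : R, (0 < delta)%R /\
    forall h : R, (Rabs h < delta)%R ->
      (Rabs (f (x + h) - f x - d * h) <= eps * Rabs h)%R.
Proof.
  intros H eps He; destruct (H eps He) as [[delta Hd] K].
  exists delta; split; [exact Hd|]; intros h Hh.
  destruct (Req_dec h 0) as [->|Hn].
  - rewrite Rplus_0_r, Rmult_0_r, Rabs_R0, Rmult_0_r.
    replace (f x - f x - 0)%R with 0%R by ring; rewrite Rabs_R0; lra.
  - specialize (K h Hn Hh).
    replace (f (x + h) - f x - d * h)%R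
      with (((f (x + h) - f x) / h - d) * h)%R by (field; auto).
    rewrite Rabs_mult; apply Rmult_le_compat_r; [apply Rabs_pos|lra].
Qed.

(** With h = a + i b, the difference is
    (e^a - 1 - a) + e^a (cos b - 1 + i (sin b - b)) + i b (e^a - 1), and each term is
    small by the derivatives of the real functions at 0. *)
Lemma Cexp_bound_0 (eps : R) : (0 < eps)%R ->
  exists delta : R, (0 < delta)%R /\
    forall h : C, (Cmod h < delta)%R ->
      (Cmod (Cexp h - 1 - h) <= eps * Cmod h)%R.
Proof.
  intros He.
  assert (He4 : (0 < eps / 6)%R) by lra.
  assert (He1 : (0 < 1)%R) by lra.
  destruct (derivable_pt_lim_bound _ _ _ (derivable_pt_lim_exp 0) _ He4)
    as [d1 [D1 K1]].
  destruct (derivable_pt_lim_bound _ _ _ (derivable_pt_lim_exp 0) _ He1)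
    as [d1' [D1' K1']].
  destruct (derivable_pt_lim_bound _ _ _ (derivable_pt_lim_cos 0) _ He4)
    as [d2 [D2 K2]].
  destruct (derivable_pt_lim_bound _ _ _ (derivable_pt_lim_sin 0) _ He4)
    as [d3 [D3 K3]].
  exists (Rmin (Rmin (Rmin d1 d1') (Rmin d2 d3)) (Rmin (1/2) (eps / 12))); split.
  { repeat apply Rmin_glb_lt; lra. }
  intros h Hh.
  assert (Hall : (Cmod h < d1 /\ Cmod h < d1' /\ Cmod h < d2 /\ Cmod h < d3
    /\ Cmod h < 1/2 /\ Cmod h < eps / 12)%R).
  { repeat split; (eapply Rlt_le_trans; [exact Hh|]);
      eauto 6 using Rmin_l, Rmin_r, Rle_trans. }
  clear Hh; destruct Hall as [H1 [H1' [H2 [H3 [H4 H5]]]]].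
  set (a := Re h); set (b := Im h).
  assert (Ha : (Rabs a <= Cmod h)%R) by apply re_le_Cmod.
  assert (Hb : (Rabs b <= Cmod h)%R) by apply im_le_Cmod.
  specialize (K1 a ltac:(lra)); specialize (K1' a ltac:(lra)).
  specialize (K2 b ltac:(lra)); specialize (K3 b ltac:(lra)).
  rewrite Rplus_0_l, exp_0, Rmult_1_l in K1, K1'.
  rewrite Rplus_0_l, cos_0, sin_0 in K2; rewrite Rplus_0_l, cos_0, sin_0 in K3.
  rewrite Rmult_1_l in K3; replace (- 0 * b)%R with 0%R in K2 by ring.
  set (E := exp a) in *.
  assert (Habs := Rabs_pos a). assert (Hbbs := Rabs_pos b).
  assert (HE : (Rabs (E - 1) <= 2 * Rabs a)%R).
  { replace (E - 1)%R with ((E - 1 - a) + a)%R by ring.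
    eapply Rle_trans; [apply Rabs_triang|]; lra. }
  assert (HE2 : (Rabs E <= 2)%R).
  { replace E with ((E - 1) + 1)%R by ring.
    eapply Rle_trans; [apply Rabs_triang|]; rewrite Rabs_R1; lra. }
  replace (Cexp h - 1 - h) with
    (RtoC (E - 1 - a) + RtoC E * (RtoC (cos b - 1) + Ci * RtoC (sin b - b))
     + Ci * RtoC (b * (E - 1))).
  2:{ unfold E, a, b; destruct h; apply C_eq; unfold Cexp, cis; simpl; ring. }
  eapply Rle_trans; [apply Cmod_triangle|].
  eapply Rle_trans; [apply Rplus_le_compat_r, Cmod_triangle|].
  rewrite !Cmod_mult, Cmod_Ci, !Cmod_R.
  assert (Hc : (Cmod (RtoC (cos b - 1) + Ci * RtoC (sin b - b))
               <= eps / 3 * Rabs b)%R).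
  { eapply Rle_trans; [apply Cmod_triangle|].
    rewrite Cmod_mult, Cmod_Ci, !Cmod_R.
    replace (cos b - 1)%R with (cos b - 1 - 0)%R by ring.
    replace (sin b - b)%R with (sin b - 0 - b)%R by ring. lra. }
  rewrite Rabs_mult.
  assert (T1 : (Rabs (E - 1 - a) <= eps / 6 * Cmod h)%R).
  { eapply Rle_trans; [exact K1|]; apply Rmult_le_compat_l; lra. }
  assert (T2 : (Rabs E * Cmod (RtoC (cos b - 1) + Ci * RtoC (sin b - b))
                <= 2 * (eps / 3 * Cmod h))%R).
  { apply Rmult_le_compat; auto using Rabs_pos, Cmod_ge_0.
    eapply Rle_trans; [exact Hc|]; apply Rmult_le_compat_l; lra. }
  assert (T3 : (Rabs b * Rabs (E - 1) <= Cmod h * (2 * Cmod h))%R).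
  { apply Rmult_le_compat; auto using Rabs_pos; lra. }
  pose proof (Cmod_ge_0 h); nra.
Qed.

Lemma is_Cderive_Cexp (z : C) : is_Cderive Cexp z (Cexp z).
Proof.
  apply is_Cderive_eps; intros eps He.
  assert (Hm := Cmod_pos _ (Cexp_neq_0 z)).
  destruct (Cexp_bound_0 (eps / Cmod (Cexp z))) as [d [Hd K]].
  { apply Rdiv_lt_0_compat; auto. }
  exists d; split; [exact Hd|]; intros w Hw; specialize (K _ Hw).
  replace (Cexp w) with (Cexp z * Cexp (w - z)).
  2:{ rewrite <- Cexp_plus; f_equal; ring. }
  replace (Cexp z * Cexp (w - z) - Cexp z - Cexp z * (w - z))
    with (Cexp z * (Cexp (w - z) - 1 - (w - z))) by ring.
  rewrite Cmod_mult.
  replace (eps * Cmod (w - z))%R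
    with (Cmod (Cexp z) * (eps / Cmod (Cexp z) * Cmod (w - z)))%R by (field; lra).
  apply Rmult_le_compat_l; lra.
Qed.

Lemma is_Cderive_Cexp_comp (f : C -> C) (z d : C) :
  is_Cderive f z d -> is_Cderive (fun w => Cexp (f w)) z (d * Cexp (f z)).
Proof. intros H; apply is_Cderive_comp; [apply is_Cderive_Cexp|exact H]. Qed.

(** * The logarithm on the slit plane *)

Definition strip (zeta : C) : Prop := (- PI < Im zeta < PI)%R.

(** The half-angle formula: it is smooth on the whole slit plane, in contrast with the
    arctangent of the slope. *)
Definition Carg (z : C) : R := (2 * atan (Im z / (Cmod z + Re z)))%R.

Definition Clog (z : C) : C := (ln (Cmod z), Carg z).

Lemma slit_neq_0 (z : C) : slit z -> z <> 0.
Proof. intros H ->; apply H; simpl; split; lra. Qed.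

Lemma slit_pos (z : C) : slit z -> (0 < Cmod z + Re z)%R.
Proof.
  intros H.
  assert (H1 := re_le_Cmod z).
  assert (H2 : (- Re z <= Rabs (Re z))%R) by (rewrite <- Rabs_Ropp; apply Rle_abs).
  destruct (Req_dec (Cmod z + Re z) 0) as [E|N]; [|lra].
  exfalso; apply H.
  assert (K := Cmod2_alt z).
  assert (HI : (Im z ^ 2 = 0)%R).
  { replace (Cmod z) with (- Re z)%R in K by lra; nra. }
  split; [apply (Rsqr_0_uniq (Im z)); unfold Rsqr; nra|].
  pose proof (Cmod_ge_0 z); lra.
Qed.

Lemma Clog_strip (z : C) : strip (Clog z).
Proof.
  unfold strip, Clog, Carg; simpl.
  destruct (atan_bound (Im z / (Cmod z + Re z))); lra.
Qed.

Lemma Cexp_Clog (z : C) : slit z -> Cexp (Clog z) = z.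
Proof.
  intros H. assert (Hp := slit_pos z H).
  assert (Hm := Cmod_pos _ (slit_neq_0 _ H)).
  unfold Cexp, Clog, Carg; simpl; rewrite exp_ln by exact Hm.
  set (t := (Im z / (Cmod z + Re z))%R).
  assert (Ht : (0 < 1 + t²)%R) by (unfold Rsqr; nra).
  assert (Hc : cos (2 * atan t) = ((1 - t²) / (1 + t²))%R).
  { rewrite cos_2a, cos_atan, sin_atan.
    assert (Hs := sqrt_sqrt (1 + t²) (Rlt_le _ _ Ht)).
    assert (Hs0 := sqrt_lt_R0 _ Ht).
    set (s := sqrt (1 + t²)) in *; clearbody s; rewrite <- Hs; unfold Rsqr; field; lra. }
  assert (Hsn : sin (2 * atan t) = ((2 * t) / (1 + t²))%R).
  { rewrite sin_2a, cos_atan, sin_atan.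
    assert (Hs := sqrt_sqrt (1 + t²) (Rlt_le _ _ Ht)).
    assert (Hs0 := sqrt_lt_R0 _ Ht).
    set (s := sqrt (1 + t²)) in *; clearbody s; rewrite <- Hs; field; lra. }
  assert (K := Cmod2_alt z).
  unfold cis; rewrite Hc, Hsn; unfold t; clear Hc Hsn Ht; clear t.
  set (m := Cmod z) in *; set (a := Re z) in *; set (b := Im z) in *.
  assert (E : (1 + (b / (m + a))² = 2 * m / (m + a))%R).
  { replace (2 * m / (m + a))%R with (2 * m * (m + a) / ((m + a) * (m + a)))%R
      by (field; lra).
    replace (2 * m * (m + a))%R with ((m + a) * (m + a) + b * b)%R by nra.
    unfold Rsqr; field; lra. }
  assert (E' : (1 - (b / (m + a))² = 2 * a / (m + a))%R).
  { replace (2 * a / (m + a))%R with (2 * a * (m + a) / ((m + a) * (m + a)))%R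
      by (field; lra).
    replace (2 * a * (m + a))%R with ((m + a) * (m + a) - b * b)%R by nra.
    unfold Rsqr; field; lra. }
  rewrite E, E'.
  apply C_eq; simpl; fold a b; field; lra.
Qed.

Lemma slit_Cexp (zeta : C) : strip zeta -> slit (Cexp zeta).
Proof.
  intros Hs [Hi Hr]; unfold strip in Hs; unfold Cexp, cis in *; simpl in *.
  assert (He := exp_pos (Re zeta)).
  assert (Hsin : sin (Im zeta) = 0%R) by nra.
  assert (Hcos : (cos (Im zeta) <= 0)%R) by nra.
  destruct (Rtotal_order (Im zeta) 0) as [L|[E|G]].
  - assert (sin (Im zeta) < 0)%R by (apply sin_lt_0_var; lra); lra.
  - rewrite E, cos_0 in Hcos; lra.
  - assert (0 < sin (Im zeta))%R by (apply sin_gt_0; lra); lra.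
Qed.

Lemma Clog_Cexp (zeta : C) : strip zeta -> Clog (Cexp zeta) = zeta.
Proof.
  intros Hs. unfold Clog, Carg; rewrite Cmod_Cexp, ln_exp.
  apply C_eq; [reflexivity|]; simpl.
  unfold strip in Hs.
  replace ((exp (Re zeta) * sin (Im zeta) + 0 * cos (Im zeta))
    / (exp (Re zeta) + (exp (Re zeta) * cos (Im zeta) - 0 * sin (Im zeta))))%R
    with (tan (Im zeta / 2)).
  { rewrite atan_tan; lra. }
  set (b := (Im zeta / 2)%R).
  replace (Im zeta) with (2 * b)%R by (unfold b; field).
  rewrite sin_2a, cos_2a_cos; unfold tan.
  assert (0 < cos b)%R by (apply cos_gt_0; unfold b; lra).
  assert (He := exp_pos (Re zeta)).
  set (e := exp (Re zeta)) in *; clearbody e b.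
  replace (e + (e * (2 * cos b * cos b - 1) - 0 * (2 * sin b * cos b)))%R
    with (2 * e * cos b * cos b)%R by ring.
  field; lra.
Qed.

Lemma Clog_1 : Clog 1 = 0.
Proof.
  rewrite <- Cexp_0; apply Clog_Cexp; unfold strip; simpl.
  pose proof PI_RGT_0; lra.
Qed.

Lemma slit_inv (z : C) : slit z -> slit (/ z).
Proof.
  intros H; rewrite <- (Cexp_Clog z H), <- Cexp_opp; apply slit_Cexp.
  generalize (Clog_strip z); unfold strip; rewrite im_opp; lra.
Qed.

Lemma Clog_inv (z : C) : slit z -> Clog (/ z) = - Clog z.
Proof.
  intros H; rewrite <- (Cexp_Clog z H) at 1; rewrite <- Cexp_opp; apply Clog_Cexp.
  generalize (Clog_strip z); unfold strip; rewrite im_opp; lra.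
Qed.

Lemma Ccont_pair (f g : C -> R) (z : C) :
  continuous (U := R_UniformSpace) (f : C_UniformSpace -> R) z ->
  continuous (U := R_UniformSpace) (g : C_UniformSpace -> R) z ->
  Ccont (fun w => (f w, g w)) z.
Proof.
  intros Hf Hg eps He.
  assert (He2 : (0 < eps / 2)%R) by lra.
  assert (Af := proj1 (filterlim_locally (U := R_UniformSpace) _ _) Hf (mkposreal _ He2)).
  assert (Ag := proj1 (filterlim_locally (U := R_UniformSpace) _ _) Hg (mkposreal _ He2)).
  eapply near_mono.
  { apply near_and; apply near_locally; [exact Af|exact Ag]. }
  intros w [H1 H2].
  unfold ball in H1, H2; simpl in H1, H2.
  unfold AbsRing_ball, abs, minus, plus, opp in H1, H2; simpl in H1, H2.
  eapply Rle_lt_trans; [apply Cmod_le_ReIm|]; simpl; lra.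
Qed.

Lemma continuous_Cmod (z : C) :
  continuous (U := R_UniformSpace) (Cmod : C_UniformSpace -> R) z.
Proof.
  apply (proj2 (filterlim_locally (U := R_UniformSpace) _ _)); intros eps.
  apply near_locally; exists (pos eps); split; [apply cond_pos|]; intros w Hw.
  unfold ball; simpl; unfold AbsRing_ball, abs, minus, plus, opp; simpl.
  apply Rabs_def1.
  - pose proof (Cmod_triangle (w - z) z) as H.
    replace (w - z + z) with w in H by ring; lra.
  - pose proof (Cmod_triangle (- (w - z)) w) as H.
    replace (- (w - z) + w) with z in H by ring; rewrite Cmod_opp in H; lra.
Qed.

Lemma Clog_cont (z : C) : slit z -> Ccont Clog z.
Proof.
  intros H; assert (Hp := slit_pos z H).
  assert (Hm := Cmod_pos _ (slit_neq_0 _ H)).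
  apply Ccont_pair.
  - apply (continuous_comp (U := C_UniformSpace) Cmod ln); [apply continuous_Cmod|].
    apply continuity_pt_filterlim, derivable_continuous_pt.
    exists (/ Cmod z)%R; apply derivable_pt_lim_ln; exact Hm.
  - unfold Carg.
    apply (continuous_comp (U := C_UniformSpace)
             (fun w : C => (Im w / (Cmod w + Re w))%R) (fun t => (2 * atan t)%R)).
    + apply (continuous_mult (U := C_UniformSpace) (K := R_AbsRing)
               Im (fun w => (/ (Cmod w + Re w))%R)).
      * apply (continuous_snd (U := R_UniformSpace) (V := R_UniformSpace)).
      * apply (continuous_comp (U := C_UniformSpace)
                 (fun w => (Cmod w + Re w)%R) Rinv).
        -- apply (continuous_plus (U := C_UniformSpace) (V := R_NormedModule) Cmod Re).
           ++ apply continuous_Cmod.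
           ++ apply (continuous_fst (U := R_UniformSpace) (V := R_UniformSpace)).
        -- apply continuous_Rinv; lra.
    + apply (continuous_scal_r (U := R_UniformSpace) (V := R_NormedModule) 2%R atan).
      apply continuity_pt_filterlim, derivable_continuous_pt, derivable_pt_atan.
Qed.

(** The inverse function theorem when a continuous inverse is already known. *)
Lemma is_Cderive_right_inverse (f g : C -> C) (z d : C) :
  Ccont g z -> near z (fun w => f (g w) = w) -> is_Cderive f (g z) d -> d <> 0 ->
  is_Cderive g z (/ d).
Proof.
  intros Hg Hfg Hf Hd; assert (Hm := Cmod_pos _ Hd).
  apply is_Cderive_eps; intros eps He.
  assert (E0 := near_point _ _ Hfg); cbv beta in E0.
  rewrite is_Cderive_eps in Hf.
  set (e1 := Rmin (Cmod d / 2) (eps * (Cmod d * Cmod d) / 2)).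
  assert (H1 : (0 < e1)%R).
  { apply Rmin_glb_lt; [lra|]; apply Rdiv_lt_0_compat; [|lra].
    repeat apply Rmult_lt_0_compat; lra. }
  destruct (Hf e1 H1) as [r [Hr K]].
  eapply near_mono; [exact (near_and _ _ _ Hfg (Hg r Hr))|]; intros w [Ew Hw].
  specialize (K _ Hw); cbv beta in K; rewrite Ew, E0 in K.
  assert (L1 : (e1 <= Cmod d / 2)%R) by apply Rmin_l.
  assert (L2 : (e1 <= eps * (Cmod d * Cmod d) / 2)%R) by apply Rmin_r.
  set (v := g w - g z) in *; set (h := w - z) in *.
  assert (Hv := Cmod_ge_0 v); assert (Hh := Cmod_ge_0 h).
  assert (Bv : (Cmod d * Cmod v <= 2 * Cmod h)%R).
  { rewrite <- Cmod_mult.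
    pose proof (Cmod_triangle h (- (h - d * v))) as T.
    replace (h + - (h - d * v)) with (d * v) in T by ring.
    rewrite Cmod_opp in T; rewrite Cmod_mult in *; nra. }
  replace (v - / d * h) with (- (/ d * (h - d * v))) by (field; auto).
  rewrite Cmod_opp, Cmod_mult, Cmod_inv by auto.
  apply Rmult_le_reg_l with (Cmod d); [exact Hm|].
  rewrite <- Rmult_assoc, Rinv_r, Rmult_1_l by lra.
  eapply Rle_trans; [exact K|].
  apply Rle_trans with (eps * (Cmod d * Cmod d) / 2 * Cmod v)%R.
  { apply Rmult_le_compat_r; lra. }
  assert (eps * Cmod d / 2 * (Cmod d * Cmod v) <= eps * Cmod d / 2 * (2 * Cmod h))%R.
  { apply Rmult_le_compat_l; [|exact Bv].
    apply Rlt_le, Rdiv_lt_0_compat; [apply Rmult_lt_0_compat|]; lra. }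
  lra.
Qed.

Lemma slit_near (z : C) : slit z -> near z slit.
Proof.
  intros H; assert (Hp := slit_pos z H).
  exists ((Cmod z + Re z) / 2)%R; split; [lra|]; intros w Hw [H1 H2].
  assert (E : Cmod w = (- Re w)%R).
  { replace w with (RtoC (Re w)) at 1 by (apply C_eq; simpl; auto).
    rewrite Cmod_R, Rabs_left1; lra. }
  pose proof (Cmod_triangle (- (w - z)) w) as T.
  replace (- (w - z) + w) with z in T by ring; rewrite Cmod_opp in T.
  pose proof (re_le_Cmod (w - z)) as R1.
  rewrite re_minus in R1; pose proof (Rabs_maj2 (Re w - Re z)) as R2. lra.
Qed.

Lemma is_Cderive_Clog (z : C) : slit z -> is_Cderive Clog z (/ z).
Proof.
  intros H; apply (is_Cderive_right_inverse Cexp).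
  - apply Clog_cont, H.
  - eapply near_mono; [exact (slit_near z H)|]; intros w; apply Cexp_Clog.
  - rewrite <- (Cexp_Clog z H) at 2; apply is_Cderive_Cexp.
  - apply slit_neq_0, H.
Qed.

Lemma strip_near (zeta : C) : strip zeta -> near zeta strip.
Proof.
  unfold strip; intros H.
  exists (Rmin (PI - Im zeta) (PI + Im zeta)); split; [apply Rmin_glb_lt; lra|].
  intros w Hw.
  assert (H1 := Rlt_le_trans _ _ _ Hw (Rmin_l _ _)).
  assert (H2 := Rlt_le_trans _ _ _ Hw (Rmin_r _ _)).
  pose proof (im_le_Cmod (w - zeta)) as I1.
  rewrite im_minus in I1.
  pose proof (Rabs_maj2 (Im w - Im zeta)).
  pose proof (Rle_abs (Im w - Im zeta)). lra.
Qed.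

(** On the negative axis, where the principal logarithm is not available, half a turn is
    added to the logarithm of the opposite. *)
Lemma Cexp_surj (z : C) : z <> 0 -> exists zeta, Cexp zeta = z.
Proof.
  intros Hz.
  destruct (excluded_middle_informative (Im z = 0%R /\ (Re z <= 0)%R)) as [[H1 H2]|H].
  - exists (Clog (- z) + Ci * PI); rewrite Cexp_shift_iPI, Cexp_Clog; [ring|].
    intros [H3 H4]; rewrite re_opp in H4.
    apply Hz, C_eq; simpl; unfold Re, Im in *; lra.
  - exists (Clog z); now apply Cexp_Clog.
Qed.

(** * Connectedness and functions with zero derivative *)

(** Connectedness of the interval: the supremum of the initial segments on which Q
    holds is 1. *)
Lemma clopen_interval (Q : R -> Prop) :
  (forall t : R, (0 <= t <= 1)%R -> exists delta : R, (0 < delta)%R /\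
     ((forall s : R, (0 <= s <= 1)%R -> (Rabs (s - t) < delta)%R -> Q s)
      \/ (forall s : R, (0 <= s <= 1)%R -> (Rabs (s - t) < delta)%R -> ~ Q s))) ->
  Q 0%R -> Q 1%R.
Proof.
  intros H Q0.
  set (E := fun t : R => (0 <= t <= 1)%R /\ forall s : R, (0 <= s <= t)%R -> Q s).
  destruct (completeness E) as [m [Hub Hlub]].
  { exists 1%R; intros t [Ht _]; lra. }
  { exists 0%R; split; [lra|]; intros s Hs; replace s with 0%R by lra; exact Q0. }
  assert (E0 : E 0%R).
  { split; [lra|]; intros s Hs; replace s with 0%R by lra; exact Q0. }
  assert (Hm0 : (0 <= m)%R) by (apply Hub, E0).
  assert (Hm1 : (m <= 1)%R) by (apply Hlub; intros t [Ht _]; lra).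
  destruct (H m (conj Hm0 Hm1)) as [d [Hd Hcase]].
  assert (Hex : exists t : R, E t /\ (m - d < t)%R).
  { destruct (excluded_middle_informative (exists t : R, E t /\ (m - d < t)%R))
      as [Y|N]; [exact Y|exfalso].
    assert (m <= m - d)%R; [|lra].
    apply Hlub; intros t Ht; destruct (Rle_dec t (m - d)) as [L|G]; [exact L|].
    exfalso; apply N; exists t; split; [exact Ht|lra]. }
  destruct Hex as [t [[Ht HQ] Htm]].
  assert (Htm' : (t <= m)%R) by (apply Hub; split; assumption).
  destruct Hcase as [Y|N].
  - assert (Hall : forall s : R, (0 <= s <= Rmin 1 (m + d / 2))%R -> Q s).
    { intros s Hs; pose proof (Rmin_l 1 (m + d / 2)); pose proof (Rmin_r 1 (m + d / 2)).
      destruct (Rle_dec s t) as [L|G]; [apply HQ; lra|].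
      apply Y; [lra|]; apply Rabs_def1; lra. }
    destruct (Rle_dec 1 (m + d / 2)) as [L|G].
    + apply Hall; rewrite Rmin_left; lra.
    + assert (m + d / 2 <= m)%R; [|lra].
      apply Hub; split; [lra|]; intros s Hs; apply Hall; rewrite Rmin_right; lra.
  - exfalso; apply (N t); [lra|apply Rabs_def1; lra|apply HQ; lra].
Qed.

Definition Rcont (g : R -> C) (t : R) : Prop :=
  forall eps : R, (0 < eps)%R -> exists delta : R, (0 < delta)%R /\
    forall s : R, (Rabs (s - t) < delta)%R -> (Cmod (g s - g t) < eps)%R.

Lemma clopen_path (g : R -> C) (P : C -> Prop) :
  (forall t : R, (0 <= t <= 1)%R -> Rcont g t) ->
  (forall t : R, (0 <= t <= 1)%R -> near (g t) P \/ near (g t) (fun w => ~ P w)) ->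
  P (g 0%R) -> P (g 1%R).
Proof.
  intros Hg H; apply (clopen_interval (fun t => P (g t))); intros t Ht.
  destruct (H t Ht) as [[r [Hr K]]|[r [Hr K]]];
    destruct (Hg t Ht r Hr) as [d [Hd L]]; exists d; split; auto.
Qed.

Lemma Rcont_affine (a b : C) (t : R) : Rcont (fun s => a + RtoC s * b) t.
Proof.
  intros eps He; assert (Hb := Cmod_ge_0 b).
  exists (eps / (Cmod b + 1))%R; split; [apply Rdiv_lt_0_compat; lra|].
  intros s Hs.
  replace (a + RtoC s * b - (a + RtoC t * b)) with (RtoC (s - t) * b)
    by (rewrite RtoC_minus; ring).
  rewrite Cmod_mult, Cmod_R; apply Rlt_div_r in Hs; [|lra].
  pose proof (Rabs_pos (s - t)); nra.
Qed.

Lemma Rcont_comp (f : C -> C) (g : R -> C) (t : R) :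
  Ccont f (g t) -> Rcont g t -> Rcont (fun s => f (g s)) t.
Proof.
  intros Hf Hg eps He; destruct (Hf eps He) as [r [Hr K]].
  destruct (Hg r Hr) as [d [Hd L]]; exists d; split; auto.
Qed.

(** The derivative of a curve in the complex plane. *)
Definition is_Rderive (g : R -> C) (t : R) (v : C) : Prop :=
  forall eps : R, (0 < eps)%R -> exists delta : R, (0 < delta)%R /\
    forall s : R, (Rabs (s - t) < delta)%R ->
      (Cmod (g s - g t - v * RtoC (s - t)) <= eps * Rabs (s - t))%R.

Lemma is_Rderive_affine (a b : C) (t : R) :
  is_Rderive (fun s => a + RtoC s * b) t b.
Proof.
  intros eps He; exists 1%R; split; [lra|]; intros s _.
  replace (a + RtoC s * b - (a + RtoC t * b) - b * RtoC (s - t)) with (RtoC 0)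
    by (rewrite RtoC_minus; ring).
  rewrite Cmod_0; apply Rmult_le_pos; [lra|apply Rabs_pos].
Qed.

Lemma is_Rderive_comp (f : C -> C) (g : R -> C) (t : R) (d v : C) :
  is_Cderive f (g t) d -> is_Rderive g t v ->
  is_Rderive (fun s => f (g s)) t (d * v).
Proof.
  intros Hf Hg eps He.
  rewrite is_Cderive_eps in Hf.
  assert (Hd := Cmod_ge_0 d); assert (Hv := Cmod_ge_0 v).
  set (e1 := (eps / 2 / (Cmod v + 1))%R).
  assert (He1 : (0 < e1)%R) by (unfold e1; repeat apply Rdiv_lt_0_compat; lra).
  destruct (Hf e1 He1) as [r [Hr K]].
  set (e2 := Rmin 1 (eps / 2 / (Cmod d + 1))).
  assert (He2 : (0 < e2)%R).
  { apply Rmin_glb_lt; [lra|]; repeat apply Rdiv_lt_0_compat; lra. }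
  destruct (Hg e2 He2) as [q [Hq L]].
  exists (Rmin q (r / (Cmod v + 1))); split.
  { apply Rmin_glb_lt; [lra|]; apply Rdiv_lt_0_compat; lra. }
  intros s Hs.
  assert (H1 := Rlt_le_trans _ _ _ Hs (Rmin_l _ _)).
  assert (H2 := Rlt_le_trans _ _ _ Hs (Rmin_r _ _)).
  specialize (L s H1).
  assert (La : (e2 <= 1)%R) by apply Rmin_l.
  assert (Lb : (e2 <= eps / 2 / (Cmod d + 1))%R) by apply Rmin_r.
  apply Rlt_div_r in H2; [|lra].
  set (h := Rabs (s - t)) in *; assert (Hh : (0 <= h)%R) by apply Rabs_pos.
  assert (B : (Cmod (g s - g t) <= (Cmod v + 1) * h)%R).
  { replace (g s - g t) with ((g s - g t - v * RtoC (s - t)) + v * RtoC (s - t)) by ring.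
    eapply Rle_trans; [apply Cmod_triangle|]; rewrite Cmod_mult, Cmod_R; fold h; nra. }
  assert (Hrr : (Cmod (g s - g t) < r)%R) by nra.
  specialize (K _ Hrr).
  replace (f (g s) - f (g t) - d * v * RtoC (s - t))
    with ((f (g s) - f (g t) - d * (g s - g t)) + d * (g s - g t - v * RtoC (s - t)))
    by ring.
  eapply Rle_trans; [apply Cmod_triangle|]; rewrite Cmod_mult.
  assert (T1 : (e1 * Cmod (g s - g t) <= eps / 2 * h)%R).
  { replace (eps / 2 * h)%R with (e1 * ((Cmod v + 1) * h))%R by (unfold e1; field; lra).
    apply Rmult_le_compat_l; lra. }
  assert (T2 : (Cmod d * Cmod (g s - g t - v * RtoC (s - t)) <= eps / 2 * h)%R).
  { apply Rle_trans with (Cmod d * (eps / 2 / (Cmod d + 1) * h))%R.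
    - apply Rmult_le_compat_l; [lra|]; eapply Rle_trans; [exact L|].
      apply Rmult_le_compat_r; lra.
    - replace (eps / 2 * h)%R with ((Cmod d + 1) * (eps / 2 / (Cmod d + 1) * h))%R
        by (field; lra).
      apply Rmult_le_compat_r; [|lra].
      apply Rmult_le_pos; [|lra]; apply Rlt_le, Rdiv_lt_0_compat; lra. }
  lra.
Qed.

Lemma is_derive_bound (f : R -> R) (t d : R) :
  (forall eps : R, (0 < eps)%R -> exists delta : R, (0 < delta)%R /\
    forall s : R, (Rabs (s - t) < delta)%R ->
      (Rabs (f s - f t - d * (s - t)) <= eps * Rabs (s - t))%R) ->
  is_derive f t d.
Proof.
  intros H; apply is_derive_Reals; intros eps He.
  destruct (H (eps / 2)%R ltac:(lra)) as [r [Hr K]].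
  exists (mkposreal r Hr); intros h Hh Hhr; simpl in Hhr.
  specialize (K (t + h)%R); replace (t + h - t)%R with h in K by ring.
  specialize (K Hhr).
  replace ((f (t + h) - f t) / h - d)%R with ((f (t + h) - f t - d * h) / h)%R
    by (field; auto).
  unfold Rdiv; rewrite Rabs_mult, Rabs_inv.
  assert (Hp := Rabs_pos_lt h Hh).
  apply Rle_lt_trans with (eps / 2)%R; [|lra].
  apply Rle_div_l; [exact Hp|lra].
Qed.

Lemma is_Rderive_Re (g : R -> C) (t : R) (v : C) :
  is_Rderive g t v -> is_derive (fun s => Re (g s)) t (Re v).
Proof.
  intros H; apply is_derive_bound; intros eps He.
  destruct (H eps He) as [d [Hd K]]; exists d; split; [exact Hd|]; intros s Hs.
  eapply Rle_trans; [|exact (K s Hs)].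
  replace (Re (g s) - Re (g t) - Re v * (s - t))%R
    with (Re (g s - g t - v * RtoC (s - t))) by (destruct (g s), (g t), v; simpl; ring).
  apply re_le_Cmod.
Qed.

Lemma is_Rderive_Im (g : R -> C) (t : R) (v : C) :
  is_Rderive g t v -> is_derive (fun s => Im (g s)) t (Im v).
Proof.
  intros H; apply is_derive_bound; intros eps He.
  destruct (H eps He) as [d [Hd K]]; exists d; split; [exact Hd|]; intros s Hs.
  eapply Rle_trans; [|exact (K s Hs)].
  replace (Im (g s) - Im (g t) - Im v * (s - t))%R
    with (Im (g s - g t - v * RtoC (s - t))) by (destruct (g s), (g t), v; simpl; ring).
  apply im_le_Cmod.
Qed.

Lemma is_Cderive_0_segment (f : C -> C) (a b : C) :
  (forall t : R, (0 <= t <= 1)%R -> is_Cderive f (a + RtoC t * (b - a)) 0) ->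
  f b = f a.
Proof.
  intros H.
  assert (K : forall t, (0 <= t <= 1)%R ->
    is_Rderive (fun s => f (a + RtoC s * (b - a))) t 0).
  { intros t Ht; replace (RtoC 0) with (0 * (b - a)) by ring.
    exact (is_Rderive_comp f _ t _ _ (H t Ht) (is_Rderive_affine a (b - a) t)). }
  replace (f b) with (f (a + RtoC 1 * (b - a))) by (f_equal; ring).
  transitivity (f (a + RtoC 0 * (b - a))); [|f_equal; ring].
  apply C_eq; symmetry.
  - apply (eq_is_derive (V := R_NormedModule)
             (fun s => Re (f (a + RtoC s * (b - a)))) 0 1); [|lra].
    intros t Ht; exact (is_Rderive_Re _ _ _ (K t Ht)).
  - apply (eq_is_derive (V := R_NormedModule)
             (fun s => Im (f (a + RtoC s * (b - a)))) 0 1); [|lra].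
    intros t Ht; exact (is_Rderive_Im _ _ _ (K t Ht)).
Qed.

Lemma near_segment (z w : C) (delta : R) (t : R) :
  (Cmod (w - z) < delta)%R -> (0 <= t <= 1)%R ->
  (Cmod (z + RtoC t * (w - z) - z) < delta)%R.
Proof.
  intros H Ht; replace (z + RtoC t * (w - z) - z) with (RtoC t * (w - z)) by ring.
  rewrite Cmod_mult, Cmod_R, Rabs_pos_eq by lra.
  pose proof (Cmod_ge_0 (w - z)); nra.
Qed.

Lemma near_is_Cderive_0 (f : C -> C) (z : C) :
  near z (fun w => is_Cderive f w 0) -> near z (fun w => f w = f z).
Proof.
  intros [d [Hd H]]; exists d; split; [exact Hd|]; intros w Hw.
  apply is_Cderive_0_segment; intros t Ht; apply H.
  now apply near_segment.
Qed.

(** A punctured disc is connected: two of its points are joined by an arc of a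
    logarithmic spiral around the centre, on which the distance to the centre is monotone. *)
Lemma clopen_punctured_disc (z : C) (r : R) (P : C -> Prop) (p q : C) :
  (forall w, w <> z -> (Cmod (w - z) < r)%R -> near w P \/ near w (fun v => ~ P v)) ->
  p <> z -> (Cmod (p - z) < r)%R -> q <> z -> (Cmod (q - z) < r)%R -> P p -> P q.
Proof.
  intros H Hp Hpr Hq Hqr HP.
  assert (Np := Cminus_neq _ _ Hp); assert (Nq := Cminus_neq _ _ Hq).
  destruct (Cexp_surj _ Np) as [a Ha]; destruct (Cexp_surj _ Nq) as [b Hb].
  set (g := fun t : R => z + Cexp (a + RtoC t * (b - a))).
  assert (G0 : g 0%R = p).
  { unfold g; replace (a + RtoC 0 * (b - a)) with a by ring; rewrite Ha; ring. }
  assert (G1 : g 1%R = q).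
  { unfold g; replace (a + RtoC 1 * (b - a)) with b by ring; rewrite Hb; ring. }
  rewrite <- G1; apply (clopen_path g P); [| |rewrite G0; exact HP].
  - intros t _; apply (Rcont_comp (fun v => z + Cexp v) (fun t => a + RtoC t * (b - a))).
    + eapply is_Cderive_Ccont, is_Cderive_plus;
        [apply is_Cderive_const|apply is_Cderive_Cexp].
    + apply Rcont_affine.
  - intros t Ht; apply H.
    + unfold g; intros E; apply (Cexp_neq_0 (a + RtoC t * (b - a))).
      replace (Cexp (a + RtoC t * (b - a)))
        with (z + Cexp (a + RtoC t * (b - a)) - z) by ring.
      rewrite E; ring.
    + unfold g; replace (z + Cexp (a + RtoC t * (b - a)) - z)
        with (Cexp (a + RtoC t * (b - a))) by ring.
      rewrite <- Ha, Cmod_Cexp in Hpr; rewrite <- Hb, Cmod_Cexp in Hqr.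
      rewrite Cmod_Cexp.
      replace (Re (a + RtoC t * (b - a))) with ((1 - t) * Re a + t * Re b)%R
        by (destruct a, b; simpl; ring).
      assert (Hmax : ((1 - t) * Re a + t * Re b <= Rmax (Re a) (Re b))%R).
      { pose proof (Rmax_l (Re a) (Re b)); pose proof (Rmax_r (Re a) (Re b)); nra. }
      apply Rle_lt_trans with (exp (Rmax (Re a) (Re b))).
      * destruct Hmax as [L|E]; [left; now apply exp_increasing|rewrite E; lra].
      * unfold Rmax; destruct (Rle_dec (Re a) (Re b)); assumption.
Qed.

Lemma pnear_clopen (z : C) (P : C -> Prop) :
  pnear z (fun w => near w P \/ near w (fun v => ~ P v)) ->
  pnear z P \/ pnear z (fun w => ~ P w).
Proof.
  intros [r [Hr H]].
  destruct (excluded_middle_informative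
    (exists p, p <> z /\ (Cmod (p - z) < r)%R /\ P p)) as [[p [Hp [Hpr HP]]]|N].
  - left; exists r; split; [exact Hr|]; intros q Hq Hqr.
    exact (clopen_punctured_disc z r P p q H Hp Hpr Hq Hqr HP).
  - right; exists r; split; [exact Hr|]; intros q Hq Hqr HP; apply N; eauto.
Qed.

(** Isolated points do not disconnect the strip.  It is star-shaped, and along a segment
    from 0 the condition to hold on a punctured neighbourhood is open and closed. *)
Lemma clopen_strip (P : C -> Prop) :
  (forall z, strip z -> pnear z P \/ pnear z (fun w => ~ P w)) ->
  pnear 0 P -> forall z, strip z -> pnear z P.
Proof.
  intros H H0 z Hz.
  set (g := fun t : R => 0 + RtoC t * z).
  replace z with (g 1%R) by (unfold g; ring).
  apply (clopen_path g (fun w => pnear w P)).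
  - intros t _; apply Rcont_affine.
  - intros t Ht.
    assert (Hs : strip (g t)).
    { unfold strip in *; replace (Im (g t)) with (t * Im z)%R
        by (unfold g; destruct z; simpl; ring).
      pose proof PI_RGT_0; destruct (Rle_dec 0 (Im z)); nra. }
    destruct (H _ Hs) as [Y|N]; [left|right].
    + destruct (pnear_near _ _ Y) as [d [Hd K]]; exists d; split; [exact Hd|].
      intros w Hw; destruct (Ceq_dec w (g t)) as [->|Nw]; [exact Y|].
      apply near_pnear, K; auto.
    + destruct (pnear_near _ _ N) as [d [Hd K]]; exists d; split; [exact Hd|].
      intros w Hw Y.
      assert (N' : pnear w (fun v => ~ P v)).
      { destruct (Ceq_dec w (g t)) as [->|Nw]; [exact N|].
        apply near_pnear, K; auto. }
      destruct (pnear_exists _ _ (pnear_and _ _ _ Y N')) as [v [_ [A B]]]; auto.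
  - replace (g 0%R) with (RtoC 0) by (unfold g; ring); exact H0.
Qed.

(** The tool behind every identification of a function that is only given off its
    singularities. *)
Lemma rigidity (f : C -> C) (Good : C -> Prop) :
  (forall z, Good z -> is_Cderive f z 0) ->
  (forall z, strip z -> pnear z Good) ->
  near 0 Good -> forall z, strip z -> Good z -> f z = f 0.
Proof.
  intros Hd HG G0 z Hz Gz.
  assert (Hloc : forall w, pnear w Good ->
    pnear w (fun v => near v (fun u => f u = f 0) \/ near v (fun u => f u <> f 0))).
  { intros w Hw; eapply pnear_mono; [exact (pnear_near _ _ Hw)|]; intros v _ Hv.
    assert (K : near v (fun u => f u = f v)).
    { apply near_is_Cderive_0; eapply near_mono; [exact Hv|]; auto. }
    destruct (Ceq_dec (f v) (f 0)) as [E|N]; [left|right];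
      (eapply near_mono; [exact K|]); intros u Hu; cbv beta in Hu; congruence. }
  assert (Hcont : forall w, Good w -> strip w -> pnear w (fun v => f v = f 0) ->
    f w = f 0).
  { intros w Gw Hw K; apply (Ccont_unique_lim f (fun _ => f 0)).
    - eapply is_Cderive_Ccont; eauto.
    - eapply is_Cderive_Ccont, is_Cderive_const.
    - exact K. }
  assert (S0 : strip 0) by (unfold strip; simpl; pose proof PI_RGT_0; lra).
  apply Hcont; auto.
  apply (clopen_strip (fun v => f v = f 0)); auto.
  - intros w Hw; apply pnear_clopen, Hloc, HG, Hw.
  - apply near_pnear, near_is_Cderive_0; eapply near_mono; [exact G0|]; auto.
Qed.

(** * Entire power series *)

(** Convergence is taken on the parts, so that the theory of real series applies. *)
Definition is_Cseries (u : nat -> C) (s : C) : Prop :=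
  is_series (fun n => Re (u n)) (Re s) /\ is_series (fun n => Im (u n)) (Im s).

Definition Cabs_summable (u : nat -> C) : Prop := ex_series (fun n => Cmod (u n)).

Definition Cseries (u : nat -> C) : C :=
  (Series (fun n => Re (u n)), Series (fun n => Im (u n))).

Lemma Cabs_summable_Re (u : nat -> C) :
  Cabs_summable u -> ex_series (fun n => Rabs (Re (u n))).
Proof.
  apply (ex_series_le (V := R_CompleteNormedModule)); intros n.
  unfold norm; simpl; unfold abs; simpl; rewrite Rabs_Rabsolu; apply re_le_Cmod.
Qed.

Lemma Cabs_summable_Im (u : nat -> C) :
  Cabs_summable u -> ex_series (fun n => Rabs (Im (u n))).
Proof.
  apply (ex_series_le (V := R_CompleteNormedModule)); intros n.
  unfold norm; simpl; unfold abs; simpl; rewrite Rabs_Rabsolu; apply im_le_Cmod.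
Qed.

Lemma Cseries_correct (u : nat -> C) : Cabs_summable u -> is_Cseries u (Cseries u).
Proof.
  intros H; split; apply Series_correct, ex_series_Rabs.
  - apply Cabs_summable_Re, H.
  - apply Cabs_summable_Im, H.
Qed.

Lemma is_Cseries_unique (u : nat -> C) (s t : C) :
  is_Cseries u s -> is_Cseries u t -> s = t.
Proof.
  intros [A B] [A' B']; apply C_eq.
  - apply is_series_unique in A; apply is_series_unique in A'; congruence.
  - apply is_series_unique in B; apply is_series_unique in B'; congruence.
Qed.

Lemma is_Cseries_ext (u v : nat -> C) (s : C) :
  (forall n, u n = v n) -> is_Cseries u s -> is_Cseries v s.
Proof.
  intros E [A B]; split; (eapply is_series_ext; [|eassumption]);
    intros n; simpl; now rewrite E.
Qed.

Lemma is_Cseries_plus (u v : nat -> C) (s t : C) :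
  is_Cseries u s -> is_Cseries v t -> is_Cseries (fun n => u n + v n) (s + t).
Proof.
  intros [A B] [A' B']; split;
    [exact (is_series_plus _ _ _ _ A A')|exact (is_series_plus _ _ _ _ B B')].
Qed.

Lemma is_Cseries_scal (a : C) (u : nat -> C) (s : C) :
  is_Cseries u s -> is_Cseries (fun n => a * u n) (a * s).
Proof.
  intros [A B]; split.
  - exact (is_series_minus _ _ _ _ (is_series_scal (Re a) _ _ A)
             (is_series_scal (Im a) _ _ B)).
  - exact (is_series_plus _ _ _ _ (is_series_scal (Re a) _ _ B)
             (is_series_scal (Im a) _ _ A)).
Qed.

Lemma is_Cseries_minus (u v : nat -> C) (s t : C) :
  is_Cseries u s -> is_Cseries v t -> is_Cseries (fun n => u n - v n) (s - t).
Proof.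
  intros [A B] [A' B']; split;
    [exact (is_series_minus _ _ _ _ A A')|exact (is_series_minus _ _ _ _ B B')].
Qed.

Lemma is_Cseries_shift (u : nat -> C) (s : C) :
  u 0%nat = 0 -> is_Cseries (fun n => u (S n)) s -> is_Cseries u s.
Proof.
  intros E [A B]; split; apply is_series_decr_1; rewrite E.
  - refine (eq_ind _ (fun x => is_series _ x) A _ _).
    change (Re s = (Re s + - 0)%R); ring.
  - refine (eq_ind _ (fun x => is_series _ x) B _ _).
    change (Im s = (Im s + - 0)%R); ring.
Qed.

Lemma is_Cseries_bound (u : nat -> C) (s : C) (b : nat -> R) (B : R) :
  is_Cseries u s -> (forall n, (Cmod (u n) <= b n)%R) -> is_series b B ->
  (Cmod s <= 2 * B)%R.
Proof.
  intros [A1 A2] H Hb.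
  assert (Hu : Cabs_summable u).
  { apply (ex_series_le (V := R_CompleteNormedModule) _ b); [|exists B; exact Hb].
    intros n; unfold norm; simpl; unfold abs; simpl.
    rewrite Rabs_pos_eq by apply Cmod_ge_0; apply H. }
  apply is_series_unique in A1; apply is_series_unique in A2.
  apply is_series_unique in Hb as HB.
  eapply Rle_trans; [apply Cmod_le_ReIm|].
  rewrite <- A1, <- A2, <- HB.
  assert (Hex : ex_series b) by (exists B; exact Hb).
  assert (E1 := Series_Rabs _ (Cabs_summable_Re _ Hu)).
  assert (E2 := Series_Rabs _ (Cabs_summable_Im _ Hu)).
  assert (F1 : (Series (fun n => Rabs (Re (u n))) <= Series b)%R).
  { apply Series_le; [|exact Hex]; intros n; split; [apply Rabs_pos|].
    eapply Rle_trans; [apply re_le_Cmod|apply H]. }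
  assert (F2 : (Series (fun n => Rabs (Im (u n))) <= Series b)%R).
  { apply Series_le; [|exact Hex]; intros n; split; [apply Rabs_pos|].
    eapply Rle_trans; [apply im_le_Cmod|apply H]. }
  lra.
Qed.

Definition Csum (f : nat -> C) (n : nat) : C :=
  (sum_f_R0 (fun k => Re (f k)) n, sum_f_R0 (fun k => Im (f k)) n).

Lemma Csum_0 (f : nat -> C) : Csum f 0 = f 0%nat.
Proof. apply C_eq; reflexivity. Qed.

Lemma Csum_S (f : nat -> C) (n : nat) : Csum f (S n) = Csum f n + f (S n).
Proof. apply C_eq; reflexivity. Qed.

Lemma Csum_ext (f g : nat -> C) (n : nat) :
  (forall k, (k <= n)%nat -> f k = g k) -> Csum f n = Csum g n.
Proof.
  induction n as [|n IH]; intros H.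
  - rewrite !Csum_0; apply H; lia.
  - rewrite !Csum_S, IH, H by (intros; apply H || lia; lia); reflexivity.
Qed.

Lemma Csum_scal (a : C) (f : nat -> C) (n : nat) :
  Csum (fun k => a * f k) n = a * Csum f n.
Proof.
  induction n as [|n IH]; [now rewrite !Csum_0|].
  rewrite !Csum_S, IH; ring.
Qed.

Lemma Csum_bound (f : nat -> C) (n : nat) :
  (Cmod (Csum f n) <= sum_f_R0 (fun k => Cmod (f k)) n)%R.
Proof.
  induction n as [|n IH]; [rewrite Csum_0; simpl; lra|].
  rewrite Csum_S; simpl; eapply Rle_trans; [apply Cmod_triangle|lra].
Qed.

(** Cauchy products: the real case applies to the four products of parts. *)
Lemma is_Cseries_mult (u v : nat -> C) (s t : C) :
  is_Cseries u s -> is_Cseries v t -> Cabs_summable u -> Cabs_summable v ->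
  is_Cseries (fun n => Csum (fun k => u k * v (n - k)%nat) n) (s * t).
Proof.
  intros [A B] [A' B'] Hu Hv.
  assert (Ru := Cabs_summable_Re _ Hu); assert (Iu := Cabs_summable_Im _ Hu).
  assert (Rv := Cabs_summable_Re _ Hv); assert (Iv := Cabs_summable_Im _ Hv).
  split.
  - eapply is_series_ext;
      [|exact (is_series_minus _ _ _ _ (is_series_mult _ _ _ _ A A' Ru Rv)
                 (is_series_mult _ _ _ _ B B' Iu Iv))].
    intros n; simpl.
    apply (eq_sym (minus_sum (fun k => (Re (u k) * Re (v (n - k)%nat))%R)
      (fun k => (Im (u k) * Im (v (n - k)%nat))%R) n)).
  - eapply is_series_ext;
      [|exact (is_series_plus _ _ _ _ (is_series_mult _ _ _ _ A B' Ru Iv)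
                 (is_series_mult _ _ _ _ B A' Iu Rv))].
    intros n; simpl; unfold plus; simpl.
    apply (eq_sym (plus_sum (fun k => (Re (u k) * Im (v (n - k)%nat))%R)
      (fun k => (Im (u k) * Re (v (n - k)%nat))%R) n)).
Qed.

Lemma is_series_zero : is_series (fun _ : nat => 0%R) 0%R.
Proof.
  assert (K := is_series_scal 0%R _ _ (is_series_geom 0 ltac:(rewrite Rabs_R0; lra))).
  unfold scal in K; simpl in K; unfold mult in K; simpl in K.
  rewrite Rmult_0_l in K; eapply is_series_ext; [|exact K]; intros n; simpl; ring.
Qed.

Definition entire (a : nat -> C) : Prop :=
  forall r : R, (0 <= r)%R -> ex_series (fun n => (Cmod (a n) * r ^ n)%R).

Definition powser (a : nat -> C) (z : C) : C := Cseries (fun n => a n * z ^ n).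

Lemma entire_summable (a : nat -> C) (z : C) :
  entire a -> Cabs_summable (fun n => a n * z ^ n).
Proof.
  intros H; eapply ex_series_ext; [|exact (H (Cmod z) (Cmod_ge_0 z))].
  intros n; simpl; now rewrite Cmod_mult, Cmod_pow.
Qed.

Lemma powser_correct (a : nat -> C) (z : C) :
  entire a -> is_Cseries (fun n => a n * z ^ n) (powser a z).
Proof. intros H; apply Cseries_correct, entire_summable, H. Qed.

Lemma powser_0 (a : nat -> C) : entire a -> powser a 0 = a 0%nat.
Proof.
  intros H; apply (is_Cseries_unique _ _ _ (powser_correct a 0 H)).
  assert (E : forall f : nat -> R, (forall n, f (S n) = 0%R) -> is_series f (f 0%nat)).
  { intros f Hf; apply is_series_decr_1.
    refine (eq_ind _ (fun x => is_series _ x) _ _ (eq_sym (plus_opp_r (f 0%nat)))).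
    eapply is_series_ext; [|exact is_series_zero]; intros n; now rewrite Hf. }
  split.
  - replace (Re (a 0%nat)) with (Re (a 0%nat * 0 ^ 0)) by (f_equal; simpl; ring).
    apply (E (fun n => Re (a n * 0 ^ n))); intros n; simpl; ring.
  - replace (Im (a 0%nat)) with (Im (a 0%nat * 0 ^ 0)) by (f_equal; simpl; ring).
    apply (E (fun n => Im (a n * 0 ^ n))); intros n; simpl; ring.
Qed.

Definition derived_coef (a : nat -> C) (n : nat) : C := RtoC (INR (S n)) * a (S n).

Lemma INR_le_pow2 (n : nat) : (INR n <= 2 ^ n)%R.
Proof.
  induction n as [|n IH]; [simpl; lra|].
  rewrite S_INR; simpl; assert (1 <= 2 ^ n)%R by (apply pow_R1_Rle; lra); lra.
Qed.

Lemma entire_derived_coef (a : nat -> C) : entire a -> entire (derived_coef a).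
Proof.
  intros H r Hr.
  assert (K := H (2 * (r + 1))%R ltac:(lra)).
  apply ex_series_incr_1 in K.
  apply (ex_series_le (V := R_CompleteNormedModule) _ _) with (2 := K).
  intros n; unfold norm; simpl; unfold abs; simpl.
  unfold derived_coef; rewrite Rabs_pos_eq.
  2:{ apply Rmult_le_pos; [apply Cmod_ge_0|apply pow_le, Hr]. }
  rewrite Cmod_mult, Cmod_R, Rabs_pos_eq by apply pos_INR.
  assert (Hm := Cmod_ge_0 (a (S n))).
  assert (H1 : (INR (S n) <= 2 ^ S n)%R) by apply INR_le_pow2.
  assert (H2 : (r ^ n <= (r + 1) ^ S n)%R).
  { apply Rle_trans with ((r + 1) ^ n)%R; [apply pow_incr; lra|].
    simpl; assert (0 <= (r + 1) ^ n)%R by (apply pow_le; lra); nra. }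
  assert (E : ((2 * (r + 1)) * (2 * (r + 1)) ^ n = 2 ^ S n * (r + 1) ^ S n)%R).
  { rewrite <- Rpow_mult_distr; reflexivity. }
  rewrite E, (Rmult_comm (INR _)), Rmult_assoc.
  apply Rmult_le_compat_l; [exact Hm|].
  apply Rmult_le_compat; auto using pos_INR, pow_le.
Qed.

Definition pow_derivative (n : nat) (z : C) : C :=
  match n with O => 0 | S k => RtoC (INR n) * z ^ k end.

Lemma pow_diff_bound (z h : C) (n : nat) :
  (Cmod h <= 1)%R -> (Cmod ((z + h) ^ n - z ^ n) <= Cmod h * (Cmod z + 1) ^ n)%R.
Proof.
  intros Hh; assert (H0 := Cmod_ge_0 h); assert (Hz := Cmod_ge_0 z).
  induction n as [|n IH].
  - replace ((z + h) ^ 0 - z ^ 0) with (RtoC 0) by (simpl; ring); rewrite Cmod_0; simpl; nra.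
  - rewrite !Cpow_S.
    replace ((z + h) * (z + h) ^ n - z * z ^ n)
      with (z * ((z + h) ^ n - z ^ n) + h * (z + h) ^ n) by ring.
    eapply Rle_trans; [apply Cmod_triangle|]; rewrite !Cmod_mult, Cmod_pow.
    assert (Hs : (Cmod (z + h) ^ n <= (Cmod z + 1) ^ n)%R).
    { apply pow_incr; split; [apply Cmod_ge_0|]; pose proof (Cmod_triangle z h); lra. }
    assert (A1 := Rmult_le_compat_l _ _ _ Hz IH).
    assert (A2 := Rmult_le_compat_l _ _ _ H0 Hs).
    simpl; lra.
Qed.

(** A second-order remainder with a bound that is again the general term of a power
    series, whence termwise differentiation. *)
Lemma pow_taylor_bound (z h : C) (n : nat) :
  (Cmod h <= 1)%R ->
  (Cmod ((z + h) ^ n - z ^ n - pow_derivative n z * h)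
   <= Cmod h * Cmod h * (Cmod z + 1) ^ n)%R.
Proof.
  intros Hh; assert (H0 := Cmod_ge_0 h); assert (Hz := Cmod_ge_0 z).
  induction n as [|n IH].
  - replace ((z + h) ^ 0 - z ^ 0 - pow_derivative 0 z * h) with (RtoC 0) by (simpl; ring).
    rewrite Cmod_0; simpl; nra.
  - assert (Hd : pow_derivative (S n) z = z * pow_derivative n z + z ^ n).
    { unfold pow_derivative; destruct n as [|n]; [simpl; ring|].
      rewrite (S_INR (S n)), RtoC_plus, Cpow_S; ring. }
    rewrite Hd, !Cpow_S.
    replace ((z + h) * (z + h) ^ n - z * z ^ n - (z * pow_derivative n z + z ^ n) * h)
      with (z * ((z + h) ^ n - z ^ n - pow_derivative n z * h) + h * ((z + h) ^ n - z ^ n)) by ring.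
    eapply Rle_trans; [apply Cmod_triangle|]; rewrite !Cmod_mult.
    assert (A1 := Rmult_le_compat_l _ _ _ Hz IH).
    assert (A2 := Rmult_le_compat_l _ _ _ H0 (pow_diff_bound z h n Hh)).
    simpl; lra.
Qed.

Lemma is_Cderive_powser (a : nat -> C) (z : C) :
  entire a -> is_Cderive (powser a) z (powser (derived_coef a) z).
Proof.
  intros Ha; apply is_Cderive_eps; intros eps He.
  destruct (Ha (Cmod z + 1)%R) as [B HB]; [pose proof (Cmod_ge_0 z); lra|].
  assert (HB0 : (0 <= B)%R).
  { rewrite <- (is_series_unique _ _ HB).
    rewrite <- (is_series_unique _ _ is_series_zero).
    apply Series_le; [|exists B; exact HB]; intros n; split; [lra|].
    apply Rmult_le_pos; [apply Cmod_ge_0|apply pow_le]; pose proof (Cmod_ge_0 z); lra. }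
  exists (Rmin 1 (eps / (2 * B + 1))); split.
  { apply Rmin_glb_lt; [lra|]; apply Rdiv_lt_0_compat; lra. }
  intros w Hw.
  assert (H1 := Rlt_le_trans _ _ _ Hw (Rmin_l _ _)).
  assert (H2 := Rlt_le_trans _ _ _ Hw (Rmin_r _ _)).
  set (h := w - z) in *.
  replace w with (z + h) by (unfold h; ring).
  assert (S1 : is_Cseries (fun n => a n * pow_derivative n z) (powser (derived_coef a) z)).
  { apply is_Cseries_shift; [simpl; ring|].
    eapply is_Cseries_ext; [|exact (powser_correct _ z (entire_derived_coef a Ha))].
    intros n; unfold derived_coef, pow_derivative; ring. }
  assert (S2 := is_Cseries_minus _ _ _ _
    (is_Cseries_minus _ _ _ _ (powser_correct a (z + h) Ha) (powser_correct a z Ha))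
    (is_Cseries_scal h _ _ S1)).
  apply (is_Cseries_ext _ (fun n => a n * ((z + h) ^ n - z ^ n - pow_derivative n z * h))) in S2;
    [|intros n; cbv beta; ring].
  assert (K := is_Cseries_bound _ _
    (fun n => (Cmod h * Cmod h * (Cmod (a n) * (Cmod z + 1) ^ n))%R)
    (Cmod h * Cmod h * B)%R S2).
  replace (powser (derived_coef a) z * h) with (h * powser (derived_coef a) z) by ring.
  assert (Hh := Cmod_ge_0 h).
  eapply Rle_trans; [apply K|].
  - intros n; rewrite Cmod_mult.
    assert (T := pow_taylor_bound z h n (Rlt_le _ _ H1)).
    assert (T2 := Rmult_le_compat_l _ _ _ (Cmod_ge_0 (a n)) T). lra.
  - exact (is_series_scal (Cmod h * Cmod h)%R _ _ HB).
  - apply Rlt_div_r in H2; [|lra]. nra.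
Qed.

Lemma powser_mult (a b : nat -> C) (z : C) :
  entire a -> entire b ->
  is_Cseries (fun n => Csum (fun k => a k * b (n - k)%nat) n * z ^ n)
    (powser a z * powser b z).
Proof.
  intros Ha Hb.
  eapply is_Cseries_ext;
    [|exact (is_Cseries_mult _ _ _ _ (powser_correct a z Ha) (powser_correct b z Hb)
               (entire_summable a z Ha) (entire_summable b z Hb))].
  intros n; cbv beta; rewrite Cmult_comm, <- Csum_scal; apply Csum_ext.
  intros k Hk; replace n with (k + (n - k))%nat at 3 by lia.
  rewrite Cpow_add_r; ring.
Qed.

(** The recurrence of the coefficients of a linear differential equation: the factor
    n + 1 on the left eventually exceeds K, and from then on the partial sums at most
    double at each step. *)
Lemma geometric_bound (t : nat -> R) (K : R) :
  (forall n, (0 <= t n)%R) ->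
  (forall n, (INR (S n) * t (S n) <= K * sum_f_R0 t n)%R) ->
  exists M : R, forall n, (t n <= M * 2 ^ n)%R.
Proof.
  intros Ht H.
  destruct (INR_unbounded K) as [N HN].
  assert (Hs : forall n, (0 <= sum_f_R0 t n)%R).
  { intros n; apply cond_pos_sum, Ht. }
  assert (Hmono : forall n m, (n <= m)%nat -> (sum_f_R0 t n <= sum_f_R0 t m)%R).
  { intros n m Hnm; induction Hnm as [|m Hnm IH]; [lra|]; simpl; specialize (Ht (S m)); lra. }
  assert (Hsum : forall k, (sum_f_R0 t (N + k) <= sum_f_R0 t N * 2 ^ k)%R).
  { induction k as [|k IH]; [rewrite Nat.add_0_r; simpl; lra|].
    rewrite Nat.add_succ_r; simpl.
    specialize (H (N + k)%nat).
    assert (Hk : (K <= INR (S (N + k)))%R).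
    { rewrite S_INR, plus_INR; pose proof (pos_INR k); lra. }
    assert (T : (t (S (N + k)) <= sum_f_R0 t (N + k))%R).
    { apply Rmult_le_reg_l with (INR (S (N + k))); [apply lt_0_INR; lia|].
      eapply Rle_trans; [exact H|]; apply Rmult_le_compat_r; auto. }
    lra. }
  exists (sum_f_R0 t N); intros n.
  assert (Hn : (t n <= sum_f_R0 t n)%R).
  { destruct n as [|n]; simpl; [lra|]; specialize (Hs n); lra. }
  eapply Rle_trans; [exact Hn|].
  apply Rle_trans with (sum_f_R0 t (N + n)); [apply Hmono; lia|apply Hsum].
Qed.

(** The geometric bound holds for every radius, and for the radius 4 (r + 1) it beats
    2^n. *)
Lemma entire_of_growth (a : nat -> C) (t : R -> nat -> R) :
  (forall r n, (1 <= r)%R -> (Cmod (a n) * r ^ n <= t r n)%R) ->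
  (forall r, (1 <= r)%R -> exists K, forall n,
     (INR (S n) * t r (S n) <= K * sum_f_R0 (t r) n)%R) ->
  entire a.
Proof.
  intros H1 H2 r Hr.
  set (r' := (4 * (r + 1))%R); assert (Hr' : (1 <= r')%R) by (unfold r'; lra).
  destruct (H2 r' Hr') as [K HK].
  assert (Hpos : forall n, (0 <= Cmod (a n) * r' ^ n)%R).
  { intros n; apply Rmult_le_pos; [apply Cmod_ge_0|apply pow_le; lra]. }
  destruct (geometric_bound (t r') K) as [M HM]; [|exact HK|].
  { intros n; eapply Rle_trans; [apply Hpos|apply H1, Hr']. }
  apply (ex_series_le (V := R_CompleteNormedModule) _ (fun n => M * (/ 2) ^ n)%R).
  2:{ apply (ex_series_scal (V := R_NormedModule) M), ex_series_geom.
      rewrite Rabs_pos_eq; lra. }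
  intros n; unfold norm; simpl; unfold abs; simpl.
  rewrite Rabs_pos_eq by (apply Rmult_le_pos; [apply Cmod_ge_0|apply pow_le; lra]).
  assert (B := Rle_trans _ _ _ (H1 r' n Hr') (HM n)).
  assert (P4 : (0 < 4 ^ n)%R) by (apply pow_lt; lra).
  apply Rmult_le_reg_l with (4 ^ n)%R; [exact P4|].
  apply Rle_trans with (M * 2 ^ n)%R.
  - eapply Rle_trans; [|exact B].
    unfold r'; rewrite Rpow_mult_distr.
    assert (r ^ n <= (r + 1) ^ n)%R by (apply pow_incr; lra).
    pose proof (Cmod_ge_0 (a n)).
    assert (Cmod (a n) * r ^ n <= Cmod (a n) * (r + 1) ^ n)%R
      by (apply Rmult_le_compat_l; auto).
    nra.
  - replace 4%R with (2 * 2)%R by ring; rewrite Rpow_mult_distr, pow_inv.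
    right; field; apply pow_nonzero; lra.
Qed.

(** * Linear systems with entire coefficients *)

Lemma entire_bounded (a : nat -> C) (r : R) :
  entire a -> (0 <= r)%R ->
  exists M : R, (0 <= M)%R /\ forall n, (Cmod (a n) * r ^ n <= M)%R.
Proof.
  intros H Hr.
  assert (L := ex_series_lim_0 _ (H r Hr)); apply is_lim_seq_Reals in L.
  destruct (maj_by_pos _ (exist _ _ L)) as [M [HM K]].
  exists M; split; [lra|]; intros n; eapply Rle_trans; [apply Rle_abs|apply K].
Qed.

Lemma RtoC_INR_neq_0 (n : nat) : RtoC (INR (S n)) <> 0.
Proof. intros E; apply RtoC_inj in E; revert E; apply not_0_INR; lia. Qed.

Definition lin_step (q : nat -> C) (c : C) (m : nat) (s : nat -> C * C) : C * C :=
  ((Csum (fun k => fst (s k) * q (m - k)%nat) m + c * snd (s m)) / RtoC (INR (S m)),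
   (c * fst (s m) - Csum (fun k => snd (s k) * q (m - k)%nat) m) / RtoC (INR (S m))).

(** Course-of-values recursion: the table of stage n is correct up to the index n. *)
Fixpoint lin_table (q : nat -> C) (c x0 y0 : C) (n : nat) : nat -> C * C :=
  match n with
  | O => fun _ => (x0, y0)
  | S m => fun k => if (k <=? m)%nat then lin_table q c x0 y0 m k
                    else lin_step q c m (lin_table q c x0 y0 m)
  end.

Definition lin_coef (q : nat -> C) (c x0 y0 : C) (n : nat) : C * C :=
  lin_table q c x0 y0 n n.

Lemma lin_table_coef (q : nat -> C) (c x0 y0 : C) (n k : nat) :
  (k <= n)%nat -> lin_table q c x0 y0 n k = lin_coef q c x0 y0 k.
Proof.
  induction n as [|n IH]; intros H.
  - replace k with 0%nat by lia; reflexivity.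
  - destruct (Nat.eq_dec k (S n)) as [->|N]; [reflexivity|].
    cbn [lin_table].
    replace (k <=? n)%nat with true by (symmetry; apply Nat.leb_le; lia).
    apply IH; lia.
Qed.

Lemma lin_coef_S (q : nat -> C) (c x0 y0 : C) (m : nat) :
  lin_coef q c x0 y0 (S m) = lin_step q c m (lin_coef q c x0 y0).
Proof.
  unfold lin_coef at 1; cbn [lin_table].
  replace (S m <=? m)%nat with false by (symmetry; apply Nat.leb_gt; lia).
  unfold lin_step; rewrite !(lin_table_coef q c x0 y0 m m) by lia.
  assert (E : forall f : C * C -> C,
    Csum (fun k => f (lin_table q c x0 y0 m k) * q (m - k)%nat) m
    = Csum (fun k => f (lin_coef q c x0 y0 k) * q (m - k)%nat) m).
  { intros f; apply Csum_ext; intros k Hk; now rewrite lin_table_coef by lia. }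
  now rewrite (E fst), (E snd).
Qed.

Lemma conv_bound (a q : nat -> C) (r M : R) (n : nat) :
  (0 <= r)%R -> (forall k, (Cmod (q k) * r ^ k <= M)%R) ->
  (Cmod (Csum (fun k => (a k * q (n - k)%nat)%C) n) * r ^ n
   <= M * sum_f_R0 (fun k => Cmod (a k) * r ^ k)%R n)%R.
Proof.
  intros Hr HM.
  eapply Rle_trans.
  { apply Rmult_le_compat_r; [apply pow_le, Hr|apply Csum_bound]. }
  rewrite Rmult_comm, !scal_sum; apply sum_Rle; intros k Hk.
  rewrite Cmod_mult; replace n with (k + (n - k))%nat at 2 by lia; rewrite pow_add.
  assert (P := Rmult_le_compat_l (Cmod (a k) * r ^ k) _ _
    (Rmult_le_pos _ _ (Cmod_ge_0 (a k)) (pow_le r k Hr)) (HM (n - k)%nat)).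
  lra.
Qed.

Lemma lin_coef_entire (q : nat -> C) (c x0 y0 : C) :
  entire q -> entire (fun n => fst (lin_coef q c x0 y0 n))
              /\ entire (fun n => snd (lin_coef q c x0 y0 n)).
Proof.
  intros Hq; set (s := lin_coef q c x0 y0).
  assert (G : forall r, (1 <= r)%R -> exists K, forall n,
    (INR (S n) * ((Cmod (fst (s (S n))) + Cmod (snd (s (S n)))) * r ^ (S n))
     <= K * sum_f_R0 (fun n => ((Cmod (fst (s n)) + Cmod (snd (s n))) * r ^ n)%R) n)%R).
  { intros r Hr; destruct (entire_bounded q r Hq ltac:(lra)) as [M [HM0 HM]].
    exists (r * (M + Cmod c))%R; intros n.
    unfold s at 1 2; rewrite lin_coef_S; fold s; unfold lin_step; cbn [fst snd].
    rewrite !Cmod_div by apply RtoC_INR_neq_0; rewrite Cmod_R, Rabs_pos_eq by apply pos_INR.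
    assert (HI : (0 < INR (S n))%R) by (apply lt_0_INR; lia).
    assert (B1 := conv_bound (fun k => fst (s k)) q r M n ltac:(lra) HM).
    assert (B2 := conv_bound (fun k => snd (s k)) q r M n ltac:(lra) HM).
    cbv beta in B1, B2.
    set (C1 := Csum (fun k => fst (s k) * q (n - k)%nat) n) in *.
    set (C2 := Csum (fun k => snd (s k) * q (n - k)%nat) n) in *.
    assert (T1 := Cmod_triangle C1 (c * snd (s n))).
    assert (T2 := Cmod_triangle (c * fst (s n)) (- C2)).
    rewrite Cmod_opp in T2; rewrite Cmod_mult in T1, T2.
    replace (sum_f_R0 (fun n => ((Cmod (fst (s n)) + Cmod (snd (s n))) * r ^ n)%R) n)
      with (sum_f_R0 (fun k => Cmod (fst (s k)) * r ^ k)%R n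
            + sum_f_R0 (fun k => Cmod (snd (s k)) * r ^ k)%R n)%R.
    2:{ rewrite <- plus_sum; apply sum_eq; intros; ring. }
    set (S1 := sum_f_R0 (fun k => Cmod (fst (s k)) * r ^ k)%R n) in *.
    set (S2 := sum_f_R0 (fun k => Cmod (snd (s k)) * r ^ k)%R n) in *.
    assert (L : forall f : nat -> R, (forall k, (0 <= f k)%R) -> (f n <= sum_f_R0 f n)%R).
    { intros f Hf; destruct n as [|n]; simpl; [lra|].
      pose proof (cond_pos_sum f n Hf); lra. }
    assert (Hp : forall k, (0 <= r ^ k)%R) by (intros; apply pow_le; lra).
    assert (L1 : (Cmod (fst (s n)) * r ^ n <= S1)%R).
    { apply (L (fun k => Cmod (fst (s k)) * r ^ k)%R); intros k.
      apply Rmult_le_pos; auto using Cmod_ge_0. }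
    assert (L2 : (Cmod (snd (s n)) * r ^ n <= S2)%R).
    { apply (L (fun k => Cmod (snd (s k)) * r ^ k)%R); intros k.
      apply Rmult_le_pos; auto using Cmod_ge_0. }
    replace (INR (S n) * ((Cmod (C1 + c * snd (s n)) / INR (S n)
               + Cmod (c * fst (s n) - C2) / INR (S n)) * r ^ S n))%R
      with (r * ((Cmod (C1 + c * snd (s n)) + Cmod (c * fst (s n) - C2)) * r ^ n))%R
      by (rewrite <- tech_pow_Rmult; set (I := INR (S n)) in *; clearbody I; field; lra).
    rewrite Rmult_assoc; apply Rmult_le_compat_l; [lra|].
    unfold Cminus.
    assert (D := Rmult_le_compat_r (r ^ n) _ _ (Hp n) (Rplus_le_compat _ _ _ _ T1 T2)).
    assert (E1 := Rmult_le_compat_l _ _ _ (Cmod_ge_0 c) L1).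
    assert (E2 := Rmult_le_compat_l _ _ _ (Cmod_ge_0 c) L2).
    lra. }
  split; apply (entire_of_growth _
    (fun r n => ((Cmod (fst (s n)) + Cmod (snd (s n))) * r ^ n)%R)); try exact G;
    intros r n Hr; apply Rmult_le_compat_r; try (apply pow_le; lra);
    pose proof (Cmod_ge_0 (fst (s n))); pose proof (Cmod_ge_0 (snd (s n))); lra.
Qed.

(** Comparing coefficients: with entire coefficients, the formal power series solution
    converges everywhere. *)
Lemma lin_exists (q : nat -> C) (c x0 y0 : C) :
  entire q ->
  exists x y : C -> C, x 0 = x0 /\ y 0 = y0 /\
    forall z, is_Cderive x z (powser q z * x z + c * y z)
           /\ is_Cderive y z (c * x z - powser q z * y z).
Proof.
  intros Hq; destruct (lin_coef_entire q c x0 y0 Hq) as [Ex Ey].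
  set (a := fun n => fst (lin_coef q c x0 y0 n)) in *.
  set (b := fun n => snd (lin_coef q c x0 y0 n)) in *.
  exists (powser a), (powser b).
  split; [apply (powser_0 a Ex)|]; split; [apply (powser_0 b Ey)|]; intros z; split.
  - eapply is_Cderive_eq; [apply is_Cderive_powser, Ex|].
    apply (is_Cseries_unique (fun n => derived_coef a n * z ^ n)).
    { apply powser_correct, entire_derived_coef, Ex. }
    replace (powser q z * powser a z) with (powser a z * powser q z) by ring.
    eapply is_Cseries_ext; [|exact (is_Cseries_plus _ _ _ _ (powser_mult a q z Ex Hq)
      (is_Cseries_scal c _ _ (powser_correct b z Ey)))].
    intros n; cbv beta; unfold derived_coef, a at 2; rewrite lin_coef_S; unfold lin_step; cbn [fst].
    fold (a n) (b n); change (snd (lin_coef q c x0 y0 n)) with (b n).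
    change (fun k => fst (lin_coef q c x0 y0 k) * q (n - k)%nat)
      with (fun k => a k * q (n - k)%nat).
    field; apply RtoC_INR_neq_0.
  - eapply is_Cderive_eq; [apply is_Cderive_powser, Ey|].
    apply (is_Cseries_unique (fun n => derived_coef b n * z ^ n)).
    { apply powser_correct, entire_derived_coef, Ey. }
    replace (powser q z * powser b z) with (powser b z * powser q z) by ring.
    eapply is_Cseries_ext; [|exact (is_Cseries_minus _ _ _ _
      (is_Cseries_scal c _ _ (powser_correct a z Ex)) (powser_mult b q z Ey Hq))].
    intros n; cbv beta; unfold derived_coef, b at 2; rewrite lin_coef_S; unfold lin_step; cbn [snd].
    change (fst (lin_coef q c x0 y0 n)) with (a n).
    change (fun k => snd (lin_coef q c x0 y0 k) * q (n - k)%nat)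
      with (fun k => b k * q (n - k)%nat).
    field; apply RtoC_INR_neq_0.
Qed.

Lemma Cderive_0_const (f : C -> C) :
  (forall z, is_Cderive f z 0) -> forall z, f z = f 0.
Proof. intros H z; apply is_Cderive_0_segment; auto. Qed.

Fixpoint exp_coef (s : C) (n : nat) : C :=
  match n with O => 1 | S m => s * exp_coef s m / RtoC (INR n) end.

Lemma exp_coef_S (s : C) (n : nat) :
  RtoC (INR (S n)) * exp_coef s (S n) = s * exp_coef s n.
Proof. cbn [exp_coef]; field; apply RtoC_INR_neq_0. Qed.

Lemma entire_exp_coef (s : C) : entire (exp_coef s).
Proof.
  apply (entire_of_growth _ (fun r n => Cmod (exp_coef s n) * r ^ n)%R); [intros; lra|].
  intros r Hr; exists (Cmod s * r)%R; intros n.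
  replace (INR (S n) * (Cmod (exp_coef s (S n)) * r ^ S n))%R
    with (Cmod (RtoC (INR (S n)) * exp_coef s (S n)) * (r * r ^ n))%R.
  2:{ rewrite Cmod_mult, Cmod_R, Rabs_pos_eq by apply pos_INR.
      rewrite <- tech_pow_Rmult; ring. }
  rewrite exp_coef_S, Cmod_mult.
  assert (Hp : forall k, (0 <= Cmod (exp_coef s k) * r ^ k)%R).
  { intros k; apply Rmult_le_pos; [apply Cmod_ge_0|apply pow_le; lra]. }
  assert (L : (Cmod (exp_coef s n) * r ^ n
    <= sum_f_R0 (fun k => Cmod (exp_coef s k) * r ^ k)%R n)%R).
  { destruct n as [|n]; simpl; [lra|]; pose proof (cond_pos_sum _ n Hp); simpl in *; lra. }
  assert (Hc : (0 <= Cmod s * r)%R) by (apply Rmult_le_pos; [apply Cmod_ge_0|lra]).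
  assert (T := Rmult_le_compat_l _ _ _ Hc L). lra.
Qed.

(** Both sides solve f' = s f with the same value at 0. *)
Lemma powser_exp (s z : C) : powser (exp_coef s) z = Cexp (s * z).
Proof.
  assert (E := entire_exp_coef s).
  assert (D : forall w, is_Cderive (powser (exp_coef s)) w (s * powser (exp_coef s) w)).
  { intros w; eapply is_Cderive_eq; [apply is_Cderive_powser, E|].
    apply (is_Cseries_unique (fun n => derived_coef (exp_coef s) n * w ^ n)).
    { apply powser_correct, entire_derived_coef, E. }
    eapply is_Cseries_ext; [|exact (is_Cseries_scal s _ _ (powser_correct _ w E))].
    intros n; unfold derived_coef; rewrite exp_coef_S; ring. }
  assert (K : powser (exp_coef s) z * Cexp (- s * z) = 1).
  { rewrite (Cderive_0_const (fun w => powser (exp_coef s) w * Cexp (- s * w))).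
    - rewrite powser_0 by exact E.
      replace (- s * 0) with (RtoC 0) by ring; rewrite Cexp_0.
      cbn [exp_coef]; ring.
    - intros w; eapply is_Cderive_eq.
      + apply is_Cderive_mult; [apply D|].
        apply is_Cderive_Cexp_comp, is_Cderive_mult;
          [apply is_Cderive_const|apply is_Cderive_id].
      + cbv beta; ring. }
  replace (- s * z) with (- (s * z)) in K by ring; rewrite Cexp_opp in K.
  pose proof (Cexp_neq_0 (s * z)).
  replace (powser (exp_coef s) z)
    with (powser (exp_coef s) z * / Cexp (s * z) * Cexp (s * z)) by (field; auto).
  rewrite K; ring.
Qed.

(** * The linear system of the Riccati equation *)

(** Half of q = l + mu (z + 1/z), in the variable zeta. *)
Definition half_q (l : nat) (mu : R) (z : C) : C :=
  (RtoC (INR l) + RtoC mu * (Cexp z + Cexp (- z))) / 2.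

(** The constant c = 1 / (2 i omega). *)
Definition coupling (omega : R) : C := / (2 * Ci * omega).

Definition linsol (l : nat) (mu omega : R) (x y : C -> C) : Prop :=
  forall z, is_Cderive x z (half_q l mu z * x z + coupling omega * y z)
         /\ is_Cderive y z (coupling omega * x z - half_q l mu z * y z).

Lemma entire_lin (a b : C) (u v : nat -> C) :
  entire u -> entire v -> entire (fun n => a * u n + b * v n).
Proof.
  intros Hu Hv r Hr.
  assert (K := ex_series_plus _ _
    (ex_series_scal (V := R_NormedModule) (Cmod a) _ (Hu r Hr))
    (ex_series_scal (V := R_NormedModule) (Cmod b) _ (Hv r Hr))).
  apply (ex_series_le (V := R_CompleteNormedModule) _ _) with (2 := K).
  intros n; unfold norm; simpl; unfold abs; simpl.
  assert (Hp : (0 <= r ^ n)%R) by now apply pow_le.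
  rewrite Rabs_pos_eq by (apply Rmult_le_pos; [apply Cmod_ge_0|exact Hp]).
  unfold plus, scal; simpl; unfold mult; simpl.
  assert (T := Rmult_le_compat_r _ _ _ Hp (Cmod_triangle (a * u n) (b * v n))).
  rewrite !Cmod_mult in T; lra.
Qed.

Lemma linsol_exists (l : nat) (mu omega : R) (x0 y0 : C) :
  exists x y : C -> C, x 0 = x0 /\ y 0 = y0 /\ linsol l mu omega x y.
Proof.
  set (m := RtoC mu / 2).
  set (u := fun n => m * exp_coef 1 n + m * exp_coef (- (1)) n).
  set (q := fun n => (INR l / 2) * exp_coef 0 n + 1 * u n).
  assert (Hu : entire u) by (apply entire_lin; apply entire_exp_coef).
  assert (Hq : entire q) by (apply entire_lin; [apply entire_exp_coef|exact Hu]).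
  assert (E : forall z, powser q z = half_q l mu z).
  { intros z; symmetry.
    apply (is_Cseries_unique (fun n => q n * z ^ n)); [|apply powser_correct, Hq].
    pose proof (powser_correct _ z (entire_exp_coef 0)) as K0.
    pose proof (powser_correct _ z (entire_exp_coef 1)) as K1.
    pose proof (powser_correct _ z (entire_exp_coef (- (1)))) as K2.
    rewrite powser_exp in K0, K1, K2.
    replace (0 * z) with (RtoC 0) in K0 by ring; rewrite Cexp_0 in K0.
    replace (1 * z) with z in K1 by ring.
    replace (- (1) * z) with (- z) in K2 by ring.
    pose proof (is_Cseries_plus _ _ _ _ (is_Cseries_scal (INR l / 2) _ _ K0)
      (is_Cseries_plus _ _ _ _ (is_Cseries_scal m _ _ K1) (is_Cseries_scal m _ _ K2))) as K.
    replace (half_q l mu z)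
      with (INR l / 2 * 1 + (m * Cexp z + m * Cexp (- z)))
      by (unfold half_q, m; field; intros X; apply RtoC_inj in X; lra).
    eapply is_Cseries_ext; [|exact K]; intros n; unfold q, u; ring. }
  destruct (lin_exists q (coupling omega) x0 y0 Hq) as [x [y [Hx [Hy H]]]].
  exists x, y; split; [exact Hx|]; split; [exact Hy|].
  intros z; rewrite <- (E z); apply H.
Qed.

Lemma linsol_lin (l : nat) (mu omega : R) (a b : C) (x y u v : C -> C) :
  linsol l mu omega x y -> linsol l mu omega u v ->
  linsol l mu omega (fun z => a * x z + b * u z) (fun z => a * y z + b * v z).
Proof.
  intros H K z; destruct (H z) as [H1 H2]; destruct (K z) as [K1 K2]; split;
    (eapply is_Cderive_eq; [apply is_Cderive_plus; (apply is_Cderive_mult;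
       [apply is_Cderive_const|eassumption])|cbv beta; ring]).
Qed.

(** The matrix of the system has trace zero. *)
Lemma linsol_wronskian (l : nat) (mu omega : R) (x y u v : C -> C) :
  linsol l mu omega x y -> linsol l mu omega u v ->
  forall z w, x z * v z - y z * u z = x w * v w - y w * u w.
Proof.
  intros H K.
  assert (E := Cderive_0_const (fun z => x z * v z - y z * u z)).
  intros z w; transitivity (x 0 * v 0 - y 0 * u 0); [|symmetry]; apply E;
    intros t; destruct (H t) as [H1 H2]; destruct (K t) as [K1 K2];
    (eapply is_Cderive_eq; [apply is_Cderive_minus; apply is_Cderive_mult; eassumption|ring]).
Qed.

(** The Wronskians of a solution with the two solutions of a basis determine it, and
    they are constant; this replaces a Gronwall estimate. *)
Lemma linsol_unique_0 (l : nat) (mu omega : R) (x y : C -> C) (p : C) :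
  linsol l mu omega x y -> x p = 0 -> y p = 0 -> forall z, x z = 0 /\ y z = 0.
Proof.
  intros H Hx Hy z.
  destruct (linsol_exists l mu omega 1 0) as [u [v [U0 [V0 K]]]].
  destruct (linsol_exists l mu omega 0 1) as [u' [v' [U0' [V0' K']]]].
  assert (W := linsol_wronskian _ _ _ _ _ _ _ H K z p).
  assert (W' := linsol_wronskian _ _ _ _ _ _ _ H K' z p).
  assert (D := linsol_wronskian _ _ _ _ _ _ _ K K' z 0).
  rewrite U0, V0, U0', V0' in D; rewrite Hx, Hy in W, W'.
  split.
  - replace (x z) with (u z * (x z * v' z - y z * u' z) - u' z * (x z * v z - y z * u z)
      + x z * (1 - (u z * v' z - v z * u' z))) by ring.
    rewrite W, W', D; ring.
  - replace (y z) with (v z * (x z * v' z - y z * u' z) - v' z * (x z * v z - y z * u z)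
      + y z * (1 - (u z * v' z - v z * u' z))) by ring.
    rewrite W, W', D; ring.
Qed.

Lemma linsol_unique (l : nat) (mu omega : R) (x y u v : C -> C) (p : C) :
  linsol l mu omega x y -> linsol l mu omega u v -> x p = u p -> y p = v p ->
  forall z, x z = u z /\ y z = v z.
Proof.
  intros H K Hx Hy z.
  destruct (linsol_unique_0 _ _ _ _ _ p (linsol_lin _ _ _ 1 (- (1)) _ _ _ _ H K)) with z
    as [A B].
  - rewrite Hx; ring.
  - rewrite Hy; ring.
  - split; [replace (x z) with (u z + (1 * x z + - (1) * u z)) by ring; rewrite A
           |replace (y z) with (v z + (1 * y z + - (1) * v z)) by ring; rewrite B]; ring.
Qed.

(** * Smooth functions *)

(** The domain is a parameter because the polynomials of the recurrence involve negative
    powers of z, while everything else is entire in zeta. *)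
Fixpoint smooth_upto (D : C -> Prop) (n : nat) (f : C -> C) : Prop :=
  match n with
  | O => True
  | S m => exists f' : C -> C,
      (forall z, D z -> is_Cderive f z (f' z)) /\ smooth_upto D m f'
  end.

Definition smooth_on (D : C -> Prop) (f : C -> C) : Prop :=
  forall n, smooth_upto D n f.

Definition open_set (D : C -> Prop) : Prop := forall z, D z -> near z D.

Lemma smooth_upto_ext (D : C -> Prop) (n : nat) (f g : C -> C) :
  open_set D -> (forall z, D z -> f z = g z) -> smooth_upto D n f -> smooth_upto D n g.
Proof.
  intros HD E; destruct n as [|n]; [auto|]; intros [f' [H K]]; exists f'; split; [|exact K].
  intros z Hz; apply (is_Cderive_near f); [|now apply H].
  eapply near_mono; [exact (HD z Hz)|exact E].
Qed.

Lemma smooth_upto_pred (D : C -> Prop) (n : nat) (f : C -> C) :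
  smooth_upto D (S n) f -> smooth_upto D n f.
Proof.
  revert f; induction n as [|n IH]; intros f; [simpl; auto|].
  intros [f' [H K]]; exists f'; split; [exact H|apply IH, K].
Qed.

Lemma smooth_upto_const (D : C -> Prop) (n : nat) (a : C) : smooth_upto D n (fun _ => a).
Proof.
  revert a; induction n as [|n IH]; intros a; simpl; [auto|].
  exists (fun _ => 0); split; [intros; apply is_Cderive_const|apply IH].
Qed.

Lemma smooth_upto_plus (D : C -> Prop) (n : nat) (f g : C -> C) :
  smooth_upto D n f -> smooth_upto D n g -> smooth_upto D n (fun z => f z + g z).
Proof.
  revert f g; induction n as [|n IH]; intros f g; [simpl; auto|].
  intros [f' [H K]] [g' [H' K']]; exists (fun z => f' z + g' z); split.
  - intros z Hz; apply is_Cderive_plus; auto.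
  - now apply IH.
Qed.

Lemma smooth_upto_mult (D : C -> Prop) (n : nat) (f g : C -> C) :
  smooth_upto D n f -> smooth_upto D n g -> smooth_upto D n (fun z => f z * g z).
Proof.
  revert f g; induction n as [|n IH]; intros f g Hf Hg; [simpl; auto|].
  assert (Pf := smooth_upto_pred _ _ _ Hf); assert (Pg := smooth_upto_pred _ _ _ Hg).
  destruct Hf as [f' [H K]]; destruct Hg as [g' [H' K']].
  exists (fun z => f' z * g z + f z * g' z); split.
  - intros z Hz; apply is_Cderive_mult; auto.
  - apply smooth_upto_plus; now apply IH.
Qed.

Lemma smooth_upto_inv (D : C -> Prop) (n : nat) (f : C -> C) :
  (forall z, D z -> f z <> 0) -> smooth_upto D n f -> smooth_upto D n (fun z => / f z).
Proof.
  intros H0; induction n as [|n IH]; intros Hf; [simpl; auto|].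
  assert (Pf := IH (smooth_upto_pred _ _ _ Hf)).
  destruct Hf as [f' [H K]].
  exists (fun z => - (1) * f' z * (/ f z * / f z)); split.
  - intros z Hz; eapply is_Cderive_eq; [apply is_Cderive_inv; auto|].
    field; auto.
  - repeat apply smooth_upto_mult; auto using smooth_upto_const.
Qed.

Lemma smooth_const (D : C -> Prop) (a : C) : smooth_on D (fun _ => a).
Proof. intros n; apply smooth_upto_const. Qed.

Lemma smooth_id (D : C -> Prop) : smooth_on D (fun z => z).
Proof.
  intros [|n]; simpl; [auto|].
  exists (fun _ => 1); split; [intros; apply is_Cderive_id|apply smooth_upto_const].
Qed.

Lemma smooth_plus (D : C -> Prop) (f g : C -> C) :
  smooth_on D f -> smooth_on D g -> smooth_on D (fun z => f z + g z).
Proof. intros H K n; apply smooth_upto_plus; auto. Qed.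

Lemma smooth_mult (D : C -> Prop) (f g : C -> C) :
  smooth_on D f -> smooth_on D g -> smooth_on D (fun z => f z * g z).
Proof. intros H K n; apply smooth_upto_mult; auto. Qed.

Lemma smooth_inv (D : C -> Prop) (f : C -> C) :
  (forall z, D z -> f z <> 0) -> smooth_on D f -> smooth_on D (fun z => / f z).
Proof. intros H K n; apply smooth_upto_inv; auto. Qed.

Lemma smooth_ext (D : C -> Prop) (f g : C -> C) :
  open_set D -> (forall z, D z -> f z = g z) -> smooth_on D f -> smooth_on D g.
Proof. intros HD E H n; eapply smooth_upto_ext; eauto. Qed.

Lemma smooth_opp (D : C -> Prop) (f : C -> C) :
  smooth_on D f -> smooth_on D (fun z => - f z).
Proof.
  intros H; replace (fun z => - f z) with (fun z => - (1) * f z)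
    by (apply functional_extensionality; intros; ring).
  apply smooth_mult; [apply smooth_const|exact H].
Qed.

Lemma smooth_minus (D : C -> Prop) (f g : C -> C) :
  smooth_on D f -> smooth_on D g -> smooth_on D (fun z => f z - g z).
Proof. intros H K; apply smooth_plus; [exact H|apply smooth_opp, K]. Qed.

Lemma smooth_derive (D : C -> Prop) (f : C -> C) (z : C) :
  smooth_on D f -> D z -> is_Cderive f z (C_derive f z).
Proof.
  intros H Hz; destruct (H 1%nat) as [f' [K _]].
  now rewrite (is_Cderive_unique _ _ _ (K z Hz)); apply K.
Qed.

Lemma smooth_C_derive (D : C -> Prop) (f : C -> C) :
  open_set D -> smooth_on D f -> smooth_on D (C_derive f).
Proof.
  intros HD H n; destruct (H (S n)) as [f' [K L]].
  apply (smooth_upto_ext D n f'); auto.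
  intros z Hz; symmetry; apply is_Cderive_unique, K, Hz.
Qed.

Definition everywhere : C -> Prop := fun _ => True.

Lemma open_everywhere : open_set everywhere.
Proof. intros z _; exists 1%R; split; [lra|constructor]. Qed.

Notation smooth := (smooth_on everywhere).

Lemma smooth_is_Cderive (f : C -> C) (z : C) :
  smooth f -> is_Cderive f z (C_derive f z).
Proof. intros H; now apply (smooth_derive everywhere). Qed.

Lemma smooth_derivative (f : C -> C) : smooth f -> smooth (C_derive f).
Proof. apply smooth_C_derive, open_everywhere. Qed.

Lemma smooth_Cexp : smooth Cexp.
Proof.
  intros n; induction n as [|n IH]; simpl; [auto|].
  exists Cexp; split; [intros; apply is_Cderive_Cexp|exact IH].
Qed.

Lemma is_Cderive_Cexp_opp (z : C) :
  is_Cderive (fun w => Cexp (- w)) z (- Cexp (- z)).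
Proof.
  eapply is_Cderive_eq.
  - apply is_Cderive_Cexp_comp, is_Cderive_opp, is_Cderive_id.
  - ring.
Qed.

Lemma smooth_Cexp_opp : smooth (fun z => Cexp (- z)).
Proof.
  intros n; induction n as [|n IH]; simpl; [auto|].
  exists (fun z => - (1) * Cexp (- z)); split.
  - intros z _; eapply is_Cderive_eq; [apply is_Cderive_Cexp_opp|ring].
  - apply smooth_upto_mult; [apply smooth_upto_const|exact IH].
Qed.

Lemma smooth_half_q (l : nat) (mu : R) : smooth (half_q l mu).
Proof.
  unfold half_q, Cdiv; apply smooth_mult; [|apply smooth_const].
  apply smooth_plus; [apply smooth_const|]; apply smooth_mult; [apply smooth_const|].
  apply smooth_plus; [apply smooth_Cexp|apply smooth_Cexp_opp].
Qed.

Lemma linsol_smooth (l : nat) (mu omega : R) (x y : C -> C) :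
  linsol l mu omega x y -> smooth x /\ smooth y.
Proof.
  intros H; assert (K : forall n,
    smooth_upto everywhere n x /\ smooth_upto everywhere n y).
  { induction n as [|n [IHx IHy]]; [simpl; auto|].
    assert (Hq := smooth_half_q l mu n); split.
    - exists (fun z => half_q l mu z * x z + coupling omega * y z); split.
      + intros z _; apply H.
      + apply smooth_upto_plus; (apply smooth_upto_mult;
          [first [exact Hq|apply smooth_upto_const]|assumption]).
    - exists (fun z => coupling omega * x z + - (1) * (half_q l mu z * y z)); split.
      + intros z _; eapply is_Cderive_eq; [apply H|ring].
      + apply smooth_upto_plus; (apply smooth_upto_mult; [apply smooth_upto_const|]);
          [exact IHx|apply smooth_upto_mult; assumption]. }
  split; intros n; apply K.
Qed.

(** * The ladder of commuting operators *)

(** The function m = (mu/2) (1/z - z). *)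
Definition weight (mu : R) (z : C) : C := RtoC mu / 2 * (Cexp (- z) - Cexp z).

(** The operator D_j = d/dzeta + m + j. *)
Definition rung (mu : R) (j : C) (f : C -> C) (z : C) : C :=
  C_derive f z + (weight mu z + j) * f z.

Lemma smooth_weight (mu : R) : smooth (weight mu).
Proof.
  unfold weight; apply smooth_mult; [apply smooth_const|].
  apply smooth_minus; [apply smooth_Cexp_opp|apply smooth_Cexp].
Qed.

Lemma smooth_rung (mu : R) (j : C) (f : C -> C) : smooth f -> smooth (rung mu j f).
Proof.
  intros H; apply smooth_plus; [apply smooth_derivative, H|].
  apply smooth_mult; [apply smooth_plus; [apply smooth_weight|apply smooth_const]|exact H].
Qed.

Lemma rung_0 (mu : R) (j : C) (f : C -> C) (z : C) :
  rung mu j f z = rung mu 0 f z + j * f z.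
Proof. unfold rung; ring. Qed.

Lemma rung_plus (mu : R) (j : C) (f g : C -> C) :
  smooth f -> smooth g ->
  rung mu j (fun z => f z + g z) = fun z => rung mu j f z + rung mu j g z.
Proof.
  intros Hf Hg; apply functional_extensionality; intros z; unfold rung.
  rewrite (is_Cderive_unique _ _ _ (is_Cderive_plus _ _ _ _ _
    (smooth_is_Cderive _ z Hf) (smooth_is_Cderive _ z Hg))); ring.
Qed.

Lemma rung_scal (mu : R) (j a : C) (f : C -> C) :
  smooth f -> rung mu j (fun z => a * f z) = fun z => a * rung mu j f z.
Proof.
  intros Hf; apply functional_extensionality; intros z; unfold rung.
  rewrite (is_Cderive_unique _ _ _ (is_Cderive_mult _ _ _ _ _
    (is_Cderive_const a z) (smooth_is_Cderive _ z Hf))); ring.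
Qed.

Lemma rung_Cexp (mu : R) (j : C) (f : C -> C) :
  smooth f -> rung mu j (fun z => Cexp z * f z) = fun z => Cexp z * rung mu (j + 1) f z.
Proof.
  intros Hf; apply functional_extensionality; intros z; unfold rung.
  rewrite (is_Cderive_unique _ _ _ (is_Cderive_mult _ _ _ _ _
    (is_Cderive_Cexp z) (smooth_is_Cderive _ z Hf))); ring.
Qed.

Lemma rung_Cexp_opp (mu : R) (j : C) (f : C -> C) :
  smooth f ->
  rung mu j (fun z => Cexp (- z) * f z) = fun z => Cexp (- z) * rung mu (j - 1) f z.
Proof.
  intros Hf; apply functional_extensionality; intros z; unfold rung.
  rewrite (is_Cderive_unique _ _ _ (is_Cderive_mult _ _ _ _ _
    (is_Cderive_Cexp_opp z) (smooth_is_Cderive _ z Hf))); ring.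
Qed.

Lemma rung_rung (mu : R) (a b : C) (f : C -> C) (z : C) :
  smooth f ->
  rung mu a (rung mu b f) z
  = rung mu 0 (rung mu 0 f) z + (a + b) * rung mu 0 f z + a * b * f z.
Proof.
  intros Hf.
  replace (rung mu b f) with (fun z => rung mu 0 f z + b * f z)
    by (apply functional_extensionality; intros w; now rewrite (rung_0 mu b)).
  rewrite rung_plus, rung_scal; auto using smooth_rung.
  - rewrite (rung_0 mu a (rung mu 0 f)), (rung_0 mu a f); ring.
  - apply smooth_mult; auto using smooth_const.
Qed.

Lemma rung_comm (mu : R) (a b : C) (f : C -> C) :
  smooth f -> rung mu a (rung mu b f) = rung mu b (rung mu a f).
Proof.
  intros Hf; apply functional_extensionality; intros z.
  rewrite (rung_rung mu a b), (rung_rung mu b a) by exact Hf; ring.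
Qed.

Fixpoint ladder (mu : R) (j : C) (n : nat) (f : C -> C) : C -> C :=
  match n with
  | O => f
  | S k => rung mu (j + RtoC (INR k)) (ladder mu j k f)
  end.

Lemma smooth_ladder (mu : R) (j : C) (n : nat) (f : C -> C) :
  smooth f -> smooth (ladder mu j n f).
Proof. intros H; induction n; simpl; auto using smooth_rung. Qed.

Lemma ladder_rung (mu : R) (j a : C) (n : nat) (f : C -> C) :
  smooth f -> ladder mu j n (rung mu a f) = rung mu a (ladder mu j n f).
Proof.
  intros H; induction n as [|n IH]; simpl; [reflexivity|].
  now rewrite IH, rung_comm by now apply smooth_ladder.
Qed.

Lemma ladder_S_bottom (mu : R) (j : C) (n : nat) (f : C -> C) :
  ladder mu j (S n) f = ladder mu (j + 1) n (rung mu j f).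
Proof.
  induction n as [|n IH].
  - cbn [ladder]; f_equal; simpl; ring.
  - change (ladder mu j (S (S n)) f)
      with (rung mu (j + RtoC (INR (S n))) (ladder mu j (S n) f)).
    rewrite IH; cbn [ladder]; f_equal; rewrite S_INR, RtoC_plus; ring.
Qed.

Lemma ladder_plus (mu : R) (j : C) (n : nat) (f g : C -> C) :
  smooth f -> smooth g ->
  ladder mu j n (fun z => f z + g z) = fun z => ladder mu j n f z + ladder mu j n g z.
Proof.
  intros Hf Hg; induction n as [|n IH]; simpl; [reflexivity|].
  rewrite IH; apply rung_plus; now apply smooth_ladder.
Qed.

Lemma ladder_scal (mu : R) (j a : C) (n : nat) (f : C -> C) :
  smooth f -> ladder mu j n (fun z => a * f z) = fun z => a * ladder mu j n f z.
Proof.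
  intros Hf; induction n as [|n IH]; simpl; [reflexivity|].
  rewrite IH; apply rung_scal; now apply smooth_ladder.
Qed.

(** Multiplication by z shifts the index of every operator. *)
Lemma ladder_Cexp (mu : R) (j : C) (n : nat) (f : C -> C) :
  smooth f ->
  ladder mu j n (fun z => Cexp z * f z) = fun z => Cexp z * ladder mu (j + 1) n f z.
Proof.
  intros Hf; induction n as [|n IH]; simpl; [reflexivity|].
  rewrite IH, rung_Cexp by now apply smooth_ladder.
  apply functional_extensionality; intros z; do 2 f_equal; ring.
Qed.

Lemma ladder_Cexp_opp (mu : R) (j : C) (n : nat) (f : C -> C) :
  smooth f ->
  ladder mu j n (fun z => Cexp (- z) * f z)
  = fun z => Cexp (- z) * ladder mu (j - 1) n f z.
Proof.
  intros Hf; induction n as [|n IH]; simpl; [reflexivity|].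
  rewrite IH, rung_Cexp_opp by now apply smooth_ladder.
  apply functional_extensionality; intros z; do 2 f_equal; ring.
Qed.

(** * Climbing the ladder: the hidden symmetry *)

Definition half_l (l : nat) : C := RtoC (INR l) / 2.

Lemma two_neq_0 : RtoC 2 <> 0.
Proof. intros E; apply RtoC_inj in E; lra. Qed.

Lemma half_l_double (l : nat) : half_l l + half_l l = RtoC (INR l).
Proof. unfold half_l; field. Qed.

(** The y-component of the new solution comes from x alone, and its x-component from y. *)
Definition climb_y (l : nat) (mu : R) (x : C -> C) : C -> C := ladder mu (- half_l l) l x.

Definition climb_x (l : nat) (mu : R) (y : C -> C) : C -> C := ladder mu (1 - half_l l) l y.

Lemma ladder_start_x (l : nat) (mu omega : R) (x y : C -> C) :
  linsol l mu omega x y ->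
  rung mu (- half_l l) x
  = fun z => RtoC mu * (Cexp (- z) * x z) + coupling omega * y z.
Proof.
  intros H; apply functional_extensionality; intros z; unfold rung.
  rewrite (is_Cderive_unique _ _ _ (proj1 (H z))); unfold half_q, weight, half_l; field.
Qed.

Lemma ladder_start_y (l : nat) (mu omega : R) (x y : C -> C) :
  linsol l mu omega x y ->
  rung mu (half_l l) y
  = fun z => coupling omega * x z + - RtoC mu * (Cexp z * y z).
Proof.
  intros H; apply functional_extensionality; intros z; unfold rung.
  rewrite (is_Cderive_unique _ _ _ (proj2 (H z))); unfold half_q, weight, half_l; field.
Qed.

(** One more operator completes the product to the one with l + 1 factors starting at
    D_{-l/2}.  Its bottom factor turns x into (mu/z) x + c y.  The remaining l factors
    give c X on the second term; on the first, moving 1/z out lowers all indices by one,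
    which gives the product that defines Y.  The indices match because l is the number
    of factors. *)
Lemma climb_y_eq (l : nat) (mu omega : R) (x y : C -> C) :
  linsol l mu omega x y ->
  rung mu (half_l l) (climb_y l mu x)
  = fun z => coupling omega * climb_x l mu y z + RtoC mu * Cexp (- z) * climb_y l mu x z.
Proof.
  intros H; destruct (linsol_smooth _ _ _ _ _ H) as [Sx Sy].
  unfold climb_y at 1.
  replace (half_l l) with (- half_l l + RtoC (INR l)) at 1 by (rewrite <- half_l_double; ring).
  change (rung mu (- half_l l + RtoC (INR l)) (ladder mu (- half_l l) l x))
    with (ladder mu (- half_l l) (S l) x).
  rewrite ladder_S_bottom, (ladder_start_x _ _ _ _ _ H).
  assert (S1 : smooth (fun z => Cexp (- z) * x z))
    by (apply smooth_mult; auto using smooth_Cexp_opp).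
  rewrite ladder_plus, !ladder_scal, ladder_Cexp_opp;
    auto using smooth_mult, smooth_const.
  apply functional_extensionality; intros z; unfold climb_x, climb_y.
  replace (- half_l l + 1 - 1) with (- half_l l) by ring.
  replace (- half_l l + 1) with (1 - half_l l) by ring; ring.
Qed.

(** As for [climb_y_eq], with the extra factor at the bottom of the product: D_{l/2} y is
    c x - mu z y, and moving z out raises all indices by one. *)
Lemma climb_x_eq (l : nat) (mu omega : R) (x y : C -> C) :
  linsol l mu omega x y ->
  rung mu (- half_l l) (climb_x l mu y)
  = fun z => coupling omega * climb_y l mu x z - RtoC mu * Cexp z * climb_x l mu y z.
Proof.
  intros H; destruct (linsol_smooth _ _ _ _ _ H) as [Sx Sy].
  unfold climb_x at 1; rewrite <- ladder_rung by exact Sy.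
  replace (1 - half_l l) with (- half_l l + 1) by ring.
  rewrite <- ladder_S_bottom; cbn [ladder].
  replace (- half_l l + RtoC (INR l)) with (half_l l) by (rewrite <- half_l_double; ring).
  rewrite <- ladder_rung, (ladder_start_y _ _ _ _ _ H) by exact Sy.
  assert (S1 : smooth (fun z => Cexp z * y z))
    by (apply smooth_mult; auto using smooth_Cexp).
  rewrite ladder_plus, !ladder_scal, ladder_Cexp;
    auto using smooth_mult, smooth_const.
  apply functional_extensionality; intros z; unfold climb_x, climb_y.
  replace (- half_l l + 1) with (1 - half_l l) by ring; ring.
Qed.

Definition half_turn (f : C -> C) (z : C) : C := f (z + Ci * PI).

Lemma is_Cderive_half_turn (f : C -> C) (z d : C) :
  is_Cderive f (z + Ci * PI) d -> is_Cderive (half_turn f) z d.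
Proof.
  intros H; eapply is_Cderive_eq.
  - apply (is_Cderive_comp f (fun w => w + Ci * PI)); [exact H|].
    apply is_Cderive_plus; [apply is_Cderive_id|apply is_Cderive_const].
  - ring.
Qed.

Lemma Cexp_opp_shift_iPI (z : C) : Cexp (- (z + Ci * PI)) = - Cexp (- z).
Proof.
  rewrite !Cexp_opp, Cexp_shift_iPI; field; apply Cexp_neq_0.
Qed.

Lemma weight_shift (mu : R) (z : C) : weight mu (z + Ci * PI) = - weight mu z.
Proof. unfold weight; rewrite Cexp_shift_iPI, Cexp_opp_shift_iPI; ring. Qed.

(** The climbed pair solves the system with -mu, which is the system at -z. *)
Lemma linsol_turned (l : nat) (mu omega : R) (x y : C -> C) :
  linsol l mu omega x y ->
  linsol l mu omega (half_turn (climb_x l mu y)) (half_turn (climb_y l mu x)).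
Proof.
  intros H; destruct (linsol_smooth _ _ _ _ _ H) as [Sx Sy]; intros z.
  assert (X := f_equal (fun f => f (z + Ci * PI)) (climb_x_eq _ _ _ _ _ H)).
  assert (Y := f_equal (fun f => f (z + Ci * PI)) (climb_y_eq _ _ _ _ _ H)).
  cbv beta in X, Y; unfold rung in X, Y.
  rewrite weight_shift in X, Y; rewrite Cexp_shift_iPI in X; rewrite Cexp_opp_shift_iPI in Y.
  split; (eapply is_Cderive_eq;
    [apply is_Cderive_half_turn, smooth_is_Cderive, smooth_ladder; assumption|]);
    unfold half_turn.
  - replace (C_derive (climb_x l mu y) (z + Ci * PI)) with
      (C_derive (climb_x l mu y) (z + Ci * PI)
       + (- weight mu z + - half_l l) * climb_x l mu y (z + Ci * PI)
       - (- weight mu z + - half_l l) * climb_x l mu y (z + Ci * PI)) by ring.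
    rewrite X; unfold half_q, weight, half_l; field.
  - replace (C_derive (climb_y l mu x) (z + Ci * PI)) with
      (C_derive (climb_y l mu x) (z + Ci * PI)
       + (- weight mu z + half_l l) * climb_y l mu x (z + Ci * PI)
       - (- weight mu z + half_l l) * climb_y l mu x (z + Ci * PI)) by ring.
    rewrite Y; unfold half_q, weight, half_l; field.
Qed.

(** * The adjoint identity *)

Lemma Cexp_mult_opp (z : C) : Cexp (- z) * Cexp z = 1.
Proof. rewrite Cexp_opp; field; apply Cexp_neq_0. Qed.

Lemma is_Cderive_weight (mu : R) (z : C) :
  is_Cderive (weight mu) z (- (RtoC mu / 2) * (Cexp (- z) + Cexp z)).
Proof.
  eapply is_Cderive_eq.
  - apply is_Cderive_mult; [apply is_Cderive_const|].
    apply is_Cderive_minus; [apply is_Cderive_Cexp_opp|apply is_Cderive_Cexp].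
  - cbv beta; ring.
Qed.

Lemma C_derive_rung (mu : R) (j : C) (f : C -> C) (z : C) :
  smooth f ->
  C_derive (rung mu j f) z
  = C_derive (C_derive f) z - RtoC mu / 2 * (Cexp (- z) + Cexp z) * f z
    + (weight mu z + j) * C_derive f z.
Proof.
  intros H; apply is_Cderive_unique; eapply is_Cderive_eq.
  - apply is_Cderive_plus; [apply smooth_is_Cderive, smooth_derivative, H|].
    apply is_Cderive_mult; [|apply smooth_is_Cderive, H].
    apply is_Cderive_plus; [apply is_Cderive_weight|apply is_Cderive_const].
  - cbv beta; ring.
Qed.

Definition second_order_constant (l : nat) (mu omega : R) : C :=
  half_l l * half_l l + coupling omega * coupling omega + RtoC mu * RtoC mu.

(** Lowering the starting index of a product by one exchanges its extreme factors, and
    two products of two operators with the same sum of indices differ by a constant. *)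
Lemma ladder_shift_opp (mu : R) (j a : C) (k : nat) (f : C -> C) (z : C) :
  smooth f ->
  rung mu a (ladder mu (j - 1) k f) z
  = rung mu (a - RtoC (INR k)) (ladder mu j k f) z
    + RtoC (INR k) * (j + RtoC (INR k) - 1 - a) * ladder mu j (pred k) f z.
Proof.
  intros Hf; destruct k as [|k].
  - simpl; replace (a - 0) with a by ring; ring.
  - rewrite ladder_S_bottom; replace (j - 1 + 1) with j by ring.
    rewrite ladder_rung by exact Hf; cbn [ladder pred].
    assert (S1 := smooth_ladder mu j k f Hf).
    rewrite (rung_rung mu a (j - 1)), (rung_rung mu (a - RtoC (INR (S k)))) by exact S1.
    rewrite S_INR, RtoC_plus; ring.
Qed.

(** The second-order equation of f is carried along the ladder; it acquires one term in
    the previous step. *)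
Lemma ladder_second (mu : R) (j alpha kappa : C) (k : nat) (f : C -> C) (z : C) :
  smooth f ->
  rung mu 0 (rung mu 0 f)
  = (fun w => RtoC mu * (Cexp (- w) * rung mu alpha f w)
              + (kappa * f w + - RtoC mu * (Cexp w * rung mu j f w))) ->
  let v := ladder mu j k f in
  C_derive (C_derive v) z
  = (weight mu z * weight mu z + RtoC mu / 2 * (Cexp (- z) + Cexp z) + kappa
     + RtoC mu * Cexp (- z) * (alpha - RtoC (INR k))
     - RtoC mu * Cexp z * (j + RtoC (INR k))) * v z
    + RtoC mu * Cexp (- z) * RtoC (INR k) * (j + RtoC (INR k) - 1 - alpha)
      * ladder mu j (pred k) f z.
Proof.
  intros Sf Hf v; set (m := RtoC mu) in *.
  assert (Sv : smooth v) by now apply smooth_ladder.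
  assert (SE : smooth (fun z => Cexp (- z) * rung mu alpha f z))
    by (apply smooth_mult; [apply smooth_Cexp_opp|now apply smooth_rung]).
  assert (SF : smooth (fun z => Cexp z * rung mu j f z))
    by (apply smooth_mult; [apply smooth_Cexp|now apply smooth_rung]).
  assert (K := f_equal (fun g => ladder mu j k g z) Hf); cbv beta in K.
  rewrite !ladder_rung in K by auto using smooth_rung; fold v in K.
  rewrite ladder_plus, ladder_scal, ladder_Cexp_opp, ladder_plus, !ladder_scal, ladder_Cexp in K;
    auto using smooth_plus, smooth_mult, smooth_const, smooth_rung.
  fold v in K.
  rewrite <- ladder_S_bottom in K.
  change (ladder mu j (S k) f) with (rung mu (j + RtoC (INR k)) v) in K.
  rewrite ladder_rung, ladder_shift_opp in K by exact Sf; fold v in K.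
  unfold rung at 1 in K; rewrite C_derive_rung in K by exact Sv; unfold rung in K; fold m in K.
  set (v2 := C_derive (C_derive v) z) in *.
  assert (HM : m * Cexp (- z) - m * Cexp z = 2 * weight mu z) by (unfold weight; fold m; field).
  match type of K with ?a = ?b => transitivity (b - (a - v2)); [rewrite <- K; ring|] end.
  transitivity ((m * Cexp (- z) - m * Cexp z - 2 * weight mu z) * (C_derive v z + weight mu z * v z)
    + ((weight mu z * weight mu z + m / 2 * (Cexp (- z) + Cexp z) + kappa
     + m * Cexp (- z) * (alpha - RtoC (INR k))
     - m * Cexp z * (j + RtoC (INR k))) * v z
    + m * Cexp (- z) * RtoC (INR k) * (j + RtoC (INR k) - 1 - alpha)
      * ladder mu j (pred k) f z)).
  - field.
  - rewrite HM; ring.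
Qed.

Lemma second_order_x (l : nat) (mu omega : R) (x y : C -> C) :
  linsol l mu omega x y ->
  rung mu 0 (rung mu 0 x)
  = fun w => RtoC mu * (Cexp (- w) * rung mu (half_l l - 1) x w)
             + (second_order_constant l mu omega * x w
                + - RtoC mu * (Cexp w * rung mu (- half_l l) x w)).
Proof.
  intros H; destruct (linsol_smooth _ _ _ _ _ H) as [Sx Sy].
  assert (S1 : smooth (fun z => Cexp (- z) * x z))
    by (apply smooth_mult; auto using smooth_Cexp_opp).
  assert (B := rung_rung mu (half_l l) (- half_l l) x).
  apply functional_extensionality; intros w; specialize (B w Sx).
  rewrite (ladder_start_x _ _ _ _ _ H) in B |- *.
  rewrite rung_plus, !rung_scal, rung_Cexp_opp, (ladder_start_y _ _ _ _ _ H) in B;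
    auto using smooth_mult, smooth_const.
  transitivity (rung mu 0 (rung mu 0 x) w + (half_l l + - half_l l) * rung mu 0 x w
    + half_l l * - half_l l * x w + half_l l * half_l l * x w); [ring|].
  rewrite <- B; unfold second_order_constant; ring [(Cexp_mult_opp w)].
Qed.

Lemma second_order_y (l : nat) (mu omega : R) (x y : C -> C) :
  linsol l mu omega x y ->
  rung mu 0 (rung mu 0 y)
  = fun w => RtoC mu * (Cexp (- w) * rung mu (half_l l) y w)
             + (second_order_constant l mu omega * y w
                + - RtoC mu * (Cexp w * rung mu (1 - half_l l) y w)).
Proof.
  intros H; destruct (linsol_smooth _ _ _ _ _ H) as [Sx Sy].
  assert (S1 : smooth (fun z => Cexp z * y z))
    by (apply smooth_mult; auto using smooth_Cexp).
  assert (B := rung_rung mu (- half_l l) (half_l l) y).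
  apply functional_extensionality; intros w; specialize (B w Sy).
  rewrite (ladder_start_y _ _ _ _ _ H) in B |- *.
  rewrite rung_plus, !rung_scal, rung_Cexp, (ladder_start_x _ _ _ _ _ H) in B;
    auto using smooth_mult, smooth_const.
  replace (- half_l l + 1) with (1 - half_l l) in B by ring.
  transitivity (rung mu 0 (rung mu 0 y) w + (- half_l l + half_l l) * rung mu 0 y w
    + - half_l l * half_l l * y w + half_l l * half_l l * y w); [ring|].
  rewrite <- B; unfold second_order_constant; ring [(Cexp_mult_opp w)].
Qed.

(** For u_k = (-1)^(l-k) D ... D y' at the opposite point and v_k = D ... D x, with l - k
    and k factors, the Wronskians T_k of u_k and v_k satisfy
    T_{k+1} - T_k = U_{k+1} - U_k, where U_k has the factor k (l - k) and so vanishes for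
    k = 0 and k = l. *)
Lemma ladder_adjoint (l : nat) (mu omega : R) (x y x' y' : C -> C) (z : C) :
  linsol l mu omega x y -> linsol l mu omega x' y' ->
  half_turn y' z * C_derive (climb_y l mu x) z
  - C_derive y' (z + Ci * PI) * climb_y l mu x z
  = (- (1)) ^ l * (half_turn (climb_x l mu y') z * C_derive x z
       - C_derive (climb_x l mu y') (z + Ci * PI) * x z).
Proof.
  intros H H'; destruct (linsol_smooth _ _ _ _ _ H) as [Sx Sy].
  destruct (linsol_smooth _ _ _ _ _ H') as [Sx' Sy'].
  set (zz := z + Ci * PI).
  set (g := fun i => ladder mu (1 - half_l l) i y').
  set (v := fun k => ladder mu (- half_l l) k x).
  assert (Sg : forall i, smooth (g i)) by (intros; now apply smooth_ladder).
  assert (Sv : forall i, smooth (v i)) by (intros; now apply smooth_ladder).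
  set (T := fun k => (- (1)) ^ (l - k)
    * (g (l - k)%nat zz * C_derive (v k) z - C_derive (g (l - k)%nat) zz * v k z)).
  set (U := fun k => - (RtoC mu * Cexp (- z) * RtoC (INR k) * (RtoC (INR l) - RtoC (INR k)))
    * (- (1)) ^ (l - k) * g (l - k - 1)%nat zz * v (pred k) z).
  assert (Step : forall k, (k < l)%nat -> T (S k) - U (S k) = T k - U k).
  { intros k Hk; unfold T, U.
    set (i := (l - S k)%nat).
    assert (Ei : (l - k)%nat = S i) by (unfold i; lia).
    assert (El : RtoC (INR l) = RtoC (INR k) + RtoC (INR i) + 1).
    { replace l with (S (k + i)) by (unfold i; lia).
      rewrite S_INR, plus_INR, !RtoC_plus; ring. }
    rewrite Ei; replace (S i - 1)%nat with i by lia.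
    replace (i - 1)%nat with (pred i) by lia; cbn [pred].
    change (g (S i)) with (rung mu (1 - half_l l + RtoC (INR i)) (g i)).
    change (v (S k)) with (rung mu (- half_l l + RtoC (INR k)) (v k)).
    rewrite !C_derive_rung by auto; unfold rung.
    assert (R1 := ladder_second _ _ _ _ k _ z Sx (second_order_x _ _ _ _ _ H));
      cbv zeta in R1; fold (v k) (v (pred k)) in R1.
    assert (R2 := ladder_second _ _ _ _ i _ zz Sy' (second_order_y _ _ _ _ _ H'));
      cbv zeta in R2; fold (g i) (g (pred i)) in R2.
    rewrite R1, R2; unfold zz; rewrite weight_shift, Cexp_shift_iPI, Cexp_opp_shift_iPI; fold zz.
    assert (Eh : half_l l = (RtoC (INR k) + RtoC (INR i) + 1) / 2) by (unfold half_l; now rewrite El).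
    rewrite S_INR, RtoC_plus, Cpow_S, El, Eh; field. }
  assert (All : forall k, (k <= l)%nat -> T k - U k = T 0%nat - U 0%nat).
  { induction k as [|k IH]; intros Hk; [reflexivity|].
    rewrite Step by lia; apply IH; lia. }
  assert (K := All l (le_n l)); unfold T, U in K.
  rewrite Nat.sub_diag, Nat.sub_0_r in K; cbn [Cpow INR] in K.
  unfold half_turn; fold zz.
  change (v l) with (climb_y l mu x) in K; change (v 0%nat) with x in K.
  change (g l) with (climb_x l mu y') in K; change (g 0%nat) with y' in K.
  replace (y' zz * C_derive (climb_y l mu x) z - C_derive y' zz * climb_y l mu x z) with
   (1 * (y' zz * C_derive (climb_y l mu x) z - C_derive y' zz * climb_y l mu x z) -
      - (RtoC mu * Cexp (- z) * RtoC (INR l) * (RtoC (INR l) - RtoC (INR l))) * 1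
      * g (0 - 1)%nat zz * v (Init.Nat.pred l) z) by ring.
  rewrite K; ring.
Qed.

Lemma coupling_neq_0 (omega : R) : (0 < omega)%R -> coupling omega <> 0.
Proof.
  intros H E; unfold coupling in E.
  assert (N : 2 * Ci * omega <> 0).
  { repeat apply Cmult_neq_0; [intros X|apply Ci_nz|intros X];
      apply RtoC_inj in X; lra. }
  apply C1_nz; rewrite <- (Cinv_r _ N), E; ring.
Qed.

(** The Wronskian with a climbed solution, written with the components of the system.
    This is the statement that rotating and climbing is adjoint, up to sign, to climbing
    and rotating. *)
Lemma climb_adjoint (l : nat) (mu omega : R) (x y x' y' : C -> C) (z : C) :
  (0 < omega)%R ->
  linsol l mu omega x y -> linsol l mu omega x' y' ->
  half_turn (climb_x l mu y') z * y z - half_turn (climb_y l mu x') z * x z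
  = (- (1)) ^ S l
    * (half_turn x' z * climb_y l mu x z - half_turn y' z * climb_x l mu y z).
Proof.
  intros Hw H H'.
  assert (A := ladder_adjoint _ _ _ _ _ _ _ z H H').
  assert (Hc := coupling_neq_0 _ Hw).
  set (c := coupling omega) in *.
  assert (X := is_Cderive_unique _ _ _ (proj1 (H z))).
  assert (Y' := is_Cderive_unique _ _ _ (proj2 (H' (z + Ci * PI)))).
  assert (TX := f_equal (fun f => f (z + Ci * PI)) (climb_x_eq _ _ _ _ _ H')).
  assert (TY := f_equal (fun f => f z) (climb_y_eq _ _ _ _ _ H)).
  cbv beta in TX, TY; unfold rung in TX, TY.
  rewrite weight_shift, Cexp_shift_iPI in TX; fold c in X, Y', TX, TY.
  unfold half_turn in *; set (zz := z + Ci * PI) in *.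
  set (ty := climb_y l mu x z) in *; set (tx := climb_x l mu y z) in *.
  set (tx' := climb_x l mu y' zz) in *; set (ty' := climb_y l mu x' zz) in *.
  assert (Hq : half_q l mu zz = half_l l - RtoC mu / 2 * (Cexp z + Cexp (- z))).
  { unfold half_q, zz, half_l; rewrite Cexp_shift_iPI, Cexp_opp_shift_iPI; field. }
  assert (Hq0 : half_q l mu z = half_l l + RtoC mu / 2 * (Cexp z + Cexp (- z)))
    by (unfold half_q, half_l; field).
  rewrite Hq in Y'; rewrite Hq0 in X; rewrite X, Y' in A.
  set (dty := C_derive (climb_y l mu x) z) in *.
  set (dtx := C_derive (climb_x l mu y') zz) in *.
  replace dty with (c * tx + RtoC mu * Cexp (- z) * ty - (weight mu z + half_l l) * ty) in A
    by (rewrite <- TY; ring).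
  replace dtx with (c * ty' - RtoC mu * - Cexp z * tx' - (- weight mu z + - half_l l) * tx') in A
    by (rewrite <- TX; ring).
  unfold weight in A; rewrite Cpow_S.
  set (s := (- (1)) ^ l) in *.
  assert (Hs : s * s = 1).
  { unfold s; rewrite <- Cpow_mult_l; replace (- (1) * - (1)) with (RtoC 1) by ring.
    apply Cpow_1_l. }
  assert (A' : c * (y' zz * tx - x' zz * ty) = c * (s * (tx' * y z - ty' * x z))).
  { replace (c * (s * (tx' * y z - ty' * x z))) with (s *
      (tx' * ((half_l l + RtoC mu / 2 * (Cexp z + Cexp (- z))) * x z + c * y z)
       - (c * ty' - RtoC mu * - Cexp z * tx'
          - (- (RtoC mu / 2 * (Cexp (- z) - Cexp z)) + - half_l l) * tx') * x z)) by field.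
    rewrite <- A; field. }
  assert (A2 : y' zz * tx - x' zz * ty = s * (tx' * y z - ty' * x z)).
  { apply (f_equal (fun t => / c * t)) in A'.
    rewrite !Cmult_assoc, Cinv_l, !Cmult_1_l in A' by exact Hc; exact A'. }
  replace (tx' * y z - ty' * x z) with (s * s * (tx' * y z - ty' * x z)) by (rewrite Hs; ring).
  replace (s * s * (tx' * y z - ty' * x z)) with (s * (s * (tx' * y z - ty' * x z))) by ring.
  rewrite <- A2; ring.
Qed.

(** * Symmetries of the ladder *)

Lemma is_Cderive_neg_arg (f : C -> C) (z d : C) :
  is_Cderive f (- z) d -> is_Cderive (fun w => f (- w)) z (- d).
Proof.
  intros H; eapply is_Cderive_eq.
  - apply (is_Cderive_comp f (fun w => - w)); [exact H|].
    apply is_Cderive_opp, is_Cderive_id.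
  - ring.
Qed.

Lemma smooth_neg_arg (f : C -> C) : smooth f -> smooth (fun z => f (- z)).
Proof.
  intros H n; specialize (H n); revert f H; induction n as [|n IH]; intros f; simpl; [auto|].
  intros [f' [H K]]; exists (fun z => - (1) * f' (- z)); split.
  - intros z _; eapply is_Cderive_eq; [apply is_Cderive_neg_arg, H; constructor|ring].
  - apply smooth_upto_mult; [apply smooth_upto_const|apply IH, K].
Qed.

Lemma weight_neg (mu : R) (z : C) : weight mu (- z) = - weight mu z.
Proof. unfold weight; replace (- - z) with z by ring; ring. Qed.

Lemma neg1_sqr (n : nat) : (- (1)) ^ n * (- (1)) ^ n = 1.
Proof.
  rewrite <- Cpow_mult_l; replace (- (1) * - (1)) with (RtoC 1) by ring; apply Cpow_1_l.
Qed.

Lemma ladder_S_below (mu : R) (j : C) (n : nat) (f : C -> C) :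
  smooth f -> rung mu (j - 1) (ladder mu j n f) = ladder mu (j - 1) (S n) f.
Proof.
  intros H; rewrite ladder_S_bottom; replace (j - 1 + 1) with j by ring.
  now rewrite ladder_rung.
Qed.

(** A reflection of the plane carries D_j to - D_{-j}, so it turns the ladder upside down
    and exchanges the two components. *)
Lemma climb_y_symmetry (l : nat) (mu : R) (rho : (C -> C) -> C -> C) (f : C -> C) (z : C) :
  (forall g, smooth g -> smooth (rho g)) ->
  (forall (a : R) g w, smooth g ->
     rung mu (RtoC a) (rho g) w = - rho (rung mu (- RtoC a) g) w) ->
  smooth f -> climb_y l mu (rho f) z = (- (1)) ^ l * rho (climb_x l mu f) z.
Proof.
  intros Srho Drho Hf.
  assert (K : forall (j : R) n w, ladder mu (RtoC j) n (rho f) w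
    = (- (1)) ^ n * rho (ladder mu (1 - RtoC j - RtoC (INR n)) n f) w).
  { intros j; induction n as [|n IH]; intros w; [simpl; ring|].
    cbn [ladder].
    replace (ladder mu (RtoC j) n (rho f))
      with (fun z => (- (1)) ^ n * rho (ladder mu (1 - RtoC j - RtoC (INR n)) n f) z)
      by (apply functional_extensionality; intros v; now rewrite IH).
    set (g := ladder mu (1 - RtoC j - RtoC (INR n)) n f).
    assert (Sg : smooth g) by now apply smooth_ladder.
    rewrite rung_scal, <- RtoC_plus, Drho by auto.
    replace (- RtoC (j + INR n)) with (1 - RtoC j - RtoC (INR n) - 1)
      by (rewrite RtoC_plus; ring).
    unfold g; rewrite ladder_S_below by exact Hf.
    replace (1 - RtoC j - RtoC (INR n) - 1) with (1 - RtoC j - RtoC (INR (S n)))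
      by (rewrite S_INR, RtoC_plus; ring).
    rewrite Cpow_S; cbn [ladder]; ring. }
  unfold climb_y, climb_x.
  replace (- half_l l) with (RtoC (- (INR l / 2)))
    by (unfold half_l; rewrite RtoC_opp, RtoC_div by lra; reflexivity).
  rewrite K; do 3 f_equal.
  rewrite RtoC_opp, RtoC_div by lra; unfold half_l; field.
Qed.

Lemma climb_y_neg_arg (l : nat) (mu : R) (f : C -> C) (z : C) :
  smooth f -> climb_y l mu (fun w => f (- w)) z = (- (1)) ^ l * climb_x l mu f (- z).
Proof.
  apply (climb_y_symmetry l mu (fun f w => f (- w))); [exact smooth_neg_arg|].
  intros a g w Sg; unfold rung; rewrite weight_neg.
  rewrite (is_Cderive_unique _ _ _ (is_Cderive_neg_arg _ _ _ (smooth_is_Cderive g (- w) Sg))).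
  ring.
Qed.

(** The reflection in the imaginary axis of zeta, that is in the unit circle of z. *)
Definition reflect (f : C -> C) (z : C) : C := Cconj (f (- Cconj z)).

Lemma is_Cderive_reflect (f : C -> C) (z d : C) :
  is_Cderive f (- Cconj z) d -> is_Cderive (reflect f) z (- Cconj d).
Proof.
  rewrite !is_Cderive_eps; intros H eps He; destruct (H eps He) as [r [Hr K]].
  exists r; split; [exact Hr|]; intros w Hw; unfold reflect.
  assert (E : Cmod (- Cconj w - - Cconj z) = Cmod (w - z)).
  { replace (- Cconj w - - Cconj z) with (- Cconj (w - z)) by (rewrite Cminus_conj; ring).
    now rewrite Cmod_opp, Cmod_conj. }
  rewrite <- E in Hw; specialize (K _ Hw); rewrite E in K.
  replace (Cconj (f (- Cconj w)) - Cconj (f (- Cconj z)) - - Cconj d * (w - z))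
    with (Cconj (f (- Cconj w) - f (- Cconj z) - d * (- Cconj w - - Cconj z))).
  - rewrite Cmod_conj; exact K.
  - rewrite !Cminus_conj, Cmult_conj, Cminus_conj, !Copp_conj, !Cconj_conj; ring.
Qed.

Lemma smooth_reflect (f : C -> C) : smooth f -> smooth (reflect f).
Proof.
  intros H n; specialize (H n); revert f H; induction n as [|n IH]; intros f; simpl; [auto|].
  intros [f' [H K]]; exists (fun z => - (1) * reflect f' z); split.
  - intros z _; eapply is_Cderive_eq; [apply is_Cderive_reflect, H; constructor|].
    unfold reflect; ring.
  - apply smooth_upto_mult; [apply smooth_upto_const|apply IH, K].
Qed.

Lemma RtoC_conj (r : R) : Cconj (RtoC r) = RtoC r.
Proof. apply C_eq; simpl; ring. Qed.

Lemma weight_reflect (mu : R) (z : C) : Cconj (weight mu (- Cconj z)) = - weight mu z.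
Proof.
  unfold weight; replace (- - Cconj z) with (Cconj z) by ring.
  unfold Cdiv; rewrite !Cmult_conj, Cminus_conj, <- !Cexp_conj.
  rewrite Copp_conj, Cconj_conj, Cinv_conj, !RtoC_conj by apply two_neq_0.
  ring.
Qed.

Lemma climb_y_reflect (l : nat) (mu : R) (f : C -> C) (z : C) :
  smooth f -> climb_y l mu (reflect f) z = (- (1)) ^ l * reflect (climb_x l mu f) z.
Proof.
  apply climb_y_symmetry; [exact smooth_reflect|].
  intros a g w Sg; unfold rung, reflect at 2 3.
  rewrite (is_Cderive_unique _ _ _ (is_Cderive_reflect _ _ _
    (smooth_is_Cderive g (- Cconj w) Sg))).
  rewrite Cplus_conj, Cmult_conj, Cplus_conj, weight_reflect, Copp_conj, !RtoC_conj.
  unfold reflect; ring.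
Qed.

Lemma linsol_neg_arg (l : nat) (mu omega : R) (x y : C -> C) :
  linsol l mu omega x y -> linsol l mu omega (fun z => y (- z)) (fun z => - x (- z)).
Proof.
  intros H z; destruct (H (- z)) as [X Y].
  assert (E : half_q l mu (- z) = half_q l mu z)
    by (unfold half_q; replace (- - z) with z by ring; field).
  rewrite E in X, Y; split.
  - eapply is_Cderive_eq; [apply is_Cderive_neg_arg, Y|ring].
  - eapply is_Cderive_eq; [apply is_Cderive_opp, is_Cderive_neg_arg, X|ring].
Qed.

Lemma coupling_conj (omega : R) : (0 < omega)%R -> Cconj (coupling omega) = - coupling omega.
Proof.
  intros H; unfold coupling.
  assert (N : RtoC omega <> 0) by (intros X; apply RtoC_inj in X; lra).
  assert (N2 : 2 * Ci * omega <> 0)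
    by (repeat apply Cmult_neq_0; auto using two_neq_0, Ci_nz).
  rewrite Cinv_conj, !Cmult_conj, !RtoC_conj by exact N2.
  replace (Cconj Ci) with (- Ci) by (apply C_eq; simpl; ring).
  field; repeat split; auto using Ci_nz.
Qed.

Lemma linsol_reflect (l : nat) (mu omega : R) (x y : C -> C) :
  (0 < omega)%R ->
  linsol l mu omega x y -> linsol l mu omega (reflect y) (reflect x).
Proof.
  intros Hw H z; destruct (H (- Cconj z)) as [X Y].
  assert (E : Cconj (half_q l mu (- Cconj z)) = half_q l mu z).
  { unfold half_q; replace (- - Cconj z) with (Cconj z) by ring.
    unfold Cdiv; rewrite Cmult_conj, Cplus_conj, Cmult_conj, Cplus_conj, <- !Cexp_conj.
    rewrite Copp_conj, Cconj_conj, Cinv_conj, !RtoC_conj by apply two_neq_0; ring. }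
  split.
  - eapply is_Cderive_eq; [apply is_Cderive_reflect, Y|].
    rewrite Cminus_conj, !Cmult_conj, E, coupling_conj by exact Hw; unfold reflect; ring.
  - eapply is_Cderive_eq; [apply is_Cderive_reflect, X|].
    rewrite Cplus_conj, !Cmult_conj, E, coupling_conj by exact Hw; unfold reflect; ring.
Qed.

(** * The full turn *)

Definition full_turn (f : C -> C) (z : C) : C := f (z + 2 * Ci * PI).

Lemma full_turn_half (f : C -> C) : full_turn f = half_turn (half_turn f).
Proof.
  apply functional_extensionality; intros z; unfold full_turn, half_turn; f_equal; ring.
Qed.

Lemma Cexp_full (z : C) : Cexp (z + 2 * Ci * PI) = Cexp z.
Proof.
  replace (z + 2 * Ci * PI) with ((z + Ci * PI) + Ci * PI) by ring.
  rewrite !Cexp_shift_iPI; ring.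
Qed.

Lemma Cexp_opp_full (z : C) : Cexp (- (z + 2 * Ci * PI)) = Cexp (- z).
Proof. now rewrite !Cexp_opp, Cexp_full. Qed.

Lemma is_Cderive_full_turn (f : C -> C) (z d : C) :
  is_Cderive f (z + 2 * Ci * PI) d -> is_Cderive (full_turn f) z d.
Proof.
  intros H; eapply is_Cderive_eq.
  - apply (is_Cderive_comp f (fun w => w + 2 * Ci * PI)); [exact H|].
    apply is_Cderive_plus; [apply is_Cderive_id|apply is_Cderive_const].
  - ring.
Qed.

Lemma linsol_full (l : nat) (mu omega : R) (x y : C -> C) :
  linsol l mu omega x y -> linsol l mu omega (full_turn x) (full_turn y).
Proof.
  intros H z; destruct (H (z + 2 * Ci * PI)) as [X Y].
  unfold half_q in X, Y; rewrite Cexp_full, Cexp_opp_full in X, Y.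
  split; apply is_Cderive_full_turn; assumption.
Qed.

Lemma ladder_full (mu : R) (j : C) (n : nat) (f : C -> C) :
  smooth f -> ladder mu j n (full_turn f) = full_turn (ladder mu j n f).
Proof.
  intros Hf; induction n as [|n IH]; simpl; [reflexivity|].
  rewrite IH; set (g := ladder mu j n f).
  apply functional_extensionality; intros z; unfold rung at 1.
  rewrite (is_Cderive_unique _ _ _ (is_Cderive_full_turn _ _ _
    (smooth_is_Cderive g (z + 2 * Ci * PI) (smooth_ladder _ _ _ _ Hf)))).
  unfold full_turn, rung, weight; now rewrite Cexp_full, Cexp_opp_full.
Qed.

(** * The polynomials p, q, r, s *)

Definition poly_p (l : nat) (mu omega : R) (k : nat) : C -> C :=
  fst (fst (fst (pqrs l mu omega k))).
Definition poly_q (l : nat) (mu omega : R) (k : nat) : C -> C :=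
  snd (fst (fst (pqrs l mu omega k))).
Definition poly_r (l : nat) (mu omega : R) (k : nat) : C -> C :=
  snd (fst (pqrs l mu omega k)).
Definition poly_s (l : nat) (mu omega : R) (k : nat) : C -> C :=
  snd (pqrs l mu omega k).

Lemma D_plus_eq (l : nat) (mu omega : R) :
  D_plus l mu omega = poly_p l mu omega l 1 + 2 * omega * poly_r l mu omega l 1.
Proof.
  unfold D_plus, poly_p, poly_r; now destruct (pqrs l mu omega l) as [[[p q] r] s].
Qed.

Lemma D_minus_eq (l : nat) (mu omega : R) :
  D_minus l mu omega = poly_p l mu omega l 1 - 2 * omega * poly_r l mu omega l 1.
Proof.
  unfold D_minus, poly_p, poly_r; now destruct (pqrs l mu omega l) as [[[p q] r] s].
Qed.

Definition heun_lambda (mu omega : R) : C := RtoC (/ (2 * omega) ^ 2 - mu ^ 2).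

Lemma poly_step (l : nat) (mu omega : R) (k : nat) (z : C) :
  let p := poly_p l mu omega k in let q := poly_q l mu omega k in
  let r := poly_r l mu omega k in let s := poly_s l mu omega k in
  let el := RtoC (INR l) in let kk := RtoC (INR (S k)) in let m := RtoC mu in
  poly_p l mu omega (S k) z = (1 - el) * z * p z + q z + z ^ 2 * C_derive p z
  /\ poly_q l mu omega (S k) z
     = z ^ 2 * (- heun_lambda mu omega + (el + 1) * m * z) * p z
       + m * (1 - z ^ 2) * q z + z ^ 2 * C_derive q z
  /\ poly_r l mu omega (S k) z = 2 * (kk - 2) * z * r z - s z - z ^ 2 * C_derive r z
  /\ poly_s l mu omega (S k) z
     = z ^ 2 * (heun_lambda mu omega - (el + 1) * m * z) * r z
       + ((2 * kk - el - 3) * z + m * (z ^ 2 - 1)) * s z - z ^ 2 * C_derive s z.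
Proof.
  unfold poly_p, poly_q, poly_r, poly_s; cbn [pqrs].
  destruct (pqrs l mu omega k) as [[[p q] r] s]; repeat split.
Qed.

Definition nonzero (z : C) : Prop := z <> 0.

Lemma open_nonzero : open_set nonzero.
Proof.
  intros z Hz; apply (Ccont_near_neq (fun w => w)); [|exact Hz].
  eapply is_Cderive_Ccont, is_Cderive_id.
Qed.

Lemma smooth_sqr (D : C -> Prop) : smooth_on D (fun z => z ^ 2).
Proof.
  simpl; apply smooth_mult; [apply smooth_id|].
  apply smooth_mult; [apply smooth_id|apply smooth_const].
Qed.

Ltac smooth_poly :=
  lazymatch goal with
  | |- smooth_on _ (fun z => @?f z + @?g z) => apply (smooth_plus _ f g); smooth_poly
  | |- smooth_on _ (fun z => @?f z - @?g z) => apply (smooth_minus _ f g); smooth_poly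
  | |- smooth_on _ (fun z => @?f z * @?g z) => apply (smooth_mult _ f g); smooth_poly
  | |- smooth_on _ (fun z => z ^ 2) => apply smooth_sqr
  | |- smooth_on _ (fun z => z) => apply smooth_id
  | |- smooth_on _ (fun _ => ?a) => apply smooth_const
  | |- smooth_on ?D (fun z => ?f z) => change (smooth_on D f); smooth_poly
  | |- smooth_on _ (C_derive _) =>
      apply smooth_C_derive; [exact open_nonzero|assumption]
  | |- _ => assumption
  end.

Lemma poly_smooth (l : nat) (mu omega : R) (k : nat) :
  smooth_on nonzero (poly_p l mu omega k) /\ smooth_on nonzero (poly_q l mu omega k)
  /\ smooth_on nonzero (poly_r l mu omega k) /\ smooth_on nonzero (poly_s l mu omega k).
Proof.
  induction k as [|k [Hp [Hq [Hr Hs]]]].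
  - repeat split.
    + exact (smooth_const nonzero 0).
    + exact (smooth_const nonzero 1).
    + apply (smooth_inv nonzero (fun z => z ^ 2)); [|apply smooth_sqr].
      intros z Hz; apply Cpow_nz, Hz.
    + exact (smooth_const nonzero (- RtoC mu)).
  - repeat split; (eapply (smooth_ext nonzero _ _ open_nonzero); [intros z _; symmetry|]).
    + exact (proj1 (poly_step l mu omega k z)).
    + smooth_poly.
    + exact (proj1 (proj2 (poly_step l mu omega k z))).
    + smooth_poly.
    + exact (proj1 (proj2 (proj2 (poly_step l mu omega k z)))).
    + smooth_poly.
    + exact (proj2 (proj2 (proj2 (poly_step l mu omega k z)))).
    + smooth_poly.
Qed.

Lemma is_Cderive_at_Cexp (f : C -> C) (z : C) :
  smooth_on nonzero f ->
  is_Cderive (fun w => f (Cexp w)) z (Cexp z * C_derive f (Cexp z)).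
Proof.
  intros H; apply is_Cderive_comp; [|apply is_Cderive_Cexp].
  apply (smooth_derive nonzero); [exact H|apply Cexp_neq_0].
Qed.

Lemma is_Cderive_Cexp_pow (k : nat) (z : C) :
  is_Cderive (fun w => Cexp w ^ k) z (RtoC (INR k) * Cexp z ^ k).
Proof.
  induction k as [|k IH].
  - eapply is_Cderive_eq; [apply (is_Cderive_const 1)|simpl; ring].
  - eapply is_Cderive_eq.
    + apply (is_Cderive_mult Cexp (fun w => Cexp w ^ k)); [apply is_Cderive_Cexp|exact IH].
    + cbv beta; rewrite S_INR, RtoC_plus, Cpow_S; ring.
Qed.

Lemma heun_lambda_coupling (mu omega : R) :
  (0 < omega)%R ->
  heun_lambda mu omega = - (coupling omega * coupling omega) - RtoC mu * RtoC mu.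
Proof.
  intros H; unfold heun_lambda, coupling.
  assert (N : RtoC omega <> 0) by (intros X; apply RtoC_inj in X; lra).
  rewrite RtoC_minus, RtoC_inv, !RtoC_pow, RtoC_mult by (apply pow_nonzero; lra).
  assert (I2 : Ci * Ci = - (1)) by (apply C_eq; simpl; ring).
  assert (E : / (2 * Ci * omega) * / (2 * Ci * omega) = / (Ci * Ci) * / ((2 * omega) * (2 * omega))).
  { field; split; auto using Ci_nz. }
  rewrite E, I2; field; exact N.
Qed.

(** With x = z^{l/2} e^{-mu (z + 1/z)/2} E, the function E solves the double confluent Heun
    equation, E' corresponds to c y / z + mu x, and z^2 p_k E' + q_k E is the k-th
    derivative with respect to -1/z of e^{-mu (z + 1/z)} E, up to the factor
    e^{mu (z + 1/z)}. *)
Lemma poly_pq_ladder (l : nat) (mu omega : R) (x y : C -> C) (k : nat) (z : C) :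
  (0 < omega)%R -> linsol l mu omega x y ->
  Cexp z ^ k * ladder mu (- half_l l) k x z
  = (RtoC mu * Cexp z ^ 2 * poly_p l mu omega k (Cexp z) + poly_q l mu omega k (Cexp z)) * x z
    + coupling omega * Cexp z * poly_p l mu omega k (Cexp z) * y z.
Proof.
  intros Hw H; destruct (linsol_smooth _ _ _ _ _ H) as [Sx Sy].
  assert (HL := heun_lambda_coupling mu omega Hw).
  revert z; induction k as [|k IH]; intros z.
  - unfold poly_p, poly_q; simpl; ring.
  - destruct (poly_smooth l mu omega k) as [Sp [Sq _]].
    destruct (poly_step l mu omega k (Cexp z)) as [Ep [Eq _]].
    rewrite Ep, Eq; clear Ep Eq.
    assert (Sv := smooth_ladder mu (- half_l l) k x Sx).
    assert (D1 := is_Cderive_mult _ _ _ _ _ (is_Cderive_Cexp_pow k z) (smooth_is_Cderive _ z Sv)).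
    assert (D2 := is_Cderive_ext _ _ _ _ IH D1).
    apply is_Cderive_unique in D2.
    destruct (H z) as [X Y].
    assert (DZ := is_Cderive_at_Cexp _ z (smooth_sqr nonzero)); cbv beta in DZ.
    assert (D3 := is_Cderive_plus _ _ _ _ _
      (is_Cderive_mult _ _ _ _ _
        (is_Cderive_plus _ _ _ _ _
          (is_Cderive_mult _ _ _ _ _
            (is_Cderive_mult _ _ _ _ _ (is_Cderive_const (RtoC mu) z) (is_Cderive_Cexp_pow 2 z))
            (is_Cderive_at_Cexp _ z Sp))
          (is_Cderive_at_Cexp _ z Sq)) X)
      (is_Cderive_mult _ _ _ _ _
        (is_Cderive_mult _ _ _ _ _
          (is_Cderive_mult _ _ _ _ _ (is_Cderive_const (coupling omega) z) (is_Cderive_Cexp z))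
          (is_Cderive_at_Cexp _ z Sp)) Y)).
    apply is_Cderive_unique in D3; cbv beta in D3; rewrite D3 in D2; clear D1 D3 DZ.
    cbn [ladder]; unfold rung.
    set (v := ladder mu (- half_l l) k x) in *.
    assert (IHz := IH z).
    replace (Cexp z ^ S k * (C_derive v z + (weight mu z + (- half_l l + RtoC (INR k))) * v z)) with
      (Cexp z * ((RtoC (INR k) * Cexp z ^ k * v z + Cexp z ^ k * C_derive v z)
         + (weight mu z - half_l l) * (Cexp z ^ k * v z))) by (rewrite Cpow_S; ring).
    rewrite <- D2, IHz, HL; unfold weight, half_q, half_l; rewrite Cexp_opp.
    replace (INR 2) with 2%R by (simpl; ring).
    field; apply Cexp_neq_0.
Qed.

(** The second family starts from E' - mu E, which corresponds to c y / z, and descends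
    from the index l/2. *)
Lemma poly_rs_ladder (l : nat) (mu omega : R) (x y : C -> C) (k : nat) (z : C) :
  (0 < omega)%R -> linsol l mu omega x y ->
  (- (1)) ^ k * coupling omega * Cexp z ^ k
    * ladder mu (half_l l - RtoC (INR k) + 1) k y z
  = Cexp z * (coupling omega * Cexp z * poly_r l mu omega k (Cexp z) * y z
      + (RtoC mu * Cexp z ^ 2 * poly_r l mu omega k (Cexp z)
         + poly_s l mu omega k (Cexp z)) * x z).
Proof.
  intros Hw H; destruct (linsol_smooth _ _ _ _ _ H) as [Sx Sy].
  assert (HL := heun_lambda_coupling mu omega Hw).
  revert z; induction k as [|k IH]; intros z.
  - unfold poly_r, poly_s; simpl; field; apply Cexp_neq_0.
  - destruct (poly_smooth l mu omega k) as [_ [_ [Sp Sq]]].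
    destruct (poly_step l mu omega k (Cexp z)) as [_ [_ [Ep Eq]]].
    rewrite Ep, Eq; clear Ep Eq.
    assert (Sv := smooth_ladder mu (half_l l - RtoC (INR k) + 1) k y Sy).
    assert (D1 := is_Cderive_mult _ _ _ _ _
      (is_Cderive_mult _ _ _ _ _ (is_Cderive_const ((- (1)) ^ k * coupling omega) z)
         (is_Cderive_Cexp_pow k z)) (smooth_is_Cderive _ z Sv)).
    assert (D2 := is_Cderive_ext _ _ _ _ IH D1).
    apply is_Cderive_unique in D2.
    destruct (H z) as [X Y].
    assert (D3 := is_Cderive_mult _ _ _ _ _ (is_Cderive_Cexp z)
      (is_Cderive_plus _ _ _ _ _
        (is_Cderive_mult _ _ _ _ _
          (is_Cderive_mult _ _ _ _ _
            (is_Cderive_mult _ _ _ _ _ (is_Cderive_const (coupling omega) z) (is_Cderive_Cexp z))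
            (is_Cderive_at_Cexp _ z Sp)) Y)
        (is_Cderive_mult _ _ _ _ _
          (is_Cderive_plus _ _ _ _ _
            (is_Cderive_mult _ _ _ _ _
              (is_Cderive_mult _ _ _ _ _ (is_Cderive_const (RtoC mu) z) (is_Cderive_Cexp_pow 2 z))
              (is_Cderive_at_Cexp _ z Sp))
            (is_Cderive_at_Cexp _ z Sq)) X))).
    apply is_Cderive_unique in D3; cbv beta in D3; rewrite D3 in D2; clear D1 D3.
    assert (IHz := IH z).
    replace (half_l l - RtoC (INR (S k)) + 1) with (half_l l - RtoC (INR k) + 1 - 1)
      by (rewrite S_INR, RtoC_plus; ring).
    rewrite <- ladder_S_below by exact Sy; unfold rung.
    set (v := ladder mu (half_l l - RtoC (INR k) + 1) k y) in *.
    set (sg := (- (1)) ^ k) in *.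
    replace ((- (1)) ^ S k * coupling omega * Cexp z ^ S k *
        (C_derive v z + (weight mu z + (half_l l - RtoC (INR k) + 1 - 1)) * v z)) with
      (- Cexp z * (((0 * Cexp z ^ k + sg * coupling omega * (RtoC (INR k) * Cexp z ^ k)) * v z
           + sg * coupling omega * Cexp z ^ k * C_derive v z)
         + (weight mu z + half_l l - 2 * RtoC (INR k)) * (sg * coupling omega * Cexp z ^ k * v z)))
      by (unfold sg; rewrite !Cpow_S; ring).
    rewrite <- D2, IHz, HL, (S_INR k), RtoC_plus; unfold weight, half_q, half_l; rewrite Cexp_opp.
    replace (INR 2) with 2%R by (simpl; ring).
    field; apply Cexp_neq_0.
Qed.

(** * The half turn and its square *)

Lemma Cmult_reg_l (a b c : C) : a <> 0 -> a * b = a * c -> b = c.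
Proof.
  intros H E; replace b with (/ a * (a * b)) by (field; exact H).
  rewrite E; field; exact H.
Qed.

Lemma climb_y_at_1 (l : nat) (mu omega : R) (x y : C -> C) :
  (0 < omega)%R -> linsol l mu omega x y ->
  climb_y l mu x 0
  = (RtoC mu * poly_p l mu omega l 1 + poly_q l mu omega l 1) * x 0
    + coupling omega * poly_p l mu omega l 1 * y 0.
Proof.
  intros Hw H; assert (K := poly_pq_ladder l mu omega x y l 0 Hw H).
  rewrite Cexp_0, !Cpow_1_l in K; unfold climb_y.
  replace (ladder mu (- half_l l) l x 0) with (1 * ladder mu (- half_l l) l x 0) by ring.
  rewrite K; ring.
Qed.

Lemma climb_x_at_1 (l : nat) (mu omega : R) (x y : C -> C) :
  (0 < omega)%R -> linsol l mu omega x y ->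
  (- (1)) ^ l * coupling omega * climb_x l mu y 0
  = coupling omega * poly_r l mu omega l 1 * y 0
    + (RtoC mu * poly_r l mu omega l 1 + poly_s l mu omega l 1) * x 0.
Proof.
  intros Hw H; assert (K := poly_rs_ladder l mu omega x y l 0 Hw H).
  replace (half_l l - RtoC (INR l) + 1) with (1 - half_l l) in K by (rewrite <- half_l_double; ring).
  rewrite Cexp_0, !Cpow_1_l in K; unfold climb_x.
  replace ((- (1)) ^ l * coupling omega * ladder mu (1 - half_l l) l y 0)
    with ((- (1)) ^ l * coupling omega * 1 * ladder mu (1 - half_l l) l y 0) by ring.
  rewrite K; ring.
Qed.

(** The symmetry z -> 1/z of the system gives the second product in terms of the first
    family of polynomials. *)
Lemma climb_x_at_1_neg (l : nat) (mu omega : R) (x y : C -> C) :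
  (0 < omega)%R -> linsol l mu omega x y ->
  climb_x l mu y 0
  = (- (1)) ^ l * ((RtoC mu * poly_p l mu omega l 1 + poly_q l mu omega l 1) * y 0
      - coupling omega * poly_p l mu omega l 1 * x 0).
Proof.
  intros Hw H; destruct (linsol_smooth _ _ _ _ _ H) as [Sx Sy].
  assert (K := climb_y_at_1 _ _ _ _ _ Hw (linsol_neg_arg _ _ _ _ _ H)).
  rewrite climb_y_neg_arg in K by exact Sy.
  replace (- 0) with (RtoC 0) in K by ring.
  replace (climb_x l mu y 0)
    with ((- (1)) ^ l * (- (1)) ^ l * climb_x l mu y 0) by (rewrite neg1_sqr; ring).
  rewrite <- Cmult_assoc, K; ring.
Qed.

(** The two expressions of the same value, for a solution that vanishes in the first
    component. *)
Lemma poly_relation (l : nat) (mu omega : R) :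
  (0 < omega)%R ->
  RtoC mu * poly_p l mu omega l 1 + poly_q l mu omega l 1 = poly_r l mu omega l 1.
Proof.
  intros Hw; destruct (linsol_exists l mu omega 0 1) as [x [y [X [Y H]]]].
  assert (A := climb_x_at_1 _ _ _ _ _ Hw H).
  assert (B := climb_x_at_1_neg _ _ _ _ _ Hw H).
  rewrite B, X, Y in A.
  apply (Cmult_reg_l (coupling omega)); [now apply coupling_neq_0|].
  set (P := RtoC mu * poly_p l mu omega l 1 + poly_q l mu omega l 1) in *.
  replace (coupling omega * P)
    with ((- (1)) ^ l * coupling omega
          * ((- (1)) ^ l * (P * 1 - coupling omega * poly_p l mu omega l 1 * 0))).
  - rewrite A; ring.
  - replace (coupling omega * P) with ((- (1)) ^ l * (- (1)) ^ l * (coupling omega * P))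
      by (rewrite neg1_sqr; ring); ring.
Qed.

Lemma climb_at_1 (l : nat) (mu omega : R) (x y : C -> C) :
  (0 < omega)%R -> linsol l mu omega x y ->
  let p := poly_p l mu omega l 1 in let r := poly_r l mu omega l 1 in
  climb_x l mu y 0 = (- (1)) ^ l * (r * y 0 - coupling omega * p * x 0)
  /\ climb_y l mu x 0 = r * x 0 + coupling omega * p * y 0.
Proof.
  intros Hw H p r.
  rewrite (climb_x_at_1_neg _ _ _ _ _ Hw H), (climb_y_at_1 _ _ _ _ _ Hw H).
  rewrite (poly_relation l mu omega Hw); split; reflexivity.
Qed.

(** The adjoint identity against the two basis solutions: only values of the ladder at
    z = 1 enter, although the half turn is a value at z = -1. *)
Lemma half_turn_at_1 (l : nat) (mu omega : R) (x y : C -> C) :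
  (0 < omega)%R -> linsol l mu omega x y ->
  let p := poly_p l mu omega l 1 in let r := poly_r l mu omega l 1 in
  let c := coupling omega in let s := (- (1)) ^ l in
  half_turn (climb_x l mu y) 0 = r * half_turn y 0 - s * c * p * half_turn x 0
  /\ half_turn (climb_y l mu x) 0 = s * r * half_turn x 0 + c * p * half_turn y 0.
Proof.
  intros Hw H p r c s.
  assert (Hs : s * s = 1) by apply neg1_sqr.
  destruct (linsol_exists l mu omega 0 1) as [x1 [y1 [X1 [Y1 H1]]]].
  destruct (linsol_exists l mu omega 1 0) as [x2 [y2 [X2 [Y2 H2]]]].
  assert (A1 := climb_adjoint _ _ _ _ _ _ _ 0 Hw H1 H).
  assert (A2 := climb_adjoint _ _ _ _ _ _ _ 0 Hw H2 H).
  destruct (climb_at_1 _ _ _ _ _ Hw H1) as [B1 B1'].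
  destruct (climb_at_1 _ _ _ _ _ Hw H2) as [B2 B2'].
  rewrite B1, B1', X1, Y1 in A1; rewrite B2, B2', X2, Y2 in A2.
  rewrite Cpow_S in A1, A2; fold p r c s in A1, A2.
  set (hx := half_turn x 0) in *; set (hy := half_turn y 0) in *.
  set (tx := half_turn (climb_x l mu y) 0) in *; set (ty := half_turn (climb_y l mu x) 0) in *.
  split.
  - replace tx with (tx * 1 - ty * 0) by ring; rewrite A1.
    replace (r * hy) with (s * s * (r * hy)) by (rewrite Hs; ring); ring.
  - replace ty with (- (tx * 0 - ty * 1)) by ring; rewrite A2.
    replace (c * p * hy) with (s * s * (c * p * hy)) by (rewrite Hs; ring); ring.
Qed.

(** The determinant, up to sign, of the matrix in [climb_at_1]. *)
Definition turn_scalar (l : nat) (mu omega : R) : C :=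
  let p := poly_p l mu omega l 1 in let r := poly_r l mu omega l 1 in
  let c := coupling omega in r * r + c * c * p * p.

(** Both sides are solutions.  Up to sign, the value of H^2 at z = 1 is the adjugate of
    the matrix of [climb_at_1] applied to the value of H at e^{i pi}, and this is the matrix
    itself applied to the value of the solution one full turn later. *)
Lemma half_turn_twice (l : nat) (mu omega : R) (x y : C -> C) (z : C) :
  (0 < omega)%R -> linsol l mu omega x y ->
  let tx := half_turn (climb_x l mu y) in let ty := half_turn (climb_y l mu x) in
  half_turn (climb_x l mu ty) z = turn_scalar l mu omega * full_turn x z
  /\ half_turn (climb_y l mu tx) z = turn_scalar l mu omega * full_turn y z.
Proof.
  intros Hw H tx ty.
  assert (H1 := linsol_turned _ _ _ _ _ H); fold tx ty in H1.
  assert (H2 := linsol_turned _ _ _ _ _ H1).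
  assert (Hf := linsol_full _ _ _ _ _ H).
  destruct (linsol_smooth _ _ _ _ _ H) as [Sx Sy].
  set (d := turn_scalar l mu omega).
  assert (Hd := linsol_lin _ _ _ d 0 _ _ _ _ Hf Hf).
  assert (E : forall w, half_turn (climb_x l mu ty) w = d * full_turn x w + 0 * full_turn x w
    /\ half_turn (climb_y l mu tx) w = d * full_turn y w + 0 * full_turn y w).
  { apply (linsol_unique _ _ _ _ _ _ _ 0 H2 Hd).
    - destruct (half_turn_at_1 _ _ _ _ _ Hw H1) as [A _]; rewrite A.
      replace (half_turn tx 0) with (climb_x l mu (full_turn y) 0).
      2:{ unfold climb_x; rewrite ladder_full by exact Sy; rewrite full_turn_half; reflexivity. }
      replace (half_turn ty 0) with (climb_y l mu (full_turn x) 0).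
      2:{ unfold climb_y; rewrite ladder_full by exact Sx; rewrite full_turn_half; reflexivity. }
      destruct (climb_at_1 _ _ _ _ _ Hw Hf) as [B B']; rewrite B, B'.
      unfold d, turn_scalar.
      match goal with |- _ - ?s * ?c * ?p * (_ * ?v) = _ =>
        replace (s * c * p * (s * v)) with (c * p * v * (s * s)) by ring end.
      rewrite neg1_sqr; ring.
    - destruct (half_turn_at_1 _ _ _ _ _ Hw H1) as [_ A]; rewrite A.
      replace (half_turn tx 0) with (climb_x l mu (full_turn y) 0).
      2:{ unfold climb_x; rewrite ladder_full by exact Sy; rewrite full_turn_half; reflexivity. }
      replace (half_turn ty 0) with (climb_y l mu (full_turn x) 0).
      2:{ unfold climb_y; rewrite ladder_full by exact Sx; rewrite full_turn_half; reflexivity. }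
      destruct (climb_at_1 _ _ _ _ _ Hw Hf) as [B B']; rewrite B, B'.
      unfold d, turn_scalar.
      match goal with |- ?s * ?r * (_ * ?v) + _ = _ =>
        replace (s * r * (s * v)) with (r * v * (s * s)) by ring end.
      rewrite neg1_sqr; ring. }
  destruct (E z) as [E1 E2]; rewrite E1, E2; split; ring.
Qed.

Lemma turn_scalar_D (l : nat) (mu omega : R) :
  (0 < omega)%R ->
  turn_scalar l mu omega
  = coupling omega * coupling omega * (D_plus l mu omega * D_minus l mu omega).
Proof.
  intros Hw; rewrite D_plus_eq, D_minus_eq; unfold turn_scalar, coupling.
  set (p := poly_p l mu omega l 1); set (r := poly_r l mu omega l 1).
  assert (N : RtoC omega <> 0) by (intros X; apply RtoC_inj in X; lra).
  assert (I2 : Ci * Ci = - (1)) by (apply C_eq; simpl; ring).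
  assert (E : / (2 * Ci * omega) * / (2 * Ci * omega) = / (Ci * Ci) * / ((2 * omega) * (2 * omega))).
  { field; split; auto using Ci_nz. }
  rewrite E, I2; field; exact N.
Qed.

(** * Pairs as quotients and products of solutions *)

(** Equation (R) in the coordinate zeta. *)
Lemma satisfies_R_Cexp (l : nat) (mu omega : R) (Phi : C -> C) (z : C) :
  (0 < omega)%R ->
  satisfies_R_at l mu omega Phi (Cexp z) ->
  is_Cderive (fun w => Phi (Cexp w)) z
    (coupling omega * (1 - Phi (Cexp z) * Phi (Cexp z))
     + 2 * half_q l mu z * Phi (Cexp z)).
Proof.
  intros Hw H; eapply is_Cderive_eq.
  - apply is_Cderive_comp; [exact H|apply is_Cderive_Cexp].
  - unfold half_q, coupling; rewrite Cexp_opp.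
    field; repeat split; auto using Cexp_neq_0, Ci_nz.
    intros X; apply RtoC_inj in X; lra.
Qed.

Lemma pnear_Cexp (z : C) (P : C -> Prop) :
  pnear (Cexp z) P -> pnear z (fun w => P (Cexp w)).
Proof.
  intros [d [Hd K]].
  assert (D := is_Cderive_Cexp z).
  assert (Cn := is_Cderive_Ccont _ _ _ D d Hd).
  assert (Hm := Cmod_pos _ (Cexp_neq_0 z)).
  rewrite is_Cderive_eps in D.
  specialize (D (Cmod (Cexp z) / 2)%R ltac:(lra)).
  apply (pnear_mono z (fun w => (Cmod (Cexp w - Cexp z) < d)%R /\
    (Cmod (Cexp w - Cexp z - Cexp z * (w - z)) <= Cmod (Cexp z) / 2 * Cmod (w - z))%R)).
  - apply near_pnear, near_and; assumption.
  - intros w Hn [H1 H2]; apply K; [|exact H1].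
    intros E; rewrite E in H2.
    replace (Cexp z - Cexp z - Cexp z * (w - z)) with (- (Cexp z * (w - z))) in H2 by ring.
    rewrite Cmod_opp, Cmod_mult in H2.
    pose proof (Cmod_pos _ (Cminus_neq _ _ Hn)); nra.
Qed.

Definition blows_up (f : C -> C) (z : C) : Prop :=
  forall M : R, pnear z (fun w => (M < Cmod (f w))%R).

Lemma pole_blows_up (f : C -> C) (z : C) : pole f z <-> blows_up f z.
Proof.
  split.
  - intros H M; apply pnear_locally'.
    apply (H (fun y => (M < y)%R)); exists M; auto.
  - intros H P [M HM].
    assert (K := proj1 (pnear_locally' _ _) (H M)).
    unfold filtermap; eapply filter_imp; [|exact K]; intros w; apply HM.
Qed.

Lemma solves_R_zeta (l : nat) (mu omega : R) (Phi : C -> C) (z : C) :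
  solves_R l mu omega Phi -> strip z ->
  satisfies_R_at l mu omega Phi (Cexp z)
  \/ (pnear z (fun w => satisfies_R_at l mu omega Phi (Cexp w))
      /\ blows_up (fun w => Phi (Cexp w)) z).
Proof.
  intros H Hz; destruct (H _ (slit_Cexp _ Hz)) as [A|[A B]]; [now left|right; split].
  - apply pnear_Cexp, pnear_locally', A.
  - intros M; apply (pnear_Cexp z (fun v => (M < Cmod (Phi v))%R)).
    now apply pole_blows_up.
Qed.

Lemma Ccont_bounded (f : C -> C) (z : C) :
  Ccont f z -> near z (fun w => (Cmod (f w) < Cmod (f z) + 1)%R).
Proof.
  intros H; eapply near_mono; [exact (H 1%R ltac:(lra))|]; intros w Hw; cbv beta in Hw.
  pose proof (Cmod_triangle (f w - f z) (f z)) as T.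
  replace (f w - f z + f z) with (f w) in T by ring; lra.
Qed.

Lemma blows_up_not_bounded (f : C -> C) (z : C) (M : R) :
  blows_up f z -> pnear z (fun w => (Cmod (f w) < M)%R) -> False.
Proof.
  intros H K; destruct (pnear_exists _ _ (pnear_and _ _ _ (H M) K)) as [w [_ [A B]]]; lra.
Qed.

Lemma strip_0 : strip 0.
Proof. unfold strip; simpl; pose proof PI_RGT_0; lra. Qed.

(** Poles do not accumulate at a regular point, since the solution is bounded near it. *)
Lemma solves_R_regular_near (l : nat) (mu omega : R) (Phi : C -> C) (z : C) :
  (0 < omega)%R -> solves_R l mu omega Phi -> strip z ->
  satisfies_R_at l mu omega Phi (Cexp z) ->
  near z (fun w => satisfies_R_at l mu omega Phi (Cexp w)).
Proof.
  intros Hw H Hz A.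
  assert (B := near_near _ _ (Ccont_bounded _ _
    (is_Cderive_Ccont _ _ _ (satisfies_R_Cexp _ _ _ _ _ Hw A)))).
  eapply near_mono; [exact (near_and _ _ _ (strip_near z Hz) B)|]; intros w [Sw Bw].
  destruct (solves_R_zeta _ _ _ _ w H Sw) as [A'|[_ P]]; [exact A'|exfalso].
  exact (blows_up_not_bounded _ _ _ P (near_pnear _ _ Bw)).
Qed.

Lemma is_Cderive_zero_isolated (f : C -> C) (z d : C) :
  is_Cderive f z d -> (f z <> 0 \/ d <> 0) -> pnear z (fun w => f w <> 0).
Proof.
  intros D Hor; destruct (Ceq_dec (f z) 0) as [E|N].
  - assert (Hd : d <> 0) by tauto.
    assert (Hm := Cmod_pos _ Hd).
    rewrite is_Cderive_eps in D; specialize (D (Cmod d / 2)%R ltac:(lra)).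
    eapply pnear_mono; [exact (near_pnear _ _ D)|]; intros w Hn K E'; cbv beta in K.
    rewrite E, E' in K.
    replace (0 - 0 - d * (w - z)) with (- (d * (w - z))) in K by ring.
    rewrite Cmod_opp, Cmod_mult in K.
    pose proof (Cmod_pos _ (Cminus_neq _ _ Hn)); nra.
  - apply near_pnear, Ccont_near_neq; [eapply is_Cderive_Ccont; exact D|exact N].
Qed.

Lemma linsol_not_both_0 (l : nat) (mu omega : R) (x y : C -> C) (p z : C) :
  linsol l mu omega x y -> x p <> 0 -> x z = 0 -> y z = 0 -> False.
Proof. intros H N A B; exact (N (proj1 (linsol_unique_0 _ _ _ _ _ z H A B p))). Qed.

(** A component vanishes to first order at its zeros, the other one being nonzero there. *)
Lemma linsol_zeros_isolated (l : nat) (mu omega : R) (x y : C -> C) (z : C) :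
  (0 < omega)%R -> linsol l mu omega x y -> x 0 <> 0 ->
  pnear z (fun w => x w <> 0 /\ y w <> 0).
Proof.
  intros Hw H N; assert (Hc := coupling_neq_0 _ Hw); destruct (H z) as [X Y].
  apply pnear_and.
  - apply (is_Cderive_zero_isolated _ _ _ X).
    destruct (Ceq_dec (x z) 0) as [E|E]; [right|now left].
    rewrite E; intros K; apply (linsol_not_both_0 _ _ _ _ _ 0 z H N E).
    apply (Cmult_reg_l (coupling omega)); [exact Hc|].
    transitivity (half_q l mu z * 0 + coupling omega * y z); [ring|rewrite K; ring].
  - apply (is_Cderive_zero_isolated _ _ _ Y).
    destruct (Ceq_dec (y z) 0) as [E|E]; [right|now left].
    rewrite E; intros K; apply (fun K' => linsol_not_both_0 _ _ _ _ _ 0 z H N K' E).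
    apply (Cmult_reg_l (coupling omega)); [exact Hc|].
    transitivity (coupling omega * x z - half_q l mu z * 0); [ring|rewrite K; ring].
Qed.

(** Let (u, v) be a second solution.  The functions W = Phi y - x and V = Phi v - u never
    vanish together and, by (R), W / V is locally constant where V is not zero.  So the
    vanishing of W is an open and closed condition off the poles; it holds at 1, hence
    everywhere. *)
Lemma solves_R_quotient (l : nat) (mu omega : R) (Phi : C -> C) (x y : C -> C) :
  (0 < omega)%R -> solves_R l mu omega Phi -> ex_Cderive Phi 1 ->
  linsol l mu omega x y -> x 0 <> 0 -> Phi 1 * y 0 = x 0 ->
  forall z, strip z ->
    (y z <> 0 /\ satisfies_R_at l mu omega Phi (Cexp z) /\ Phi (Cexp z) = x z / y z)
    \/ (y z = 0 /\ blows_up (fun w => Phi (Cexp w)) z).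
Proof.
  intros Hw HR Hex H N H0.
  set (f := fun w => Phi (Cexp w)).
  set (Reg := fun w => satisfies_R_at l mu omega Phi (Cexp w)).
  assert (Hy0 : y 0 <> 0).
  { intros E; apply N; rewrite <- H0, E; ring. }
  assert (R0 : Reg 0).
  { destruct (solves_R_zeta _ _ _ _ 0 HR strip_0) as [A|[_ B]]; [exact A|exfalso].
    destruct Hex as [d Hd].
    assert (Cn : Ccont f 0).
    { eapply is_Cderive_Ccont, (is_Cderive_comp Phi Cexp); [|apply is_Cderive_Cexp].
      rewrite Cexp_0; exact Hd. }
    exact (blows_up_not_bounded _ _ _ B (near_pnear _ _ (Ccont_bounded _ _ Cn))). }
  destruct (linsol_exists l mu omega 1 0) as [u [v [U0 [V0 K]]]].
  assert (Det : forall w, x w * v w - y w * u w <> 0).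
  { intros w; rewrite (linsol_wronskian _ _ _ _ _ _ _ H K w 0), U0, V0.
    intros E; apply Hy0; replace (y 0) with (- (x 0 * 0 - y 0 * 1)) by ring.
    rewrite E; ring. }
  set (P := fun w => f w * y w = x w).
  (* The derivative of the Riccati defect is proportional to it, with a factor that
     does not depend on the solution (a, b). *)
  assert (Df : forall a b w, linsol l mu omega a b -> Reg w ->
    is_Cderive (fun w => f w * b w - a w) w
      ((half_q l mu w - coupling omega * f w) * (f w * b w - a w))).
  { intros a b w Hab Rw; destruct (Hab w) as [A B].
    eapply is_Cderive_eq.
    - apply is_Cderive_minus; [apply is_Cderive_mult|exact A]; [|exact B].
      apply (satisfies_R_Cexp _ _ _ _ _ Hw Rw).
    - unfold f; ring. }
  assert (Loc : forall w, near w Reg -> near w P \/ near w (fun t => ~ P t)).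
  { intros w Rw; assert (Rw0 := near_point _ _ Rw).
    destruct (Ceq_dec (f w * y w - x w) 0) as [E|E].
    - left.
      assert (E2 : f w * v w - u w <> 0).
      { intros E2; apply (Det w).
        replace (x w * v w - y w * u w)
          with (y w * (f w * v w - u w) - v w * (f w * y w - x w)) by ring.
        rewrite E, E2; ring. }
      assert (NZ := Ccont_near_neq _ _ 0
        (is_Cderive_Ccont _ _ _ (Df u v w K Rw0)) E2).
      assert (D0 : near w (fun t =>
        is_Cderive (fun t => (f t * y t - x t) / (f t * v t - u t)) t 0)).
      { eapply near_mono; [exact (near_and _ _ _ Rw NZ)|]; intros t [Rt Nt].
        eapply is_Cderive_eq.
        - apply is_Cderive_div; [apply Df; assumption|apply Df; assumption|exact Nt].
        - cbv beta; field; exact Nt. }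
      eapply near_mono; [exact (near_and _ _ _ NZ (near_is_Cderive_0 _ _ D0))|].
      intros t [Nt Et]; cbv beta in Et; rewrite E in Et; unfold P.
      apply (Cmult_reg_l (/ (f t * v t - u t))).
      + intros X; apply C1_nz; rewrite <- (Cinv_l _ Nt), X; ring.
      + replace (/ (f t * v t - u t) * (f t * y t)) with
          ((f t * y t - x t) / (f t * v t - u t) + / (f t * v t - u t) * x t)
          by (field; exact Nt).
        rewrite Et; field; split; [exact Nt|exact E2].
    - right; eapply near_mono;
        [exact (Ccont_near_neq _ _ 0 (is_Cderive_Ccont _ _ _ (Df x y w H Rw0)) E)|].
      intros t Nt Pt; apply Nt; unfold P in Pt; rewrite Pt; ring. }
  assert (NearReg : forall w, strip w -> Reg w -> near w Reg).
  { intros w Sw Rw; exact (solves_R_regular_near _ _ _ _ _ Hw HR Sw Rw). }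
  assert (PReg : forall w, strip w -> pnear w (fun t => near t Reg)).
  { intros w Sw; destruct (solves_R_zeta _ _ _ _ w HR Sw) as [A|[A _]].
    - apply pnear_near, near_pnear, NearReg; assumption.
    - apply pnear_near, A. }
  assert (All : forall w, strip w -> pnear w P).
  { apply clopen_strip.
    - intros w Sw; apply pnear_clopen; eapply pnear_mono; [exact (PReg w Sw)|].
      intros t _; apply Loc.
    - destruct (Loc 0 (NearReg 0 strip_0 R0)) as [Y|Y]; [exact (near_pnear _ _ Y)|].
      exfalso; apply (near_point _ _ Y); unfold P, f; rewrite Cexp_0; exact H0. }
  intros z Sz; destruct (H z) as [X Y].
  destruct (solves_R_zeta _ _ _ _ z HR Sz) as [A|[_ B]].
  - left.
    assert (Pz : P z).
    { apply (Ccont_unique_lim (fun w => f w * y w) x).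
      - eapply is_Cderive_Ccont, is_Cderive_mult; [|exact Y].
        apply (satisfies_R_Cexp _ _ _ _ _ Hw A).
      - eapply is_Cderive_Ccont; exact X.
      - exact (All z Sz). }
    assert (Ny : y z <> 0).
    { intros E; unfold P in Pz; rewrite E in Pz.
      apply (linsol_not_both_0 _ _ _ _ _ 0 z H N); [rewrite <- Pz; ring|exact E]. }
    split; [exact Ny|]; split; [exact A|].
    unfold P, f in Pz; rewrite <- Pz; field; exact Ny.
  - right; split; [|exact B].
    destruct (Ceq_dec (y z) 0) as [E|Ny]; [exact E|exfalso].
    assert (Q := Ccont_bounded _ _ (is_Cderive_Ccont _ _ _ (is_Cderive_div _ _ _ _ _ X Y Ny))).
    assert (NY := Ccont_near_neq _ _ 0 (is_Cderive_Ccont _ _ _ Y) Ny).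
    apply (blows_up_not_bounded _ _ (Cmod (x z / y z) + 1)%R B).
    eapply pnear_mono;
      [exact (pnear_and _ _ _ (All z Sz) (near_pnear _ _ (near_and _ _ _ Q NY)))|].
    intros w _ [Pw [Qw Nw]]; unfold P, f in Pw.
    replace (Phi (Cexp w)) with (x w / y w); [exact Qw|].
    rewrite <- Pw; field; exact Nw.
Qed.

(** The ratio of Psi and x y has zero derivative off the zeros of x and y. *)
Lemma solves_L_product (l : nat) (mu omega : R) (Phi Psi : C -> C) (x y : C -> C) :
  (0 < omega)%R -> solves_R l mu omega Phi -> ex_Cderive Phi 1 ->
  solves_L omega Phi Psi -> Psi 1 = 1 ->
  linsol l mu omega x y -> x 0 * y 0 = 1 -> Phi 1 * y 0 = x 0 ->
  forall z, strip z -> x z <> 0 -> y z <> 0 -> Psi (Cexp z) = x z * y z.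
Proof.
  intros Hw HR Hex HL HP H Hxy H0 z Sz Nx Ny.
  assert (N : x 0 <> 0).
  { intros E; apply C1_nz; rewrite <- Hxy, E; ring. }
  assert (Ny0 : y 0 <> 0).
  { intros E; apply C1_nz; rewrite <- Hxy, E; ring. }
  assert (Q := solves_R_quotient _ _ _ _ _ _ Hw HR Hex H N H0).
  set (Good := fun w => strip w /\ x w <> 0 /\ y w <> 0).
  assert (NearGood : forall w, Good w -> near w Good).
  { intros w [Sw [Xw Yw]]; destruct (H w) as [X Y]; apply near_and; [now apply strip_near|].
    apply near_and; apply Ccont_near_neq; auto; eapply is_Cderive_Ccont; eassumption. }
  assert (RG := rigidity (fun w => Psi (Cexp w) / (x w * y w)) Good).
  assert (E : Psi (Cexp z) / (x z * y z) = Psi (Cexp 0) / (x 0 * y 0)).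
  { apply RG.
    - intros w [Sw [Xw Yw]]; destruct (H w) as [X Y].
      destruct (Q w Sw) as [[_ [Rw Ew]]|[Yw' _]]; [|contradiction].
      assert (D := HL (Cexp w) (slit_Cexp _ Sw)
        (ex_intro (fun d => is_Cderive Phi (Cexp w) d) _ Rw)).
      assert (NP : Phi (Cexp w) <> 0).
      { rewrite Ew; intros E; apply Xw; replace (x w) with (x w / y w * y w)
          by (field; exact Yw); rewrite E; ring. }
      specialize (D NP).
      eapply is_Cderive_eq.
      + apply is_Cderive_div; [|apply is_Cderive_mult; eassumption|now apply Cmult_neq_0].
        apply (is_Cderive_comp Psi Cexp); [exact D|apply is_Cderive_Cexp].
      + rewrite Ew; unfold coupling.
        field; repeat split; auto using Cexp_neq_0, Ci_nz.
        intros X0; apply RtoC_inj in X0; lra.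
    - intros w Sw; apply pnear_and; [apply near_pnear, strip_near, Sw|].
      exact (linsol_zeros_isolated _ _ _ _ _ w Hw H N).
    - apply NearGood; repeat split; auto using strip_0; apply strip_0.
    - exact Sz.
    - repeat split; auto; apply Sz. }
  rewrite Hxy, Cexp_0, HP in E.
  replace (Psi (Cexp z)) with (Psi (Cexp z) / (x z * y z) * (x z * y z)) by (field; auto).
  rewrite E; field.
Qed.

(** * The phase on the unit circle *)

Lemma is_Rderive_of_parts (g : R -> C) (t : R) (v : C) :
  is_derive (fun s => Re (g s)) t (Re v) -> is_derive (fun s => Im (g s)) t (Im v) ->
  is_Rderive g t v.
Proof.
  intros HR HI eps He; apply is_derive_Reals in HR; apply is_derive_Reals in HI.
  destruct (derivable_pt_lim_bound _ _ _ HR (eps / 2)%R ltac:(lra)) as [d1 [D1 K1]].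
  destruct (derivable_pt_lim_bound _ _ _ HI (eps / 2)%R ltac:(lra)) as [d2 [D2 K2]].
  exists (Rmin d1 d2); split; [now apply Rmin_glb_lt|]; intros s Hs.
  specialize (K1 (s - t)%R (Rlt_le_trans _ _ _ Hs (Rmin_l _ _))).
  specialize (K2 (s - t)%R (Rlt_le_trans _ _ _ Hs (Rmin_r _ _))).
  replace (t + (s - t))%R with s in K1, K2 by ring.
  eapply Rle_trans; [apply Cmod_le_ReIm|].
  replace (Re (g s - g t - v * RtoC (s - t))) with (Re (g s) - Re (g t) - Re v * (s - t))%R
    by (destruct (g s), (g t), v; simpl; ring).
  replace (Im (g s - g t - v * RtoC (s - t))) with (Im (g s) - Im (g t) - Im v * (s - t))%R
    by (destruct (g s), (g t), v; simpl; ring).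
  lra.
Qed.

Lemma is_Rderive_mult (f g : R -> C) (t : R) (a b : C) :
  is_Rderive f t a -> is_Rderive g t b ->
  is_Rderive (fun s => f s * g s) t (a * g t + f t * b).
Proof.
  intros Hf Hg.
  assert (f1 := is_Rderive_Re _ _ _ Hf); assert (f2 := is_Rderive_Im _ _ _ Hf).
  assert (g1 := is_Rderive_Re _ _ _ Hg); assert (g2 := is_Rderive_Im _ _ _ Hg).
  apply is_Rderive_of_parts.
  - evar_last.
    + apply (is_derive_minus (V := R_NormedModule)
        (fun s => Re (f s) * Re (g s))%R (fun s => Im (f s) * Im (g s))%R);
        (apply (is_derive_mult (K := R_AbsRing)); [eassumption|eassumption|intros; apply Rmult_comm]).
    + unfold minus, plus, opp, mult; simpl; unfold Re, Im; simpl; ring.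
  - evar_last.
    + apply (is_derive_plus (V := R_NormedModule)
        (fun s => Re (f s) * Im (g s))%R (fun s => Im (f s) * Re (g s))%R);
        (apply (is_derive_mult (K := R_AbsRing)); [eassumption|eassumption|intros; apply Rmult_comm]).
    + unfold minus, plus, opp, mult; simpl; unfold Re, Im; simpl; ring.
Qed.

Lemma is_Rderive_0_const (g : R -> C) :
  (forall t, is_Rderive g t 0) -> forall t, g t = g 0%R.
Proof.
  intros H t.
  assert (K : forall a b, (a < b)%R -> g a = g b).
  { intros a b Hab; apply C_eq.
    - apply (eq_is_derive (V := R_NormedModule) (fun s => Re (g s)) a b); [|exact Hab].
      intros s _; exact (is_Rderive_Re _ _ _ (H s)).
    - apply (eq_is_derive (V := R_NormedModule) (fun s => Im (g s)) a b); [|exact Hab].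
      intros s _; exact (is_Rderive_Im _ _ _ (H s)). }
  destruct (Rtotal_order t 0) as [L|[E|G]]; [now apply K|now rewrite E|symmetry; now apply K].
Qed.

Lemma is_Rderive_RtoC (f : R -> R) (t d : R) :
  is_derive f t d -> is_Rderive (fun s => RtoC (f s)) t (RtoC d).
Proof.
  intros H; apply is_Rderive_of_parts; [exact H|].
  apply (is_derive_const (K := R_AbsRing) (V := R_NormedModule) 0%R t).
Qed.

Lemma Rcont_continuous_Re (g : R -> C) (t : R) :
  Rcont g t -> continuous (fun s => Re (g s)) t.
Proof.
  intros H; apply (proj2 (filterlim_locally (U := R_UniformSpace) _ _)); intros eps.
  destruct (H eps (cond_pos eps)) as [d [Hd K]]; exists (mkposreal d Hd); intros s Hs.
  unfold ball; simpl; unfold AbsRing_ball, abs, minus, plus, opp; simpl.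
  eapply Rle_lt_trans; [|exact (K s Hs)].
  exact (re_le_Cmod (g s - g t)).
Qed.

Lemma Rcont_continuous_Im (g : R -> C) (t : R) :
  Rcont g t -> continuous (fun s => Im (g s)) t.
Proof.
  intros H; apply (proj2 (filterlim_locally (U := R_UniformSpace) _ _)); intros eps.
  destruct (H eps (cond_pos eps)) as [d [Hd K]]; exists (mkposreal d Hd); intros s Hs.
  unfold ball; simpl; unfold AbsRing_ball, abs, minus, plus, opp; simpl.
  eapply Rle_lt_trans; [|exact (K s Hs)].
  exact (im_le_Cmod (g s - g t)).
Qed.

(** The coordinate zeta of e^{i omega t}. *)
Definition arc (omega t : R) : C := Ci * RtoC (omega * t).

Lemma arc_affine (omega t : R) : arc omega t = 0 + RtoC t * (Ci * RtoC omega).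
Proof. unfold arc; rewrite RtoC_mult; ring. Qed.

Lemma is_Rderive_arc (f : C -> C) (omega t : R) (d : C) :
  is_Cderive f (arc omega t) d ->
  is_Rderive (fun s => f (arc omega s)) t (d * (Ci * RtoC omega)).
Proof.
  intros H.
  replace (fun s => f (arc omega s)) with (fun s => f (0 + RtoC s * (Ci * RtoC omega)))
    by (apply functional_extensionality; intros s; now rewrite arc_affine).
  rewrite arc_affine in H.
  apply (is_Rderive_comp f (fun s => 0 + RtoC s * (Ci * RtoC omega))); [exact H|].
  apply is_Rderive_affine.
Qed.

Lemma Rcont_arc (f : C -> C) (omega t : R) :
  Ccont f (arc omega t) -> Rcont (fun s => f (arc omega s)) t.
Proof.
  intros H.
  replace (fun s => f (arc omega s)) with (fun s => f (0 + RtoC s * (Ci * RtoC omega)))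
    by (apply functional_extensionality; intros s; now rewrite arc_affine).
  rewrite arc_affine in H.
  apply (Rcont_comp f (fun s => 0 + RtoC s * (Ci * RtoC omega))); [exact H|].
  apply Rcont_affine.
Qed.

Lemma Cexp_arc (omega t : R) : Cexp (arc omega t) = cis (omega * t).
Proof. apply Cexp_imag. Qed.

Lemma half_period (omega : R) : (0 < omega)%R -> (period omega / 2 = PI / omega)%R.
Proof. intros H; unfold period; field; lra. Qed.

Lemma strip_arc (omega t : R) :
  (0 < omega)%R -> (- (period omega / 2) < t < period omega / 2)%R -> strip (arc omega t).
Proof.
  intros Hw; rewrite half_period by exact Hw; intros [H1 H2].
  assert (E : (PI = omega * (PI / omega))%R) by (field; lra).
  unfold strip, arc; rewrite im_mult; simpl.
  assert (omega * t < omega * (PI / omega))%R by (apply Rmult_lt_compat_l; lra).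
  assert (omega * - (PI / omega) < omega * t)%R by (apply Rmult_lt_compat_l; lra).
  lra.
Qed.

(** The reflection in the unit circle followed by the exchange of the components maps
    solutions to solutions, and it fixes the value at 1. *)
Lemma linsol_conj (l : nat) (mu omega : R) (x y : C -> C) :
  (0 < omega)%R -> linsol l mu omega x y -> y 0 = Cconj (x 0) ->
  forall z, y z = reflect x z.
Proof.
  intros Hw H E z.
  assert (K := linsol_reflect _ _ _ _ _ Hw H).
  symmetry; apply (linsol_unique _ _ _ _ _ _ _ 0 K H).
  - unfold reflect; replace (- Cconj 0) with (RtoC 0)
      by (rewrite RtoC_conj; ring); rewrite E, Cconj_conj; reflexivity.
  - unfold reflect; replace (- Cconj 0) with (RtoC 0)
      by (rewrite RtoC_conj; ring); now rewrite E.
Qed.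

Lemma arc_conj (omega t : R) : - Cconj (arc omega t) = arc omega t.
Proof. unfold arc; destruct (RtoC (omega * t)) eqn:E; apply C_eq; simpl; injection E; intros; subst; ring. Qed.

(** At z = 1 the components are conjugate and unimodular, as for Phi^{1/2} and Phi^{-1/2}. *)
Definition normalised (l : nat) (mu omega : R) (x y : C -> C) : Prop :=
  linsol l mu omega x y /\ Cmod (x 0) = 1%R /\ y 0 = Cconj (x 0).

Lemma normalised_mult (x0 : C) : Cmod x0 = 1%R -> x0 * Cconj x0 = 1.
Proof. intros H; rewrite <- Cmod2_conj, H; apply C_eq; simpl; ring. Qed.

Lemma normalised_arc_conj (l : nat) (mu omega : R) (x y : C -> C) (t : R) :
  (0 < omega)%R -> normalised l mu omega x y ->
  y (arc omega t) = Cconj (x (arc omega t)).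
Proof.
  intros Hw [H [_ E]]; rewrite (linsol_conj _ _ _ _ _ Hw H E).
  unfold reflect; now rewrite arc_conj.
Qed.

Lemma normalised_arc_neq_0 (l : nat) (mu omega : R) (x y : C -> C) (t : R) :
  (0 < omega)%R -> normalised l mu omega x y ->
  x (arc omega t) <> 0 /\ y (arc omega t) <> 0.
Proof.
  intros Hw Hn; assert (E := normalised_arc_conj _ _ _ _ _ t Hw Hn).
  destruct Hn as [H [M _]].
  assert (N0 : x 0 <> 0) by (apply Cmod_gt_0; rewrite M; lra).
  assert (Nx : x (arc omega t) <> 0).
  { intros X; apply (linsol_not_both_0 _ _ _ _ _ 0 _ H N0 X).
    rewrite E, X; apply RtoC_conj. }
  split; [exact Nx|]; rewrite E; apply Cmod_gt_0; rewrite Cmod_conj; now apply Cmod_gt_0.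
Qed.

Lemma arc_0 (omega : R) : arc omega 0 = 0.
Proof. unfold arc; rewrite Rmult_0_r; ring. Qed.

Lemma half_q_arc_conj (l : nat) (mu omega t : R) :
  Cconj (half_q l mu (arc omega t)) = half_q l mu (arc omega t).
Proof.
  unfold half_q, Cdiv; rewrite Cmult_conj, Cplus_conj, Cmult_conj, Cplus_conj, <- !Cexp_conj.
  rewrite Copp_conj, Cinv_conj, !RtoC_conj by apply two_neq_0.
  replace (Cconj (arc omega t)) with (- arc omega t) by (rewrite <- (arc_conj omega t) at 1; ring).
  replace (- - arc omega t) with (arc omega t) by ring; ring.
Qed.

(** The phase is the primitive of its own equation, whose right-hand side is expressed
    with the known quotient x / y. *)
Lemma phase_lift (l : nat) (mu omega theta0 : R) (x y : C -> C) :
  (0 < omega)%R -> normalised l mu omega x y -> x 0 = cis theta0 * y 0 ->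
  exists theta : R -> R, (forall t, continuous theta t)
    /\ forall t, cis (theta t) = x (arc omega t) / y (arc omega t).
Proof.
  intros Hw Hn H0.
  assert (NZ := fun t => normalised_arc_neq_0 _ _ _ _ _ t Hw Hn).
  assert (CJ := fun t => normalised_arc_conj _ _ _ _ _ t Hw Hn).
  assert (H := proj1 Hn).
  (* On the circle this is i times the right-hand side of the equation of the phase. *)
  set (W := fun z => 2 * Ci * omega * half_q l mu z + (y z / x z - x z / y z) / 2).
  set (w := fun t => Im (W (arc omega t))).
  assert (HW : forall t, W (arc omega t) = Ci * RtoC (w t)).
  { intros t; unfold w; apply C_eq; [|simpl; ring].
    assert (E : Cconj (W (arc omega t)) = - W (arc omega t)).
    { destruct (NZ t) as [Nx Ny]; unfold W.
      unfold Cdiv; rewrite !Cplus_conj, !Cmult_conj, !Cminus_conj, !Cmult_conj.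
      rewrite !Cinv_conj, !RtoC_conj, half_q_arc_conj by (auto using two_neq_0).
      rewrite (CJ t), Cconj_conj.
      replace (Cconj Ci) with (- Ci) by (apply C_eq; simpl; ring).
      ring. }
    apply (f_equal Re) in E; rewrite re_conj, re_opp in E.
    replace (Re (W (arc omega t))) with 0%R by lra; simpl; ring. }
  assert (Cw : forall t, continuous w t).
  { intros t; apply (Rcont_continuous_Im (fun s => W (arc omega s))).
    apply Rcont_arc; destruct (NZ t) as [Nx Ny]; destruct (H (arc omega t)) as [X Y].
    assert (Q := smooth_is_Cderive _ (arc omega t) (smooth_half_q l mu)).
    eapply is_Cderive_Ccont; unfold W.
    apply is_Cderive_plus.
    - apply is_Cderive_mult; [apply is_Cderive_const|exact Q].
    - apply is_Cderive_div; [|apply (is_Cderive_const 2)|apply two_neq_0].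
      apply is_Cderive_minus; apply is_Cderive_div; eassumption. }
  set (theta := fun t => (theta0 + RInt w 0 t)%R).
  assert (Dth : forall t, is_derive theta t (w t)).
  { intros t; evar_last.
    - apply (is_derive_plus (V := R_NormedModule) (fun _ => theta0) (fun t => RInt w 0 t)).
      + apply (is_derive_const (K := R_AbsRing) (V := R_NormedModule)).
      + apply is_derive_RInt with 0%R; [|apply Cw].
        apply filter_forall; intros b.
        apply (RInt_correct (V := R_CompleteNormedModule)).
        apply (ex_RInt_continuous (V := R_CompleteNormedModule)); intros; apply Cw.
    - unfold plus, zero; simpl; ring. }
  exists theta; split.
  { intros t; apply (ex_derive_continuous theta); eexists; apply Dth. }
  set (K := fun t => Cexp (- Ci * RtoC (theta t)) * (x (arc omega t) / y (arc omega t))).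
  assert (DK : forall t, is_Rderive K t 0).
  { intros t; destruct (NZ t) as [Nx Ny]; destruct (H (arc omega t)) as [X Y].
    assert (D1 : is_Rderive (fun s => Cexp (- Ci * RtoC (theta s))) t
      ((- Ci * Cexp (- Ci * RtoC (theta t))) * RtoC (w t))).
    { apply (is_Rderive_comp (fun v => Cexp (- Ci * v)) (fun s => RtoC (theta s))).
      - eapply is_Cderive_eq.
        + apply is_Cderive_Cexp_comp, is_Cderive_mult;
            [apply is_Cderive_const|apply is_Cderive_id].
        + cbv beta; ring.
      - apply is_Rderive_RtoC, Dth. }
    assert (D2 := is_Rderive_arc _ _ _ _ (is_Cderive_div _ _ _ _ _ X Y Ny)).
    assert (D := is_Rderive_mult _ _ _ _ _ D1 D2); cbv beta in D.
    replace (RtoC 0) with (- Ci * Cexp (- Ci * theta t) * w t * (x (arc omega t) / y (arc omega t)) +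
     Cexp (- Ci * theta t) *
     (((half_q l mu (arc omega t) * x (arc omega t) + coupling omega * y (arc omega t)) *
       y (arc omega t) -
       x (arc omega t) *
       (coupling omega * x (arc omega t) - half_q l mu (arc omega t) * y (arc omega t))) /
      (y (arc omega t) * y (arc omega t)) * (Ci * omega))); [exact D|].
    replace (- Ci * Cexp (- Ci * theta t) * w t)
      with (- Cexp (- Ci * theta t) * (Ci * RtoC (w t))) by ring.
    rewrite <- HW; unfold W, coupling; field; repeat split; auto using Ci_nz.
    intros E; apply RtoC_inj in E; lra. }
  intros t.
  assert (E := is_Rderive_0_const K DK t); unfold K in E.
  rewrite arc_0 in E; unfold theta in E at 2; rewrite RInt_point in E.
  change (zero : R) with 0%R in E; rewrite Rplus_0_r in E.
  assert (Ny0 := proj2 (NZ 0%R)); rewrite arc_0 in Ny0.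
  replace (x 0 / y 0) with (cis theta0) in E by (rewrite H0; field; exact Ny0).
  replace (- Ci * RtoC theta0) with (- (Ci * RtoC theta0)) in E by ring.
  replace (- Ci * RtoC (theta t)) with (- (Ci * RtoC (theta t))) in E by ring.
  rewrite !Cexp_opp, !Cexp_imag in E.
  assert (Nc : forall a, cis a <> 0) by (intros a; rewrite <- Cexp_imag; apply Cexp_neq_0).
  rewrite Cinv_l in E by apply Nc.
  replace (x (arc omega t) / y (arc omega t))
    with (cis (theta t) * (/ cis (theta t) * (x (arc omega t) / y (arc omega t)))).
  - rewrite E; ring.
  - field; split; [apply NZ|apply Nc].
Qed.

Lemma arc_quotient (l : nat) (mu omega : R) (Phi : C -> C) (x y : C -> C) (t : R) :
  (0 < omega)%R -> solves_R l mu omega Phi -> ex_Cderive Phi 1 ->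
  normalised l mu omega x y -> Phi 1 * y 0 = x 0 ->
  (- (period omega / 2) < t < period omega / 2)%R ->
  Phi (cis (omega * t)) = x (arc omega t) / y (arc omega t).
Proof.
  intros Hw HR Hex Hn H0 Ht; rewrite <- Cexp_arc.
  assert (N0 : x 0 <> 0) by (apply Cmod_gt_0; rewrite (proj1 (proj2 Hn)); lra).
  destruct (solves_R_quotient _ _ _ _ _ _ Hw HR Hex (proj1 Hn) N0 H0 _ (strip_arc _ _ Hw Ht))
    as [[_ [_ E]]|[E _]]; [exact E|exfalso].
  exact (proj2 (normalised_arc_neq_0 _ _ _ _ _ t Hw Hn) E).
Qed.

Lemma normalised_exists (l : nat) (mu omega theta : R) :
  exists x y : C -> C, normalised l mu omega x y
    /\ x 0 = cis (theta / 2) /\ y 0 = cis (- theta / 2).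
Proof.
  destruct (linsol_exists l mu omega (cis (theta / 2)) (cis (- theta / 2)))
    as [x [y [X [Y H]]]].
  exists x, y; repeat split; try apply H; auto; rewrite ?X, ?Y; [apply Cmod_cis|].
  rewrite <- cis_opp; f_equal; field.
Qed.

Lemma cis_double (a : R) : cis (a / 2) * cis (a / 2) = cis a.
Proof. rewrite <- cis_plus; f_equal; field. Qed.

Lemma cis_half_inv (a : R) : cis (- a / 2) * cis (a / 2) = 1.
Proof.
  rewrite <- cis_plus; replace (- a / 2 + a / 2)%R with 0%R by field; apply cis_0.
Qed.

Lemma cis_half_quotient (a : R) (w : C) :
  w = cis a -> w * cis (- a / 2) = cis (a / 2).
Proof.
  intros ->; rewrite <- (cis_double a), <- Cmult_assoc, (Cmult_comm _ (cis (- a / 2))).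
  rewrite cis_half_inv; ring.
Qed.

Lemma unimodular_cis (w : C) : Cmod w = 1%R -> exists a, w = cis a.
Proof.
  intros H; assert (N : w <> 0) by (apply Cmod_gt_0; lra).
  destruct (Cexp_surj w N) as [z Hz]; exists (Im z).
  rewrite <- Hz; unfold Cexp.
  assert (E : exp (Re z) = 1%R) by (rewrite <- Cmod_Cexp, Hz; exact H).
  rewrite E; ring.
Qed.

(** The existence of a phase, so that the one picked by [phase] is one. *)
Lemma phase_correct (l : nat) (mu omega : R) (Phi Psi : C -> C) :
  (0 < omega)%R -> solution_pair l mu omega (Phi, Psi) ->
  is_phase omega Phi (phase omega Phi).
Proof.
  intros Hw [HR [_ [Hex [HM _]]]]; unfold phase; apply epsilon_spec.
  destruct (unimodular_cis _ HM) as [a Ha].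
  destruct (normalised_exists l mu omega a) as [x [y [Hn [X Y]]]].
  assert (H0 : Phi 1 * y 0 = x 0) by (rewrite X, Y; now apply cis_half_quotient).
  destruct (phase_lift l mu omega a x y Hw Hn) as [theta [Ct Et]].
  { rewrite X, Y; symmetry; now apply cis_half_quotient. }
  exists theta; split.
  - intros t _; eapply filterlim_filter_le_1; [|exact (Ct t)]; apply filter_le_within.
  - intros t Ht; rewrite Et; eapply arc_quotient; eassumption.
Qed.

(** The phase is only known to be continuous on a closed interval; composed with the
    retraction to that interval it is continuous on the line. *)
Definition clamp (h t : R) : R := Rmax (- h) (Rmin h t).

Lemma clamp_in (h t : R) : (0 <= h)%R -> (- h <= clamp h t <= h)%R.
Proof.
  intros H; unfold clamp; split; [apply Rmax_l|].
  apply Rmax_lub; [lra|apply Rmin_l].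
Qed.

Lemma clamp_id (h t : R) : (- h <= t <= h)%R -> clamp h t = t.
Proof. intros H; unfold clamp; rewrite Rmin_right, Rmax_right; lra. Qed.

Lemma clamp_lipschitz (h s t : R) : (Rabs (clamp h s - clamp h t) <= Rabs (s - t))%R.
Proof.
  unfold clamp, Rmax, Rmin, Rabs.
  destruct (Rle_dec h s), (Rle_dec h t); repeat destruct Rle_dec; repeat destruct Rcase_abs; lra.
Qed.

Lemma continuous_on_clamp (h : R) (f : R -> R) :
  (0 <= h)%R -> continuous_on (fun t : R => - h <= t <= h)%R f ->
  forall t, Rcont (fun s => RtoC (f (clamp h s))) t.
Proof.
  intros Hh Hf t eps He.
  assert (K := proj1 (filterlim_locally (U := R_UniformSpace) _ _)
    (Hf (clamp h t) (clamp_in h t Hh)) (mkposreal eps He)).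
  destruct K as [d Hd]; exists (pos d); split; [apply cond_pos|]; intros s Hs.
  rewrite <- RtoC_minus, Cmod_R.
  apply (Hd (clamp h s)); [|apply clamp_in, Hh].
  unfold ball; simpl; unfold AbsRing_ball, abs, minus, plus, opp; simpl.
  eapply Rle_lt_trans; [apply clamp_lipschitz|exact Hs].
Qed.

Lemma Rcont_closure (f g : R -> C) (h : R) :
  (0 < h)%R -> (forall t, Rcont f t) -> (forall t, Rcont g t) ->
  (forall t, (- h < t < h)%R -> f t = g t) ->
  forall t, (- h <= t <= h)%R -> f t = g t.
Proof.
  intros Hh Hf Hg E t Ht.
  destruct (Ceq_dec (f t) (g t)) as [Y|N]; [exact Y|exfalso].
  set (e := Cmod (f t - g t)).
  assert (He : (0 < e)%R) by (apply Cmod_pos, Cminus_neq, N).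
  destruct (Hf t (e / 2)%R ltac:(lra)) as [d1 [D1 K1]].
  destruct (Hg t (e / 2)%R ltac:(lra)) as [d2 [D2 K2]].
  set (d := Rmin (Rmin d1 d2) h).
  assert (Hd : (0 < d)%R) by (unfold d; repeat apply Rmin_glb_lt; lra).
  assert (L1 : (d <= d1)%R) by (unfold d; eapply Rle_trans; [apply Rmin_l|apply Rmin_l]).
  assert (L2 : (d <= d2)%R) by (unfold d; eapply Rle_trans; [apply Rmin_l|apply Rmin_r]).
  assert (L3 : (d <= h)%R) by apply Rmin_r.
  assert (Hs : exists s, (- h < s < h)%R /\ (Rabs (s - t) < d)%R).
  { destruct (Rle_dec 0 t).
    - exists (t - d / 2)%R; split; [lra|]; apply Rabs_def1; lra.
    - exists (t + d / 2)%R; split; [lra|]; apply Rabs_def1; lra. }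
  destruct Hs as [s [Hs1 Hs2]].
  specialize (K1 s ltac:(lra)); specialize (K2 s ltac:(lra)); rewrite (E s Hs1) in K1.
  assert (T := Cmod_triangle (- (g s - f t)) (g s - g t)).
  replace (- (g s - f t) + (g s - g t)) with (f t - g t) in T by ring.
  rewrite Cmod_opp in T; fold e in T; lra.
Qed.

Lemma Rcont_mult (f g : R -> C) (t : R) :
  Rcont f t -> Rcont g t -> Rcont (fun s => f s * g s) t.
Proof.
  intros Hf Hg eps He.
  assert (Ha := Cmod_ge_0 (f t)); assert (Hb := Cmod_ge_0 (g t)).
  set (e1 := (eps / (2 * (Cmod (g t) + 1)))%R).
  set (e2 := (eps / (2 * (Cmod (f t) + 1)))%R).
  assert (He1 : (0 < e1)%R) by (apply Rdiv_lt_0_compat; lra).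
  assert (He2 : (0 < e2)%R) by (apply Rdiv_lt_0_compat; lra).
  destruct (Hf e1 He1) as [d1 [D1 K1]].
  destruct (Hg (Rmin 1 e2) ltac:(apply Rmin_glb_lt; lra)) as [d2 [D2 K2]].
  exists (Rmin d1 d2); split; [now apply Rmin_glb_lt|]; intros s Hs.
  specialize (K1 s (Rlt_le_trans _ _ _ Hs (Rmin_l _ _))).
  specialize (K2 s (Rlt_le_trans _ _ _ Hs (Rmin_r _ _))).
  assert (K3 := Rlt_le_trans _ _ _ K2 (Rmin_l _ _)).
  assert (K4 := Rlt_le_trans _ _ _ K2 (Rmin_r _ _)).
  replace (f s * g s - f t * g t) with ((f s - f t) * g s + f t * (g s - g t)) by ring.
  eapply Rle_lt_trans; [apply Cmod_triangle|]; rewrite !Cmod_mult.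
  assert (Bg : (Cmod (g s) <= Cmod (g t) + 1)%R).
  { pose proof (Cmod_triangle (g s - g t) (g t)) as T.
    replace (g s - g t + g t) with (g s) in T by ring; lra. }
  assert (T1 : (Cmod (f s - f t) * Cmod (g s) < eps / 2)%R).
  { apply Rle_lt_trans with (Cmod (f s - f t) * (Cmod (g t) + 1))%R.
    - apply Rmult_le_compat_l; [apply Cmod_ge_0|exact Bg].
    - replace (eps / 2)%R with (e1 * (Cmod (g t) + 1))%R by (unfold e1; field; lra).
      apply Rmult_lt_compat_r; lra. }
  assert (T2 : (Cmod (f t) * Cmod (g s - g t) <= eps / 2)%R).
  { apply Rle_trans with ((Cmod (f t) + 1) * e2)%R.
    - apply Rmult_le_compat; try lra; apply Cmod_ge_0.
    - right; unfold e2; field; lra. }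
  lra.
Qed.

Lemma sign_constant (f : R -> C) (h : R) :
  (forall t, Rcont f t) -> (forall t, (- h <= t <= h)%R -> f t * f t = 1) ->
  f 0%R = 1 -> forall t, (- h <= t <= h)%R -> f t = 1.
Proof.
  intros Cf Hf H0 t Ht.
  assert (Sg : forall s, (- h <= s <= h)%R -> f s = 1 \/ f s = - (1)).
  { intros s Hs; specialize (Hf s Hs).
    destruct (Ceq_dec (f s - 1) 0) as [E|N].
    - left; replace (f s) with (f s - 1 + 1) by ring; rewrite E; ring.
    - right; apply (Cmult_reg_l (f s - 1)); [exact N|].
      replace ((f s - 1) * f s) with (f s * f s - f s) by ring; rewrite Hf; ring. }
  assert (Hin : forall s, (0 <= s <= 1)%R -> (- h <= s * t <= h)%R).
  { intros s Hs; destruct (Rle_dec 0 t); nra. }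
  replace t with (1 * t)%R by ring.
  apply (clopen_interval (fun s => f (s * t)%R = 1)); [|now rewrite Rmult_0_l].
  intros s Hs; destruct (Cf (s * t)%R 1%R ltac:(lra)) as [d [Hd K]].
  exists (d / (Rabs t + 1))%R; pose proof (Rabs_pos t) as Hp.
  split; [apply Rdiv_lt_0_compat; lra|].
  assert (K' : forall r, (Rabs (r - s) < d / (Rabs t + 1))%R ->
    (Cmod (f (r * t)%R - f (s * t)%R) < 1)%R).
  { intros r Hr; apply K; replace (r * t - s * t)%R with ((r - s) * t)%R by ring.
    rewrite Rabs_mult; apply Rlt_div_r in Hr; [|lra].
    pose proof (Rabs_pos (r - s)); nra. }
  assert (M2 : Cmod (1 - - (1)) = 2%R).
  { replace (1 - - (1)) with (RtoC 2) by (apply C_eq; simpl; ring).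
    rewrite Cmod_R; apply Rabs_pos_eq; lra. }
  destruct (Sg (s * t)%R (Hin s Hs)) as [E|E]; [left|right]; intros r Hr Hrs.
  - destruct (Sg (r * t)%R (Hin r Hr)) as [E'|E']; [exact E'|exfalso].
    specialize (K' r Hrs); rewrite E, E' in K'.
    replace (- (1) - 1) with (- (1 - - (1))) in K' by ring; rewrite Cmod_opp in K'; lra.
  - intros E'; specialize (K' r Hrs); rewrite E, E' in K'; lra.
Qed.

Lemma cis_neq_0 (a : R) : cis a <> 0.
Proof. rewrite <- Cexp_imag; apply Cexp_neq_0. Qed.

Lemma RtoC_neq_0 (a : R) : a <> 0%R -> RtoC a <> 0.
Proof. intros H E; apply RtoC_inj in E; auto. Qed.

(** On the unit circle |x|^2 = x y has logarithmic derivative Re (x / y) = cos phi, so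
    |x| = e^{P/2}; and x^2 / |x|^2 = x / y = e^{i phi}, so x has the phase phi/2 up to a
    sign, which is constant. *)
Lemma phase_polar (l : nat) (mu omega : R) (Phi : C -> C) (phi : R -> R) (x y : C -> C) :
  (0 < omega)%R -> solves_R l mu omega Phi -> ex_Cderive Phi 1 ->
  is_phase omega Phi phi -> normalised l mu omega x y ->
  x 0 = cis (phi 0 / 2) -> Phi 1 * y 0 = x 0 ->
  forall t, (- (period omega / 2) <= t <= period omega / 2)%R ->
    x (arc omega t) = RtoC (exp (Pint phi t / 2)) * cis (phi t / 2).
Proof.
  intros Hw HR Hex [Hc Hphi] Hn X0 H0.
  set (h := (period omega / 2)%R) in *.
  assert (Hh : (0 < h)%R).
  { unfold h; rewrite half_period by exact Hw; apply Rdiv_lt_0_compat; [apply PI_RGT_0|exact Hw]. }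
  assert (NZ := fun t => normalised_arc_neq_0 _ _ _ _ _ t Hw Hn).
  assert (CJ := fun t => normalised_arc_conj _ _ _ _ _ t Hw Hn).
  assert (H := proj1 Hn).
  set (u := fun t => x (arc omega t) / y (arc omega t)).
  assert (Cu : forall t, Rcont u t).
  { intros t; destruct (NZ t) as [Nx Ny]; destruct (H (arc omega t)) as [X Y].
    apply (Rcont_arc (fun z => x z / y z)); eapply is_Cderive_Ccont, is_Cderive_div; eassumption. }
  assert (Cphi := continuous_on_clamp h phi (Rlt_le _ _ Hh) Hc).
  assert (Ccis : forall a t, Rcont (fun s => Cexp (a * RtoC (phi (clamp h s)))) t).
  { intros a t; apply (Rcont_comp (fun v => Cexp (a * v)) (fun s => RtoC (phi (clamp h s)))).
    - eapply is_Cderive_Ccont, is_Cderive_Cexp_comp, is_Cderive_mult;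
        [apply is_Cderive_const|apply is_Cderive_id].
    - apply Cphi. }
  assert (Eu : forall t, (- h <= t <= h)%R -> cis (phi t) = u t).
  { intros t Ht.
    assert (E := Rcont_closure _ _ h Hh (Ccis Ci) Cu); cbv beta in E.
    rewrite <- E; [now rewrite clamp_id, Cexp_imag by exact Ht| |exact Ht].
    intros s Hs; rewrite clamp_id, Cexp_imag by lra.
    rewrite <- (Hphi s Hs); eapply arc_quotient; eassumption. }
  set (N := fun t => Re (x (arc omega t) * y (arc omega t))).
  assert (HN : forall t, RtoC (N t) = x (arc omega t) * y (arc omega t)).
  { intros t; unfold N; rewrite (CJ t); destruct (x (arc omega t)); apply C_eq; simpl; ring. }
  assert (PN : forall t, (0 < N t)%R).
  { intros t; unfold N; rewrite (CJ t), <- Cmod2_conj; simpl.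
    pose proof (Cmod_pos _ (proj1 (NZ t))); nra. }
  assert (N0 : N 0%R = 1%R).
  { unfold N; rewrite arc_0, (proj2 (proj2 Hn)), normalised_mult by apply Hn; reflexivity. }
  assert (DN : forall t, is_derive N t (Re (u t) * N t)%R).
  { intros t; destruct (NZ t) as [Nx Ny]; destruct (H (arc omega t)) as [X Y].
    assert (D := is_Rderive_Re _ _ _ (is_Rderive_arc _ _ _ _ (is_Cderive_mult _ _ _ _ _ X Y))).
    evar_last; [exact D|].
    transitivity (Re (u t * RtoC (N t))); [|unfold u; simpl; ring].
    rewrite HN; unfold u.
    replace (x (arc omega t) / y (arc omega t) * (x (arc omega t) * y (arc omega t)))
      with (x (arc omega t) * x (arc omega t)) by (field; exact Ny).
    replace (((half_q l mu (arc omega t) * x (arc omega t) + coupling omega * y (arc omega t)) *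
       y (arc omega t) + x (arc omega t) *
       (coupling omega * x (arc omega t) - half_q l mu (arc omega t) * y (arc omega t)))
       * (Ci * omega)) with
      ((x (arc omega t) * x (arc omega t) + y (arc omega t) * y (arc omega t)) / 2).
    2:{ unfold coupling; field; split; [apply RtoC_neq_0; lra|apply Ci_nz]. }
    rewrite (CJ t); destruct (x (arc omega t)) as [a b]; unfold Cdiv.
    replace (/ 2) with (RtoC (/ 2)) by (rewrite RtoC_inv by lra; reflexivity).
    simpl; field. }
  assert (HP : forall t, (- h <= t <= h)%R -> Pint phi t = ln (N t)).
  { intros t Ht; unfold Pint.
    transitivity (RInt (fun s => Re (u s)) 0 t).
    - apply RInt_ext; intros s Hs.
      assert (Hs' : (- h <= s <= h)%R).
      { unfold Rmin, Rmax in Hs; destruct (Rle_dec 0 t); lra. }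
      rewrite <- (Eu s Hs'); reflexivity.
    - apply is_RInt_unique; replace (ln (N t)) with (minus (ln (N t)) (ln (N 0%R))).
      2:{ rewrite N0, ln_1; unfold minus, plus, opp; simpl; ring. }
      apply (is_RInt_derive (V := R_CompleteNormedModule) (fun s => ln (N s))).
      + intros s _; evar_last.
        * apply (is_derive_comp (V := R_NormedModule) ln N); [|apply DN].
          apply is_derive_Reals, derivable_pt_lim_ln, PN.
        * change ((Re (u s) * N s) * / N s = Re (u s))%R; field; apply Rgt_not_eq, PN.
      + intros s _; apply Rcont_continuous_Re, Cu. }
  (* The sign: x divided by its candidate polar form. *)
  set (sg := fun t => x (arc omega t) * Cexp (- Ci / 2 * RtoC (phi (clamp h t)))
     * RtoC (/ sqrt (N t))).
  assert (Csq : forall t, (0 < sqrt (N t))%R) by (intros; apply sqrt_lt_R0, PN).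
  assert (Csg : forall t, Rcont sg t).
  { intros t; apply Rcont_mult; [apply Rcont_mult; [|apply Ccis]|].
    - apply Rcont_arc; eapply is_Cderive_Ccont, H.
    - assert (Cn : continuous (fun s => / sqrt (N s))%R t).
      { apply (continuous_comp (fun s => sqrt (N s)) Rinv).
        - apply (continuous_comp N sqrt); [|apply continuous_sqrt].
          apply (ex_derive_continuous N); eexists; apply DN.
        - apply continuous_Rinv, Rgt_not_eq, Csq. }
      intros eps He.
      destruct (proj1 (filterlim_locally (U := R_UniformSpace) _ _) Cn (mkposreal eps He))
        as [d Hd].
      exists (pos d); split; [apply cond_pos|]; intros s Hs.
      rewrite <- RtoC_minus, Cmod_R; exact (Hd s Hs). }
  assert (Ecis : forall a : R, Cexp (- Ci / 2 * RtoC a) = / cis (a / 2)).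
  { intros a; replace (- Ci / 2 * RtoC a) with (- (Ci * RtoC (a / 2)))
      by (rewrite RtoC_div by lra; field).
    rewrite Cexp_opp, Cexp_imag; reflexivity. }
  assert (Sq : forall t, RtoC (sqrt (N t)) * RtoC (sqrt (N t)) = x (arc omega t) * y (arc omega t)).
  { intros t; rewrite <- RtoC_mult, sqrt_sqrt by (apply Rlt_le, PN); apply HN. }
  assert (Nsq : forall t, RtoC (sqrt (N t)) <> 0)
    by (intros t; apply RtoC_neq_0, Rgt_not_eq, Csq).
  assert (Esg : forall t, (- h <= t <= h)%R -> sg t = 1).
  { apply sign_constant; [exact Csg| |].
    - intros t Ht; destruct (NZ t) as [Nx Ny].
      unfold sg; rewrite clamp_id, Ecis, RtoC_inv by (auto; apply Rgt_not_eq, Csq).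
      assert (E2 := cis_double (phi t)); rewrite (Eu t Ht) in E2; unfold u in E2.
      transitivity (x (arc omega t) * x (arc omega t) / (cis (phi t / 2) * cis (phi t / 2))
        / (RtoC (sqrt (N t)) * RtoC (sqrt (N t)))).
      + field; split; solve [apply Nsq|apply cis_neq_0].
      + rewrite E2, Sq; field; auto.
    - unfold sg; rewrite N0, sqrt_1, arc_0, clamp_id, X0, Ecis by lra.
      rewrite RtoC_inv by lra; field; apply cis_neq_0. }
  intros t Ht; rewrite (HP t Ht).
  assert (Eexp : exp (ln (N t) / 2) = sqrt (N t)).
  { apply Rsqr_inj; [apply Rlt_le, exp_pos|apply Rlt_le, Csq|].
    rewrite Rsqr_sqrt by (apply Rlt_le, PN); unfold Rsqr; rewrite <- exp_plus.
    replace (ln (N t) / 2 + ln (N t) / 2)%R with (ln (N t)) by field; apply exp_ln, PN. }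
  rewrite Eexp.
  assert (E := Esg t Ht); unfold sg in E; rewrite clamp_id, Ecis, RtoC_inv in E
    by (auto; apply Rgt_not_eq, Csq).
  transitivity (x (arc omega t) * / cis (phi t / 2) * / RtoC (sqrt (N t))
    * (RtoC (sqrt (N t)) * cis (phi t / 2))).
  - field; split; solve [apply Nsq|apply cis_neq_0].
  - rewrite E; ring.
Qed.

(** * The branches of the square roots *)

Lemma unit_square_derivative (f : C -> C) (z d : C) :
  near z (fun w => f w * f w = 1) -> is_Cderive f z d -> d = 0.
Proof.
  intros H D; assert (E := near_point _ _ H); cbv beta in E.
  assert (D2 := is_Cderive_mult _ _ _ _ _ D D).
  assert (D1 : is_Cderive (fun w => f w * f w) z 0).
  { apply (is_Cderive_near (fun _ => 1)); [|apply is_Cderive_const].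
    eapply near_mono; [exact H|]; intros w Hw; now rewrite Hw. }
  assert (K := eq_trans (eq_sym (is_Cderive_unique _ _ _ D2)) (is_Cderive_unique _ _ _ D1)).
  replace d with ((d * f z + f z * d) * f z / 2) by
    (transitivity (d * (f z * f z)); [field|rewrite E; ring]).
  rewrite K; field.
Qed.

(** The ratio is a holomorphic function with square 1 off the zeros. *)
Lemma root_unique (l : nat) (mu omega : R) (x y g X : C -> C) :
  (0 < omega)%R -> linsol l mu omega x y -> x 0 <> 0 -> y 0 <> 0 ->
  (forall z, exists d, is_Cderive g z d) ->
  (forall z, x z <> 0 -> y z <> 0 -> g z <> 0) ->
  (forall z, slit z -> ex_Cderive X z) ->
  (forall z, strip z -> x z <> 0 -> y z <> 0 -> X (Cexp z) ^ 2 = g z * g z) ->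
  X 1 = g 0 -> forall z, slit z -> X z = g (Clog z).
Proof.
  intros Hw H Nx Ny Dg Ng DX Sq H1.
  set (Good := fun w => strip w /\ x w <> 0 /\ y w <> 0).
  assert (NearGood : forall w, Good w -> near w Good).
  { intros w [Sw [Xw Yw]]; destruct (H w) as [X' Y']; apply near_and; [now apply strip_near|].
    apply near_and; apply Ccont_near_neq; auto; eapply is_Cderive_Ccont; eassumption. }
  assert (PGood : forall w, strip w -> pnear w Good).
  { intros w Sw; apply pnear_and; [apply near_pnear, strip_near, Sw|].
    exact (linsol_zeros_isolated _ _ _ _ _ w Hw H Nx). }
  assert (G0 : Good 0) by (split; [apply strip_0|now split]).
  assert (DXe : forall w, strip w -> exists d, is_Cderive (fun t => X (Cexp t)) w d).
  { intros w Sw; destruct (DX _ (slit_Cexp _ Sw)) as [d Hd]; eexists.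
    apply (is_Cderive_comp X Cexp); [exact Hd|apply is_Cderive_Cexp]. }
  assert (Sq1 : forall w, Good w -> X (Cexp w) / g w * (X (Cexp w) / g w) = 1).
  { intros w [Sw [Xw Yw]]; assert (E := Sq w Sw Xw Yw).
    assert (Gw := Ng w Xw Yw).
    transitivity (X (Cexp w) ^ 2 / (g w * g w)); [simpl; field; exact Gw|].
    rewrite E; field; exact Gw. }
  assert (Rig : forall w, strip w -> Good w -> X (Cexp w) / g w = X (Cexp 0) / g 0).
  { apply (rigidity (fun w => X (Cexp w) / g w) Good); [|exact PGood|apply NearGood, G0].
    intros w Gw; destruct (DXe w (proj1 Gw)) as [d Hd]; destruct (Dg w) as [d' Hd'].
    assert (D := is_Cderive_div _ _ _ _ _ Hd Hd' (Ng w (proj1 (proj2 Gw)) (proj2 (proj2 Gw)))).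
    eapply is_Cderive_eq; [exact D|].
    apply (unit_square_derivative (fun w => X (Cexp w) / g w) w); [|exact D].
    eapply near_mono; [exact (NearGood w Gw)|exact Sq1]. }
  assert (Eq : forall w, Good w -> X (Cexp w) = g w).
  { intros w Gw; assert (E := Rig w (proj1 Gw) Gw).
    assert (Gg := Ng w (proj1 (proj2 Gw)) (proj2 (proj2 Gw))).
    assert (G0' := Ng 0 Nx Ny).
    rewrite Cexp_0, H1 in E.
    replace (X (Cexp w)) with (X (Cexp w) / g w * g w) by (field; exact Gg).
    rewrite E; field; exact G0'. }
  intros z Sz; rewrite <- (Cexp_Clog z Sz) at 1.
  set (w := Clog z); assert (Sw : strip w) by apply Clog_strip.
  apply (Ccont_unique_lim (fun t => X (Cexp t)) g).
  - destruct (DXe w Sw) as [d Hd]; exact (is_Cderive_Ccont _ _ _ Hd).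
  - destruct (Dg w) as [d Hd]; exact (is_Cderive_Ccont _ _ _ Hd).
  - eapply pnear_mono; [exact (PGood w Sw)|]; intros t _; apply Eq.
Qed.

Lemma half_period_pos (omega : R) : (0 < omega)%R -> (0 < period omega / 2)%R.
Proof.
  intros H; rewrite half_period by exact H; apply Rdiv_lt_0_compat; [apply PI_RGT_0|exact H].
Qed.

Lemma Clog_cis (omega t : R) :
  (0 < omega)%R -> (- (period omega / 2) < t < period omega / 2)%R ->
  slit (cis (omega * t)) /\ Clog (cis (omega * t)) = arc omega t.
Proof.
  intros Hw Ht; rewrite <- Cexp_arc; assert (S := strip_arc _ _ Hw Ht).
  split; [now apply slit_Cexp|now apply Clog_Cexp].
Qed.

Lemma arc_half_period (omega : R) : (0 < omega)%R -> arc omega (period omega / 2) = Ci * PI.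
Proof.
  intros H; unfold arc; rewrite half_period by exact H.
  do 2 f_equal; field; lra.
Qed.

Lemma arc_half_period_opp (omega : R) :
  (0 < omega)%R -> arc omega (- (period omega / 2)) = - (Ci * PI).
Proof.
  intros H; rewrite <- (arc_half_period omega H); unfold arc.
  rewrite Ropp_mult_distr_r_reverse, RtoC_opp; ring.
Qed.

(** Everything that the transformation B reads from a pair, in terms of the solution of
    the linear system that the pair determines. *)
Lemma normal_form (l : nat) (mu omega : R) (Phi Psi : C -> C) :
  (0 < omega)%R -> solution_pair l mu omega (Phi, Psi) ->
  let phi := phase omega Phi in let h := (period omega / 2)%R in
  exists x y : C -> C,
    normalised l mu omega x y
    /\ x 0 = cis (phi 0 / 2) /\ y 0 = cis (- phi 0 / 2) /\ Phi 1 * y 0 = x 0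
    /\ (forall z, slit z -> root_plus omega Phi Psi z = x (Clog z))
    /\ (forall z, slit z -> root_minus omega Phi Psi z = y (Clog z))
    /\ x (Ci * PI) = RtoC (exp (Pint phi h / 2)) * cis (phi h / 2)
    /\ y (Ci * PI) = RtoC (exp (Pint phi h / 2)) * cis (- phi h / 2)
    /\ x (- (Ci * PI)) = RtoC (exp (Pint phi (- h) / 2)) * cis (phi (- h)%R / 2)
    /\ y (- (Ci * PI)) = RtoC (exp (Pint phi (- h) / 2)) * cis (- phi (- h)%R / 2).
Proof.
  intros Hw Hsol phi h.
  assert (Hph := phase_correct _ _ _ _ _ Hw Hsol); fold phi in Hph.
  destruct Hsol as [HR [HL [Hex [HM HP]]]].
  destruct (normalised_exists l mu omega (phi 0)) as [x [y [Hn [X0 Y0]]]].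
  assert (Hh : (0 < h)%R) by now apply half_period_pos.
  assert (P1 : Phi 1 = cis (phi 0%R)).
  { rewrite <- (proj2 Hph 0%R) by (unfold h in Hh; lra).
    rewrite Rmult_0_r, cis_0; reflexivity. }
  assert (H0 : Phi 1 * y 0 = x 0) by (rewrite X0, Y0; now apply cis_half_quotient).
  assert (H := proj1 Hn).
  assert (Nx0 : x 0 <> 0) by (rewrite X0; apply cis_neq_0).
  assert (Ny0 : y 0 <> 0) by (rewrite Y0; apply cis_neq_0).
  assert (Hxy : x 0 * y 0 = 1) by (rewrite X0, Y0, Cmult_comm; apply cis_half_inv).
  assert (Pol := phase_polar l mu omega Phi phi x y Hw HR Hex Hph Hn X0 H0).
  assert (PolY : forall t, (- h <= t <= h)%R ->
    y (arc omega t) = RtoC (exp (Pint phi t / 2)) * cis (- phi t / 2)).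
  { intros t Ht; rewrite (normalised_arc_conj _ _ _ _ _ t Hw Hn), Pol by exact Ht.
    rewrite Cmult_conj, RtoC_conj, <- cis_opp; do 2 f_equal; field. }
  assert (Q := solves_R_quotient _ _ _ _ _ _ Hw HR Hex H Nx0 H0).
  assert (L := solves_L_product _ _ _ _ _ _ _ Hw HR Hex HL HP H Hxy H0).
  assert (Reg : forall z, slit z -> ex_Cderive Phi z ->
    y (Clog z) <> 0 /\ Phi z = x (Clog z) / y (Clog z)).
  { intros z Sz [d Hd].
    destruct (Q (Clog z) (Clog_strip z)) as [[A [_ B]]|[_ B]].
    - rewrite Cexp_Clog in B by exact Sz; now split.
    - exfalso; rewrite <- (Cexp_Clog z Sz) in Hd.
      assert (Cn := is_Cderive_Ccont _ _ _ (is_Cderive_comp Phi Cexp _ _ _ Hd (is_Cderive_Cexp _))).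
      exact (blows_up_not_bounded _ _ _ B (near_pnear _ _ (Ccont_bounded _ _ Cn))). }
  assert (RegE : forall z, strip z -> x z <> 0 -> y z <> 0 ->
    ex_Cderive Phi (Cexp z) /\ Phi (Cexp z) = x z / y z /\ Phi (Cexp z) <> 0
    /\ Psi (Cexp z) = x z * y z).
  { intros z Sz Nx Ny; destruct (Q z Sz) as [[_ [A B]]|[A _]]; [|contradiction].
    split; [exact (ex_intro (fun d => is_Cderive Phi (Cexp z) d) _ A)|].
    split; [exact B|]; split; [|now apply L].
    rewrite B; intros E; apply Nx; replace (x z) with (x z / y z * y z) by (field; exact Ny).
    rewrite E; ring. }
  assert (RegL : forall z, slit z -> ex_Cderive Phi z -> Phi z <> 0 ->
    x (Clog z) <> 0 /\ y (Clog z) <> 0 /\ Phi z = x (Clog z) / y (Clog z)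
    /\ Psi z = x (Clog z) * y (Clog z)).
  { intros z Sz Hd Np; destruct (Reg z Sz Hd) as [Ny E].
    assert (Nx : x (Clog z) <> 0).
    { intros E0; apply Np; rewrite E, E0; field; exact Ny. }
    repeat split; auto; rewrite <- (Cexp_Clog z Sz) at 1; apply L; auto using Clog_strip. }
  assert (Dx : forall z, exists d, is_Cderive x z d) by (intros z; eexists; apply H).
  assert (Dy : forall z, exists d, is_Cderive y z d) by (intros z; eexists; apply H).
  assert (DLog : forall g : C -> C, (forall z, exists d, is_Cderive g z d) ->
    forall z, slit z -> ex_Cderive (fun w => g (Clog w)) z).
  { intros g Dg z Sz; destruct (Dg (Clog z)) as [d Hd]; eexists.
    apply (is_Cderive_comp g Clog); [exact Hd|now apply is_Cderive_Clog]. }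
  assert (Bp : is_root_branch omega Phi Psi phi Phi phi (fun z => x (Clog z))).
  { split; [apply DLog, Dx|]; split.
    - intros z Sz Hd Np; destruct (RegL z Sz Hd Np) as [Nx [Ny [E1 E2]]].
      rewrite E1, E2; simpl; field; exact Ny.
    - intros t Ht; rewrite (proj2 (Clog_cis _ _ Hw Ht)); apply Pol; lra. }
  assert (Bm : is_root_branch omega Phi Psi phi (fun z => / Phi z) (fun t => (- phi t)%R)
    (fun z => y (Clog z))).
  { split; [apply DLog, Dy|]; split.
    - intros z Sz Hd Np; destruct (RegL z Sz Hd Np) as [Nx [Ny [E1 E2]]].
      rewrite E1, E2; simpl; field; split; assumption.
    - intros t Ht; rewrite (proj2 (Clog_cis _ _ Hw Ht)); apply PolY; fold h in Ht; lra. }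
  assert (Pt0 : Pint phi 0 = 0%R).
  { unfold Pint; apply (RInt_point (V := R_CompleteNormedModule)). }
  assert (At1 : forall X (theta : R -> R) F, is_root_branch omega Phi Psi phi F theta X ->
    X 1 = cis (theta 0 / 2)).
  { intros X theta F [_ [_ E]]; specialize (E 0%R ltac:(fold h; lra)).
    rewrite Rmult_0_r, cis_0, Pt0 in E; rewrite E.
    replace (0 / 2)%R with 0%R by field; rewrite exp_0; ring. }
  assert (Rp : forall z, slit z -> root_plus omega Phi Psi z = x (Clog z)).
  { assert (B := epsilon_spec (inhabits (fun _ : C => RtoC 0)) _ (ex_intro _ _ Bp)).
    change (epsilon _ _) with (root_plus omega Phi Psi) in B.
    apply (root_unique l mu omega x y x); auto.
    - apply B.
    - intros z Sz Nx Ny; destruct (RegE z Sz Nx Ny) as [A1 [A2 [A3 A4]]].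
      rewrite (proj1 (proj2 B)) by (auto using slit_Cexp).
      rewrite A4, A2; field; exact Ny.
    - rewrite (At1 _ _ _ B), X0; reflexivity. }
  assert (Rm : forall z, slit z -> root_minus omega Phi Psi z = y (Clog z)).
  { assert (B := epsilon_spec (inhabits (fun _ : C => RtoC 0)) _ (ex_intro _ _ Bm)).
    change (epsilon _ _) with (root_minus omega Phi Psi) in B.
    apply (root_unique l mu omega x y y); auto.
    - apply B.
    - intros z Sz Nx Ny; destruct (RegE z Sz Nx Ny) as [A1 [A2 [A3 A4]]].
      rewrite (proj1 (proj2 B)) by (auto using slit_Cexp).
      rewrite A4, A2; field; split; assumption.
    - rewrite (At1 _ _ _ B), Y0; reflexivity. }
  exists x, y; repeat split; auto; try apply Hn.
  - rewrite <- (arc_half_period _ Hw); apply Pol; fold h; lra.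
  - rewrite <- (arc_half_period _ Hw); apply PolY; fold h; lra.
  - rewrite <- (arc_half_period_opp _ Hw); apply Pol; fold h; lra.
  - rewrite <- (arc_half_period_opp _ Hw); apply PolY; fold h; lra.
Qed.

(** * Solutions of the linear system give pairs *)

(** At the poles of Phi_B the quotient is 0 by convention. *)
Lemma Cinv_0 : / RtoC 0 = 0.
Proof. apply C_eq; unfold Cinv; simpl; unfold Rdiv; ring. Qed.

Lemma Cdiv_0_r (a : C) : a / 0 = 0.
Proof. unfold Cdiv; rewrite Cinv_0; ring. Qed.

Lemma quotient_blows_up (f n d : C -> C) (z : C) :
  Ccont n z -> Ccont d z -> n z <> 0 -> d z = 0 ->
  pnear z (fun w => d w <> 0 /\ f w = n w / d w) -> blows_up f z.
Proof.
  intros Cn Cd Nn Ed Hp M.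
  assert (Hm := Cmod_pos _ Nn).
  set (e := (Cmod (n z) / 2 / (Rabs M + 1))%R).
  assert (HM := Rabs_pos M).
  assert (He : (0 < e)%R) by (unfold e; repeat apply Rdiv_lt_0_compat; lra).
  eapply pnear_mono; [exact (pnear_and _ _ _ Hp (near_pnear _ _
    (near_and _ _ _ (Cn (Cmod (n z) / 2)%R ltac:(lra)) (Cd e He))))|].
  intros w _ [[Nd E] [Bn Bd]]; rewrite E, Cmod_div by exact Nd.
  rewrite Ed in Bd; replace (d w - 0) with (d w) in Bd by ring.
  assert (Hd := Cmod_pos _ Nd).
  assert (Hn : (Cmod (n z) / 2 < Cmod (n w))%R).
  { pose proof (Cmod_triangle (- (n w - n z)) (n w)) as T.
    replace (- (n w - n z) + n w) with (n z) in T by ring.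
    rewrite Cmod_opp in T; lra. }
  apply Rle_lt_trans with (Rabs M); [apply Rle_abs|].
  apply Rlt_div_r; [exact Hd|].
  assert (T : (Rabs M * Cmod (d w) <= Rabs M * e)%R) by (apply Rmult_le_compat_l; lra).
  assert (T2 : ((Rabs M + 1) * e = Cmod (n z) / 2)%R) by (unfold e; field; lra).
  lra.
Qed.

Lemma pnear_Clog (z : C) (P : C -> Prop) :
  slit z -> pnear (Clog z) P -> pnear z (fun w => P (Clog w)).
Proof.
  intros Sz [d [Hd K]].
  eapply pnear_mono; [exact (near_pnear _ _ (near_and _ _ _ (slit_near z Sz)
    (Clog_cont z Sz d Hd)))|].
  intros w Hn [Sw Hw]; apply K; [|exact Hw].
  intros E; apply Hn; rewrite <- (Cexp_Clog w Sw), <- (Cexp_Clog z Sz), E; reflexivity.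
Qed.

Lemma near_Clog (z : C) (P : C -> Prop) :
  slit z -> near (Clog z) P -> near z (fun w => slit w /\ P (Clog w)).
Proof.
  intros Sz [d [Hd K]]; eapply near_mono;
    [exact (near_and _ _ _ (slit_near z Sz) (Clog_cont z Sz d Hd))|].
  intros w [Sw Hw]; split; [exact Sw|now apply K].
Qed.

(** The converse of [normal_form]. *)
Lemma linsol_solution_pair (l : nat) (mu omega : R) (n d Phi Psi : C -> C) :
  (0 < omega)%R -> linsol l mu omega n d -> n 0 <> 0 -> Cmod (n 0) = Cmod (d 0) ->
  (forall z, slit z -> Phi z = n (Clog z) / d (Clog z)) ->
  (forall z, slit z -> n (Clog z) <> 0 -> d (Clog z) <> 0 ->
     Psi z = n (Clog z) * d (Clog z) / (n 0 * d 0)) ->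
  solution_pair l mu omega (Phi, Psi).
Proof.
  intros Hw H Nn0 Hm HPhi HPsi.
  assert (Nd0 : d 0 <> 0) by (apply Cmod_gt_0; rewrite <- Hm; now apply Cmod_gt_0).
  assert (S1 : slit 1) by (rewrite <- Cexp_0; apply slit_Cexp, strip_0).
  assert (Nw : RtoC omega <> 0) by (apply RtoC_neq_0; lra).
  assert (Cn : forall z, Ccont n z) by (intros z; eapply is_Cderive_Ccont, H).
  assert (Cd : forall z, Ccont d z) by (intros z; eapply is_Cderive_Ccont, H).
  assert (Sat : forall z, slit z -> d (Clog z) <> 0 -> satisfies_R_at l mu omega Phi z).
  { intros z Sz Nd; assert (Nz := slit_neq_0 z Sz).
    destruct (H (Clog z)) as [N' D'].
    unfold satisfies_R_at; rewrite HPhi by exact Sz.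
    apply (is_Cderive_near (fun w => n (Clog w) / d (Clog w))).
    { eapply near_mono; [exact (slit_near z Sz)|]; intros w Sw; now rewrite HPhi. }
    eapply is_Cderive_eq.
    - apply (is_Cderive_comp (fun w => n w / d w) Clog); [|now apply is_Cderive_Clog].
      apply is_Cderive_div; eassumption.
    - unfold half_q, coupling; rewrite Cexp_opp, Cexp_Clog by exact Sz.
      simpl; field; repeat split; auto using Ci_nz. }
  split; [|split; [|split; [|split]]].
  - intros z Sz; destruct (Ceq_dec (d (Clog z)) 0) as [E|N]; [right|left; now apply Sat].
    assert (Pd : pnear z (fun w => slit w /\ d (Clog w) <> 0)).
    { apply pnear_and; [apply near_pnear, slit_near, Sz|].
      apply (pnear_Clog z (fun v => d v <> 0) Sz).
      eapply pnear_mono; [exact (linsol_zeros_isolated _ _ _ _ _ _ Hw H Nn0)|].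
      intros w _ [_ A]; exact A. }
    split.
    + apply pnear_locally'; eapply pnear_mono; [exact Pd|].
      intros w _ [Sw Nd]; now apply Sat.
    + apply pole_blows_up, (quotient_blows_up _ (fun w => n (Clog w)) (fun w => d (Clog w))).
      * eapply is_Cderive_Ccont, (is_Cderive_comp n Clog); [apply H|now apply is_Cderive_Clog].
      * eapply is_Cderive_Ccont, (is_Cderive_comp d Clog); [apply H|now apply is_Cderive_Clog].
      * intros E'; exact (linsol_not_both_0 _ _ _ _ _ 0 _ H Nn0 E' E).
      * exact E.
      * eapply pnear_mono; [exact Pd|]; intros w _ [Sw Nd]; split; [exact Nd|now apply HPhi].
  - intros z Sz _ NP; assert (Nz := slit_neq_0 z Sz).
    rewrite HPhi in * by exact Sz.
    assert (Nd : d (Clog z) <> 0) by (intros E; apply NP; rewrite E; apply Cdiv_0_r).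
    assert (Nn : n (Clog z) <> 0).
    { intros E; apply NP; rewrite E; field; exact Nd. }
    rewrite HPsi by assumption.
    apply (is_Cderive_near (fun w => n (Clog w) * d (Clog w) / (n 0 * d 0))).
    { eapply near_mono; [exact (near_Clog z _ Sz (near_and _ _ _
        (Ccont_near_neq _ _ 0 (Cn (Clog z)) Nn) (Ccont_near_neq _ _ 0 (Cd (Clog z)) Nd)))|].
      intros w [Sw [A B]]; now rewrite HPsi. }
    destruct (H (Clog z)) as [N' D'].
    eapply is_Cderive_eq.
    + apply (is_Cderive_comp (fun w => n w * d w / (n 0 * d 0)) Clog);
        [|now apply is_Cderive_Clog].
      apply is_Cderive_div; [apply is_Cderive_mult; eassumption|
        apply (is_Cderive_const (n 0 * d 0))|now apply Cmult_neq_0].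
    + unfold coupling; field; repeat split; auto using Ci_nz.
  - eexists; apply (Sat 1 S1); now rewrite Clog_1.
  - rewrite HPhi, Clog_1, Cmod_div, Hm by auto.
    field; apply Rgt_not_eq; now apply Cmod_gt_0.
  - rewrite HPsi, Clog_1 by (rewrite ?Clog_1; auto); field; split; assumption.
Qed.

(** * The transformation B is the half turn *)

Definition turned_x (l : nat) (mu : R) (y : C -> C) : C -> C := half_turn (climb_x l mu y).
Definition turned_y (l : nat) (mu : R) (x : C -> C) : C -> C := half_turn (climb_y l mu x).

(** The reflection in the unit circle fixes both (x, y) and the point e^{i pi} of the
    universal cover. *)
Lemma turned_y_0 (l : nat) (mu omega : R) (x y : C -> C) :
  (0 < omega)%R -> normalised l mu omega x y ->
  turned_y l mu x 0 = (- (1)) ^ l * Cconj (turned_x l mu y 0).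
Proof.
  intros Hw [H [M E]]; destruct (linsol_smooth _ _ _ _ _ H) as [Sx Sy].
  assert (Ex : x = reflect y).
  { apply functional_extensionality; intros z; unfold reflect.
    rewrite (linsol_conj _ _ _ _ _ Hw H E); unfold reflect.
    rewrite Copp_conj, !Cconj_conj; f_equal; ring. }
  unfold turned_y, turned_x, half_turn.
  rewrite Ex, climb_y_reflect by exact Sy; unfold reflect.
  do 4 f_equal; apply C_eq; simpl; ring.
Qed.

(** The half turn is injective, as its matrix has a determinant proportional to
    D_+ D_-; and the two components have the same modulus at 1. *)
Lemma turned_neq_0 (l : nat) (mu omega : R) (x y : C -> C) :
  (0 < omega)%R -> normalised l mu omega x y ->
  D_plus l mu omega <> 0 -> D_minus l mu omega <> 0 ->
  turned_x l mu y 0 <> 0 /\ turned_y l mu x 0 <> 0.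
Proof.
  intros Hw Hn HDp HDm; assert (H := proj1 Hn).
  assert (Hc := coupling_neq_0 _ Hw).
  assert (Ey := turned_y_0 _ _ _ _ _ Hw Hn).
  assert (Nx : turned_x l mu y 0 <> 0).
  { intros E; rewrite E, RtoC_conj in Ey.
    destruct (half_turn_at_1 _ _ _ _ _ Hw H) as [A B].
    fold (turned_x l mu y) in A; fold (turned_y l mu x) in B.
    rewrite Ey in B; rewrite E in A.
    assert (Nd : turn_scalar l mu omega <> 0).
    { rewrite turn_scalar_D by exact Hw; now repeat apply Cmult_neq_0. }
    assert (Ny := proj2 (normalised_arc_neq_0 _ _ _ _ _ (period omega / 2) Hw Hn)).
    rewrite arc_half_period in Ny by exact Hw; apply Ny.
    replace (y (Ci * PI)) with (half_turn y 0) by (unfold half_turn; f_equal; ring).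
    apply (Cmult_reg_l (turn_scalar l mu omega)); [exact Nd|].
    unfold turn_scalar.
    set (p := poly_p l mu omega l 1) in *; set (r := poly_r l mu omega l 1) in *.
    set (c := coupling omega) in *; set (s := (- (1)) ^ l) in *.
    transitivity (r * (r * half_turn y 0 - s * c * p * half_turn x 0)
      + c * p * (s * r * half_turn x 0 + c * p * half_turn y 0)); [ring|].
    rewrite <- A, <- B; ring. }
  split; [exact Nx|]; rewrite Ey.
  apply Cmult_neq_0.
  - apply Cpow_nz; intros E; apply C1_nz; replace (RtoC 1) with (- - (1)) by ring; rewrite E; ring.
  - apply Cmod_gt_0; rewrite Cmod_conj; now apply Cmod_gt_0.
Qed.

(** The constants a and b as Wronskians of the half turn (tx, ty) with the solution and its
    mirror image.  Here k = c p_l(1), r = r_l(1), s = (-1)^l, and X, Y and X', Y' stand for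
    the values of the solution at e^{i pi} and e^{-i pi}.  The hypothesis on
    x0 * ty - y0 * tx is the constancy of a Wronskian between 1 and e^{-i pi}; it makes
    the two halves of b equal. *)
Lemma B_coefficients (omega : R) (x0 y0 X Y X' Y' k r s tx ty : C) :
  (0 < omega)%R -> s * s = 1 -> x0 * y0 = 1 ->
  tx = r * Y - s * k * X -> ty = s * r * X + k * Y ->
  x0 * ty - y0 * tx = X' * (r * x0 + k * y0) - Y' * (s * (r * y0 - k * x0)) ->
  let Dp := 2 * Ci * omega * k + 2 * omega * r in
  let Dm := 2 * Ci * omega * k - 2 * omega * r in
  let wp := x0 + Ci * y0 in let wm := x0 - Ci * y0 in
  2 * Ci * (Dp * wm * (s * X - Ci * Y) + Dm * wp * (s * X + Ci * Y))
    = 8 * omega * (x0 * tx + y0 * ty)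
  /\ - (Dp * wm * ((s * X - Ci * Y) + (X' - Ci * s * Y')))
     + Dm * wp * ((s * X + Ci * Y) + (X' + Ci * s * Y'))
    = - (8 * omega * (x0 * ty - y0 * tx)).
Proof.
  intros Hw Hs Hxy -> -> Hwr; cbv zeta.
  assert (I2 : Ci * Ci = - (1)) by (apply C_eq; simpl; ring).
  split.
  - ring [I2].
  - transitivity (- (4 * omega) * (x0 * (s * r * X + k * Y) - y0 * (r * Y - s * k * X))
      - 4 * omega * (X' * (r * x0 + k * y0) - Y' * (s * (r * y0 - k * x0)))).
    + ring [I2].
    + rewrite <- Hwr; ring.
Qed.

Lemma cis_cos_sin (a : R) : cis a = RtoC (cos a) + Ci * RtoC (sin a).
Proof. apply C_eq; unfold cis; simpl; ring. Qed.

Lemma B_is_half_turn (l : nat) (mu omega : R) (Phi Psi : C -> C) :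
  (0 < omega)%R -> D_plus l mu omega <> 0 -> D_minus l mu omega <> 0 ->
  solution_pair l mu omega (Phi, Psi) -> B_defined omega (Phi, Psi) ->
  exists x y : C -> C,
    normalised l mu omega x y /\ Phi 1 * y 0 = x 0
    /\ (forall z, slit z -> fst (B l mu omega (Phi, Psi)) z
          = turned_x l mu y (Clog z) / turned_y l mu x (Clog z))
    /\ (forall z, slit z ->
          turned_x l mu y (Clog z) <> 0 -> turned_y l mu x (Clog z) <> 0 ->
          snd (B l mu omega (Phi, Psi)) z
          = turned_x l mu y (Clog z) * turned_y l mu x (Clog z)
            / (turned_x l mu y 0 * turned_y l mu x 0)).
Proof.
  intros Hw HDp HDm Hsol Hdef; unfold B_defined in Hdef; cbn [fst] in Hdef.
  destruct (normal_form _ _ _ _ _ Hw Hsol)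
    as [x [y [Hn [X0 [Y0 [H0 [Rp [Rm [XP [YP [XM YM]]]]]]]]]]].
  exists x, y; split; [exact Hn|]; split; [exact H0|].
  assert (H := proj1 Hn).
  assert (I2 : Ci * Ci = - (1)) by (apply C_eq; simpl; ring).
  assert (Nw : RtoC omega <> 0) by (apply RtoC_neq_0; lra).
  destruct (turned_neq_0 _ _ _ _ _ Hw Hn HDp HDm) as [Ntx Nty].
  pose (phi := phase omega Phi); fold phi in Hdef, X0, Y0, XP, YP, XM, YM.
  pose (h := (period omega / 2)%R); fold h in XP, YP, XM, YM.
  pose (sgn := (- (1)) ^ l : C).
  pose (ep := RtoC (exp (Pint phi h / 2))).
  pose (em := RtoC (exp (Pint phi (- h) / 2))).
  pose (S := RtoC (sin (phi 0%R))).
  pose (up := sgn * cis (phi h / 2) + Ci * cis (- phi h / 2)).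
  pose (um := sgn * cis (phi h / 2) - Ci * cis (- phi h / 2)).
  pose (vp := cis (phi (- h)%R / 2) + Ci * sgn * cis (- phi (- h)%R / 2)).
  pose (vm := cis (phi (- h)%R / 2) - Ci * sgn * cis (- phi (- h)%R / 2)).
  pose (wp := cis (phi 0%R / 2) + Ci * cis (- phi 0%R / 2)).
  pose (wm := cis (phi 0%R / 2) - Ci * cis (- phi 0%R / 2)).
  pose (Dp := D_plus l mu omega).
  pose (Dm := D_minus l mu omega).
  pose (a := 2 * Ci * ep * (Dp * wm * um + Dm * wp * up)).
  pose (b := - (Dp * wm * (ep * um + em * vm)) + Dm * wp * (ep * up + em * vp)).
  pose (c := Dm * wp * ((2 * S - 1) * ep * up - em * vp)
             + Dp * wm * ((2 * S + 1) * ep * um + em * vm)).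
  pose (d := - (Dm * wp * ((S - 2) * ep * up + S * em * vp))
             + Dp * wm * ((S + 2) * ep * um + S * em * vm)).
  pose (cos0 := RtoC (cos (phi 0%R))).
  assert (Hcos : cos0 <> 0) by (apply RtoC_neq_0, Hdef).
  assert (Hxy : x 0 * y 0 = 1) by (rewrite X0, Y0, Cmult_comm; apply cis_half_inv).
  assert (Exx : x 0 * x 0 = cos0 + Ci * S).
  { rewrite X0, cis_double; apply cis_cos_sin. }
  assert (Eyy : y 0 * y 0 = cos0 - Ci * S).
  { rewrite Y0.
    replace (- phi 0 / 2)%R with ((- phi 0%R) / 2)%R by field.
    rewrite cis_double, cis_cos_sin, cos_neg, sin_neg, RtoC_opp; fold cos0 S; ring. }
  set (tx := turned_x l mu y) in *; set (ty := turned_y l mu x) in *.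
  assert (Ht : linsol l mu omega tx ty) by exact (linsol_turned _ _ _ _ _ H).
  destruct (half_turn_at_1 _ _ _ _ _ Hw H) as [Etx Ety].
  fold (turned_x l mu y) in Etx; fold (turned_y l mu x) in Ety; fold tx in Etx; fold ty in Ety.
  fold sgn in Etx, Ety.
  destruct (climb_at_1 _ _ _ _ _ Hw H) as [Ux Uy]; fold sgn in Ux.
  set (k := coupling omega * poly_p l mu omega l 1).
  set (r := poly_r l mu omega l 1) in *.
  assert (Ep : poly_p l mu omega l 1 = 2 * Ci * omega * k).
  { unfold k, coupling; field; split; [exact Nw|apply Ci_nz]. }
  assert (EX : half_turn x 0 = ep * cis (phi h / 2)).
  { unfold half_turn, ep; rewrite <- XP; f_equal; ring. }
  assert (EY : half_turn y 0 = ep * cis (- phi h / 2)).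
  { unfold half_turn, ep; rewrite <- YP; f_equal; ring. }
  assert (Wr : x 0 * ty 0 - y 0 * tx 0
    = em * cis (phi (- h)%R / 2) * (r * x 0 + k * y 0)
      - em * cis (- phi (- h)%R / 2) * (sgn * (r * y 0 - k * x 0))).
  { rewrite (linsol_wronskian _ _ _ _ _ _ _ H Ht 0 (- (Ci * PI))).
    rewrite XM, YM; unfold tx, ty, turned_x, turned_y, half_turn.
    replace (- (Ci * PI) + Ci * PI) with (RtoC 0) by ring.
    rewrite Ux, Uy; fold k em; ring. }
  destruct (B_coefficients omega (x 0) (y 0) (ep * cis (phi h / 2)) (ep * cis (- phi h / 2))
    (em * cis (phi (- h)%R / 2)) (em * cis (- phi (- h)%R / 2)) k r sgn (tx 0) (ty 0)
    Hw (neg1_sqr l) Hxy) as [Ea Eb].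
  { rewrite Etx, EX, EY; unfold k; ring. }
  { rewrite Ety, EX, EY; unfold k; ring. }
  { exact Wr. }
  assert (EDp : Dp = 2 * Ci * omega * k + 2 * omega * r)
    by (unfold Dp; rewrite D_plus_eq, Ep; reflexivity).
  assert (EDm : Dm = 2 * Ci * omega * k - 2 * omega * r)
    by (unfold Dm; rewrite D_minus_eq, Ep; reflexivity).
  rewrite <- EDp, <- EDm in Ea, Eb.
  assert (Ea' : a = 8 * omega * (x 0 * tx 0 + y 0 * ty 0)).
  { rewrite <- Ea; unfold a, wm, wp, um, up; rewrite <- X0, <- Y0; ring. }
  assert (Eb' : b = - (8 * omega * (x 0 * ty 0 - y 0 * tx 0))).
  { rewrite <- Eb; unfold b, wm, wp, um, up, vm, vp; rewrite <- X0, <- Y0; ring. }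
  assert (Ec : c = - Ci * S * a - b).
  { unfold c, b, a; ring [I2]. }
  assert (Ed : d = - S * b - Ci * a).
  { unfold d, b, a; ring [I2]. }
  (* The factor 8 omega of [B_coefficients] times x0^2 + y0^2 = 2 cos(phi(0)). *)
  set (kap := 16 * omega * cos0).
  assert (Nk : kap <> 0).
  { unfold kap; repeat apply Cmult_neq_0; auto; apply RtoC_neq_0; lra. }
  assert (Main : forall z, a * x z + b * y (- z) = kap * tx z
                        /\ a * y z - b * x (- z) = kap * ty z).
  { assert (L1 := linsol_lin _ _ _ a b _ _ _ _ H (linsol_neg_arg _ _ _ _ _ H)).
    assert (L2 := linsol_lin _ _ _ kap 0 _ _ _ _ Ht Ht).
    intros z; destruct (linsol_unique _ _ _ _ _ _ _ 0 L1 L2) with z as [A1 A2]; cbv beta.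
    - replace (- 0) with (RtoC 0) by ring; rewrite Ea', Eb'.
      transitivity (8 * omega * (tx 0 * (x 0 * x 0 + y 0 * y 0))); [ring|].
      rewrite Exx, Eyy; unfold kap; ring.
    - replace (- 0) with (RtoC 0) by ring; rewrite Ea', Eb'.
      transitivity (8 * omega * (ty 0 * (x 0 * x 0 + y 0 * y 0))); [ring|].
      rewrite Exx, Eyy; unfold kap; ring.
    - cbv beta in A1, A2; split.
      + rewrite A1; ring.
      + replace (a * y z - b * x (- z)) with (a * y z + b * - x (- z)) by ring.
        rewrite A2; ring. }
  split.
  - intros z Sz; destruct (Main (Clog z)) as [M1 M2].
    change (fst (B l mu omega (Phi, Psi)) z) with
      (- ((a * root_plus omega Phi Psi z + b * root_minus omega Phi Psi (/ z))
          / (- a * root_minus omega Phi Psi z + b * root_plus omega Phi Psi (/ z)))).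
    rewrite !Rp, !Rm, !Clog_inv by (auto using slit_inv).
    replace (- a * y (Clog z) + b * x (- Clog z)) with (- (a * y (Clog z) - b * x (- Clog z)))
      by ring.
    rewrite M1, M2.
    destruct (Ceq_dec (ty (Clog z)) 0) as [E|N].
    + rewrite E; replace (- (kap * 0)) with (RtoC 0) by ring; rewrite !Cdiv_0_r; ring.
    + field; split; assumption.
  - intros z Sz Nx Ny; destruct (Main (Clog z)) as [M1 M2]; destruct (Main 0) as [M3 M4].
    change (snd (B l mu omega (Phi, Psi)) z) with
      (/ (1 / (2 * Ci) *
       (1 / cos0 *
          ((- Ci * c * root_minus omega Phi Psi z + d * root_plus omega Phi Psi (/ z))
           / (- a * root_minus omega Phi Psi z + b * root_plus omega Phi Psi (/ z)))
        - 1 / cos0 *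
          ((Ci * c * root_plus omega Phi Psi z + d * root_minus omega Phi Psi (/ z))
           / (a * root_plus omega Phi Psi z + b * root_minus omega Phi Psi (/ z)))))).
    rewrite !Rp, !Rm, !Clog_inv by (auto using slit_inv).
    set (zeta := Clog z) in *.
    replace (- a * y zeta + b * x (- zeta)) with (- (a * y zeta - b * x (- zeta))) by ring.
    assert (Wj := linsol_wronskian _ _ _ _ _ _ _ H (linsol_neg_arg _ _ _ _ _ H) zeta 0).
    cbv beta in Wj; replace (- 0) with (RtoC 0) in Wj by ring.
    assert (Sum : x zeta * x (- zeta) + y zeta * y (- zeta) = 2 * cos0).
    { transitivity (- (x zeta * - x (- zeta) - y zeta * y (- zeta))); [ring|].
      rewrite Wj; transitivity (x 0 * x 0 + y 0 * y 0); [ring|]; rewrite Exx, Eyy; ring. }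
    replace (- 0) with (RtoC 0) in M3, M4 by ring.
    (* The numerator of Theta_B - Theta~_B is constant, by the mirror Wronskian. *)
    assert (Num : (- Ci * c * y zeta + d * x (- zeta)) * (kap * tx zeta)
      - (Ci * c * x zeta + d * y (- zeta)) * - (kap * ty zeta)
      = - (Ci * (kap * tx 0) * (kap * ty 0)) * (2 * cos0)).
    { rewrite <- M1, <- M2, <- M3, <- M4.
      transitivity ((d * a - Ci * c * b) * (x zeta * x (- zeta) + y zeta * y (- zeta))); [ring|].
      rewrite Sum; f_equal; rewrite Ec, Ed.
      transitivity (- (Ci * ((a * a - b * b) * (x 0 * y 0) - a * b * (x 0 * x 0 - y 0 * y 0)))).
      - rewrite Hxy, Exx, Eyy; ring [I2].
      - ring. }
    rewrite M1, M2.
    transitivity (/ (1 / (2 * Ci) * (1 / cos0) *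
      (((- Ci * c * y zeta + d * x (- zeta)) * (kap * tx zeta)
      - (Ci * c * x zeta + d * y (- zeta)) * - (kap * ty zeta))
        / (- (kap * ty zeta) * (kap * tx zeta))))).
    + f_equal; field; repeat split; auto using Ci_nz.
    + rewrite Num; field; repeat split; auto using Ci_nz.
Qed.

Lemma B_solution_pair (l : nat) (mu omega : R) (Phi Psi : C -> C) :
  (0 < omega)%R -> D_plus l mu omega <> 0 -> D_minus l mu omega <> 0 ->
  solution_pair l mu omega (Phi, Psi) -> B_defined omega (Phi, Psi) ->
  solution_pair l mu omega (B l mu omega (Phi, Psi)).
Proof.
  intros Hw HDp HDm Hsol Hdef.
  destruct (B_is_half_turn _ _ _ _ _ Hw HDp HDm Hsol Hdef) as [x [y [Hn [H0 [E1 E2]]]]].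
  destruct (turned_neq_0 _ _ _ _ _ Hw Hn HDp HDm) as [Ntx Nty].
  rewrite (surjective_pairing (B l mu omega (Phi, Psi))).
  apply (linsol_solution_pair _ _ _ (turned_x l mu y) (turned_y l mu x)); auto.
  - apply linsol_turned, Hn.
  - rewrite (turned_y_0 _ _ _ _ _ Hw Hn), Cmod_mult, Cmod_conj, Cmod_pow.
    rewrite Cmod_opp, Cmod_1, pow1; ring.
Qed.

(** The solution attached to the transformed pair is a multiple of the half turn of the
    solution attached to the pair. *)
Lemma B_twice (l : nat) (mu omega : R) (Phi Psi : C -> C) :
  (0 < omega)%R -> D_plus l mu omega <> 0 -> D_minus l mu omega <> 0 ->
  solution_pair l mu omega (Phi, Psi) -> B_defined omega (Phi, Psi) ->
  B_defined omega (B l mu omega (Phi, Psi)) ->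
  exists x y : C -> C, normalised l mu omega x y /\ Phi 1 * y 0 = x 0
    /\ forall z, slit z -> fst (B l mu omega (B l mu omega (Phi, Psi))) z
         = full_turn x (Clog z) / full_turn y (Clog z).
Proof.
  intros Hw HDp HDm Hsol Hdef Hdef1.
  assert (Hsol1 := B_solution_pair _ _ _ _ _ Hw HDp HDm Hsol Hdef).
  destruct (B_is_half_turn _ _ _ _ _ Hw HDp HDm Hsol Hdef) as [x [y [Hn [H0 [E1 _]]]]].
  destruct (turned_neq_0 _ _ _ _ _ Hw Hn HDp HDm) as [Ntx Nty].
  exists x, y; split; [exact Hn|]; split; [exact H0|].
  destruct (B l mu omega (Phi, Psi)) as [Phi1 Psi1]; cbn [fst] in E1.
  destruct (B_is_half_turn _ _ _ _ _ Hw HDp HDm Hsol1 Hdef1) as [x1 [y1 [Hn1 [H1 [F1 _]]]]].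
  assert (S1 : slit 1) by (rewrite <- Cexp_0; apply slit_Cexp, strip_0).
  assert (K := E1 1 S1); rewrite Clog_1 in K; rewrite K in H1.
  assert (Ht := linsol_turned _ _ _ _ _ (proj1 Hn)).
  fold (turned_x l mu y) (turned_y l mu x) in Ht.
  set (tx := turned_x l mu y) in *; set (ty := turned_y l mu x) in *.
  assert (Ny1 : y1 0 <> 0).
  { destruct Hn1 as [_ [M E]]; rewrite E; apply Cmod_gt_0; rewrite Cmod_conj, M; lra. }
  set (tau := y1 0 / ty 0).
  assert (Ntau : tau <> 0).
  { intros E; apply Ny1; replace (y1 0) with (tau * ty 0) by (unfold tau; field; exact Nty).
    rewrite E; ring. }
  assert (L := linsol_lin _ _ _ tau 0 _ _ _ _ Ht Ht).
  assert (Eq : forall z, x1 z = tau * tx z + 0 * tx z /\ y1 z = tau * ty z + 0 * ty z).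
  { apply (linsol_unique _ _ _ _ _ _ _ 0 (proj1 Hn1) L).
    - rewrite <- H1; unfold tau; field; exact Nty.
    - unfold tau; field; exact Nty. }
  assert (Ex1 : x1 = fun z => tau * tx z)
    by (apply functional_extensionality; intros z; rewrite (proj1 (Eq z)); ring).
  assert (Ey1 : y1 = fun z => tau * ty z)
    by (apply functional_extensionality; intros z; rewrite (proj2 (Eq z)); ring).
  destruct (linsol_smooth _ _ _ _ _ Ht) as [Stx Sty].
  assert (Nd : turn_scalar l mu omega <> 0).
  { rewrite turn_scalar_D by exact Hw.
    repeat apply Cmult_neq_0; auto using coupling_neq_0. }
  intros z Sz; rewrite F1 by exact Sz.
  destruct (half_turn_twice _ _ _ _ _ (Clog z) Hw (proj1 Hn)) as [T1 T2].
  fold (turned_x l mu y) (turned_y l mu x) in T1, T2; fold tx in T2; fold ty in T1.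
  unfold turned_x, turned_y, climb_x, climb_y; rewrite Ex1, Ey1, !ladder_scal by assumption.
  assert (T1' : half_turn (fun z => tau * ladder mu (1 - half_l l) l ty z) (Clog z)
    = tau * turn_scalar l mu omega * full_turn x (Clog z)).
  { unfold half_turn; unfold half_turn, climb_x in T1; rewrite T1; ring. }
  assert (T2' : half_turn (fun z => tau * ladder mu (- half_l l) l tx z) (Clog z)
    = tau * turn_scalar l mu omega * full_turn y (Clog z)).
  { unfold half_turn; unfold half_turn, climb_y in T2; rewrite T2; ring. }
  rewrite T1', T2'.
  destruct (Ceq_dec (full_turn y (Clog z)) 0) as [E|N].
  - rewrite E; replace (tau * turn_scalar l mu omega * 0) with (RtoC 0) by ring.
    now rewrite !Cdiv_0_r.
  - field; repeat split; assumption.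
Qed.

Lemma quotient_monodromy (l : nat) (mu omega : R) (Phi Phi2 x y : C -> C) :
  (0 < omega)%R -> solves_R l mu omega Phi -> ex_Cderive Phi 1 ->
  normalised l mu omega x y -> Phi 1 * y 0 = x 0 ->
  (forall z, slit z -> Phi2 z = full_turn x (Clog z) / full_turn y (Clog z)) ->
  is_monodromy Phi Phi2.
Proof.
  intros Hw HR Hex Hn H0 H2; assert (H := proj1 Hn).
  assert (Nx0 : x 0 <> 0) by (apply Cmod_gt_0; rewrite (proj1 (proj2 Hn)); lra).
  assert (Q := solves_R_quotient _ _ _ _ _ _ Hw HR Hex H Nx0 H0).
  (* At the zeros of y the value of F is that of the given functions. *)
  set (F := fun z =>
    if excluded_middle_informative (strip z) then Phi (Cexp z)
    else if excluded_middle_informative (strip (z - 2 * PI * Ci)) then Phi2 (Cexp z)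
    else x z / y z).
  assert (HF : forall z, y z <> 0 -> F z = x z / y z).
  { intros z Ny; unfold F.
    destruct (excluded_middle_informative (strip z)) as [S|_].
    - destruct (Q z S) as [[_ [_ E]]|[E _]]; [exact E|contradiction].
    - destruct (excluded_middle_informative (strip (z - 2 * PI * Ci))) as [S|_]; [|reflexivity].
      replace (Cexp z) with (Cexp (z - 2 * PI * Ci)).
      + rewrite H2, Clog_Cexp by (auto using slit_Cexp).
        unfold full_turn; replace (z - 2 * PI * Ci + 2 * Ci * PI) with z by ring; reflexivity.
      + rewrite <- (Cexp_full (z - 2 * PI * Ci)); f_equal; ring. }
  assert (Cx : forall z, Ccont x z) by (intros z; eapply is_Cderive_Ccont, H).
  assert (Cy : forall z, Ccont y z) by (intros z; eapply is_Cderive_Ccont, H).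
  assert (DF : forall z, y z <> 0 -> ex_Cderive F z).
  { intros z Ny; destruct (H z) as [X Y]; eexists.
    apply (is_Cderive_near (fun w => x w / y w)).
    - eapply near_mono; [exact (Ccont_near_neq _ _ 0 (Cy z) Ny)|].
      intros w Nw; symmetry; now apply HF.
    - apply is_Cderive_div; eassumption. }
  exists F; split.
  - intros z; destruct (Ceq_dec (y z) 0) as [E|N]; [right|left; now apply DF].
    assert (P : pnear z (fun w => y w <> 0)).
    { eapply pnear_mono; [exact (linsol_zeros_isolated _ _ _ _ _ z Hw H Nx0)|].
      intros w _ [_ A]; exact A. }
    split.
    + apply pnear_locally'; eapply pnear_mono; [exact P|]; intros w _; apply DF.
    + apply pole_blows_up, (quotient_blows_up F x y z); auto.
      * intros E'; exact (linsol_not_both_0 _ _ _ _ _ 0 z H Nx0 E' E).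
      * eapply pnear_mono; [exact P|]; intros w _ A; auto.
  - intros z Sz; split.
    + unfold F; destruct (excluded_middle_informative (strip z)) as [_|N]; [reflexivity|].
      contradiction.
    + assert (Ez : z + 2 * PI * Ci - 2 * PI * Ci = z) by ring.
      unfold F; rewrite Ez.
      destruct (excluded_middle_informative (strip (z + 2 * PI * Ci))) as [S|_].
      * exfalso; unfold strip in *; rewrite im_plus in S.
        replace (Im (2 * PI * Ci)) with (2 * PI)%R in S by (simpl; ring).
        lra.
      * destruct (excluded_middle_informative (strip z)) as [_|N]; [|contradiction].
        f_equal; rewrite <- (Cexp_full z); f_equal; ring.
Qed.

Local Close Scope C_scope.

Theorem theorem5 :
  forall (l : nat) (mu omega : R) (Phi Psi : C -> C),
    (1 <= l)%nat ->
    (0 < omega)%R ->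
    D_plus l mu omega <> RtoC 0 ->
    D_minus l mu omega <> RtoC 0 ->
    solution_pair l mu omega (Phi, Psi) ->
    B_defined omega (Phi, Psi) ->
    solution_pair l mu omega (B l mu omega (Phi, Psi))
    /\ (B_defined omega (B l mu omega (Phi, Psi)) ->
        is_monodromy_pair l mu omega (Phi, Psi)
          (B l mu omega (B l mu omega (Phi, Psi)))).
Proof.
  intros l mu omega Phi Psi _ Hw HDp HDm Hsol Hdef.
  assert (Hsol1 := B_solution_pair _ _ _ _ _ Hw HDp HDm Hsol Hdef).
  split; [exact Hsol1|]; intros Hdef1; split.
  - destruct (B_twice _ _ _ _ _ Hw HDp HDm Hsol Hdef Hdef1) as [x [y [Hn [H0 E]]]].
    destruct Hsol as [HR [_ [Hex _]]].
    exact (quotient_monodromy _ _ _ _ _ _ _ Hw HR Hex Hn H0 E).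
  - destruct (B l mu omega (Phi, Psi)) as [Phi1 Psi1].
    now apply B_solution_pair.
Qed.
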